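(* Let $P$ be a stabilizable causal linear time-varying plant with normalized right and left coprime factorizations $P=NM^{-1}=\hat M^{-1}\hat N$, where $M,N,\hat M,\hat N\in\mathcal B_c(\ell^2,\ell^2)$, and let $U,V,\hat U,\hat V\in\mathcal B_c(\ell^2,\ell^2)$ satisfy $$\begin{pmatrix}\hat V&-\hat U\\ -\hat N&\hat M\end{pmatrix}\begin{pmatrix}M&U\\ N&V\end{pmatrix}=\begin{pmatrix}M&U\\ N&V\end{pmatrix}\begin{pmatrix}\hat V&-\hat U\\ -\hat N&\hat M\end{pmatrix}=\begin{pmatrix}I&0\\ 0&I\end{pmatrix}.$$ Define $r_o>0$ by $$r_o^{-1}=\inf_{Q\in\mathcal B_c(\ell^2,\ell^2)}\left\|\begin{pmatrix}U\\ V\end{pmatrix}+\begin{pmatrix}M\\ N\end{pmatrix}Q\right\|,$$ the norm being the operator norm from $\ell^2$ to $\ell^2\oplus\ell^2$. Then $$r_o^{2}=1-\left\|H_{\binom{\hat M^\star}{\hat N^\star}}\right\|^2 ,$$ where $H_{\binom{\hat M^\star}{\hat N^\star}}$ is the time-varying Hankel operator with symbol $\binom{\hat M^\star}{\hat N^\star}$. Moreover, $r_o$ is a bound on the maximal achievable stability margin $r_{opt}$ of $P$ under time-varying coprime factor uncertainty, namely $r_{opt}^{-1}\le r_o^{-1}$, and if $P$ is time-invariant then $r_o=r_{opt}$.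
   Context: $\ell^2$ is the Hilbert space of square-summable sequences $(x_0,x_1,\dots)$. For an integer $k\ge 0$, $P_k$ is the truncation that sets all entries after time $k$ to zero. An operator $A$ is causal if $P_kAP_k=P_kA$ for all $k$; $\mathcal B_c(\ell^2,\ell^2)$ is the algebra of bounded causal linear operators on $\ell^2$ (causality of operators between direct sums is understood with respect to componentwise truncation). $^\star$ denotes the Hilbert space adjoint. Plants and controllers are causal linear (possibly unbounded) operators on $\ell^2$. A right coprime factorization of $P$ is $P=NM^{-1}$ with $M,N\in\mathcal B_c(\ell^2,\ell^2)$ and $XN+YM=I$ for some $X,Y\in\mathcal B_c(\ell^2,\ell^2)$; a left coprime factorization is $P=\hat M^{-1}\hat N$ with $\hat M,\hat N\in\mathcal B_c(\ell^2,\ell^2)$ and $\hat N\hat X+\hat M\hat Y=I$ for some $\hat X,\hat Y\in\mathcal B_c(\ell^2,\ell^2)$. The inverses $M^{-1},\hat M^{-1}$ are taken in the algebra of (possibly unbounded) causal linear systems, i.e. causal linear maps on the space of all sequences. The factorizations are normalized if $M^\star M+N^\star N=I$ (so $\binom MN$ is an isometry $\ell^2\to\ell^2\oplus\ell^2$) and $\hat M\hat M^\star+\hat N\hat N^\star=I$ (so $\binom{-\hat N^\star}{\hat M^\star}$ is an isometry). A controller $C$ stabilizes $P$ if $\begin{pmatrix}I&C\\ P&I\end{pmatrix}$ has a bounded causal inverse on $\ell^2\oplus\ell^2$; equivalently, $C=(U+MQ)(V+NQ)^{-1}$ for some $Q\in\mathcal B_c(\ell^2,\ell^2)$. $P$ is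 stabilizable if some such $C$ exists. $P$ is time-invariant if it commutes with the unilateral shift. For $r>0$, $B_s(P,r)$ is the set of all plants $P_1=N_1M_1^{-1}$ given by a right coprime factorization, with $M_1$ invertible in the algebra of causal linear time-varying systems and $\left\|\binom MN-\binom{M_1}{N_1}\right\|<r$. The maximal achievable stability margin $r_{opt}$ is the supremum of all $r$ for which there is a single controller $C$ that stabilizes every element of $B_s(P,r)$. $\mathcal C_2$ is the Hilbert space of Hilbert–Schmidt operators on $\ell^2$ with inner product $(A,B)=\mathrm{tr}(B^\star A)$, and $\mathcal A_2=\mathcal C_2\cap\mathcal B_c(\ell^2,\ell^2)$. $\mathcal P$ is the orthogonal projection of $\mathcal C_2$ onto $\mathcal A_2$ (lower triangular truncation), applied componentwise on $\mathcal C_2\oplus\mathcal C_2$. The time-varying Hankel operator $H_{\binom{\hat M^\star}{\hat N^\star}}:\mathcal A_2\to(\mathcal C_2\oplus\mathcal C_2)\ominus(\mathcal A_2\oplus\mathcal A_2)$ is $$H_{\binom{\hat M^\star}{\hat N^\star}}A=(I-\mathcal P)\begin{pmatrix}\hat M^\star A\\ \hat N^\star A\end{pmatrix},\qquad A\in\mathcal A_2,$$ and its norm is the operator norm induced by the Hilbert–Schmidt norms. *)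

(* Defs.v *)
From HB Require Import structures.
From mathcomp Require Import all_boot all_order all_algebra.
From mathcomp Require Import all_classical all_reals all_analysis.
From mathcomp Require Import complex ring lra.
Set Implicit Arguments.
Unset Strict Implicit.
Unset Printing Implicit Defensive.
Import Order.TTheory GRing.Theory Num.Theory numFieldNormedType.Exports.
Local Open Scope classical_set_scope.
Local Open Scope ring_scope.

(* Sequences have complex entries; R is the field of real numbers. *)
Notation signal R := (nat -> R[i]).

Definition sqnormc (R : realType) (z : R[i]) : R := complex.Re z ^+ 2 + complex.Im z ^+ 2.

Definition square_summable (R : realType) : {pred signal R} :=
  fun x => `[< (\sum_(n <oo) (sqnormc (x n))%:E < +oo)%E >].

Section ell2_module.
Variable R : realType.
Implicit Types (x y : signal R) (a : R[i]).

Lemma sqnormc_ge0 (z : R[i]) : 0 <= sqnormc z.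
Proof. by rewrite addr_ge0 ?sqr_ge0. Qed.

Lemma sqnormcM (z w : R[i]) : sqnormc (z * w) = sqnormc z * sqnormc w.
Proof.
case: z w => a b [c d]; rewrite /sqnormc /= !expr2.
by rewrite !mulrDl !mulrDr; ring.
Qed.

Lemma sqnormcD (z w : R[i]) : sqnormc (z + w) <= 2 * sqnormc z + 2 * sqnormc w.
Proof.
case: z w => a b [c d]; rewrite /sqnormc /=.
have := sqr_ge0 (a - c); have := sqr_ge0 (b - d); nra.
Qed.

Lemma square_summable_submod : subsemimod_closed (@square_summable R).
Proof.
split; first split.
- apply/asboolP; rewrite eseries0 ?ltry// => n _ _.
  by rewrite /sqnormc /= expr0n addr0.
- move=> x y /asboolP hx /asboolP hy; apply/asboolP.
  apply: (@le_lt_trans _ _ (\sum_(n <oo)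
    ((2%:E * (sqnormc (x n))%:E) + (2%:E * (sqnormc (y n))%:E)))%E).
    apply: lee_nneseries => n _ //; first by rewrite lee_fin sqnormc_ge0.
    by rewrite -!EFinM -EFinD lee_fin sqnormcD.
  rewrite nneseriesD; last 2 first.
  - by move=> n _ _; rewrite -EFinM lee_fin mulr_ge0 ?sqnormc_ge0.
  - by move=> n _ _; rewrite -EFinM lee_fin mulr_ge0 ?sqnormc_ge0.
  rewrite !nneseriesZl; try by move=> *; rewrite lee_fin sqnormc_ge0.
  by rewrite lte_add_pinfty// lte_mul_pinfty// lee_fin.
- move=> a x /asboolP hx; apply/asboolP.
  rewrite (eq_eseriesr (g := fun n => ((sqnormc a)%:E * (sqnormc (x n))%:E)%E)).
    rewrite nneseriesZl; last by move=> *; rewrite lee_fin sqnormc_ge0.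
    by rewrite lte_mul_pinfty// lee_fin sqnormc_ge0.
  by move=> n _; rewrite -EFinM -sqnormcM.
Qed.

HB.instance Definition _ := GRing.isSubmodClosed.Build _ _ (@square_summable R)
  square_summable_submod.

End ell2_module.

Record ell2 (R : realType) : Type := Ell2 {
  ell2_val : signal R;
  ell2_valP : ell2_val \in @square_summable R }.

HB.instance Definition _ (R : realType) := [isSub for @ell2_val R].
HB.instance Definition _ (R : realType) := [Choice of ell2 R by <:].
HB.instance Definition _ (R : realType) := [SubChoice_isSubLmodule of ell2 R by <:].

(* The truncation P_k on arbitrary sequences; the entry at time k is kept. *)
Definition trunc (R : realType) (k : nat) (x : signal R) : signal R :=
  fun n => if (n <= k)%N then x n else 0.

Lemma trunc_summable (R : realType) k (x : signal R) :
  trunc k x \in @square_summable R.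
Proof.
apply/asboolP; rewrite (nneseries_split 0 k.+1); last first.
  by move=> n _; rewrite lee_fin sqnormc_ge0.
rewrite add0n sumEFin eseries0 ?adde0 ?ltry// => n /= kn _.
by rewrite /trunc leqNgt kn /= /sqnormc /= expr0n addr0.
Qed.

Section operators.
Variable R : realType.
Local Notation l2 := (ell2 R).
Local Notation sig := (signal R).

Definition truncl2 (k : nat) (x : sig) : l2 := Ell2 (trunc_summable k x).

Definition trunc_pair (k : nat) (x : l2 * l2) : l2 * l2 :=
  (truncl2 k (ell2_val x.1), truncl2 k (ell2_val x.2)).

Definition unit_vec (n : nat) : l2 := truncl2 n (fun k => (k == n)%:R).

(* Complex series are summed through their real and imaginary parts. *)
Definition csum (u : nat -> R[i]) : R[i] :=
  Complex (limn (series (fun n => complex.Re (u n))))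
          (limn (series (fun n => complex.Im (u n)))).

Definition inner (x y : l2) : R[i] :=
  csum (fun n => ell2_val x n * conjc (ell2_val y n)).

Definition norm2 (x : l2) : R := Num.sqrt (complex.Re (inner x x)).

Definition norm2_pair (x : l2 * l2) : R :=
  Num.sqrt (norm2 x.1 ^+ 2 + norm2 x.2 ^+ 2).

Definition bounded_linear (E F : lmodType R[i]) (nE : E -> R) (nF : F -> R)
    (T : E -> F) : Prop :=
  linear T /\ exists K : R, forall x, nF (T x) <= K * nE x.

Definition opnorm (E F : Type) (nE : E -> R) (nF : F -> R) (T : E -> F) : R :=
  sup [set nF (T x) | x in [set x | nE x <= 1]].

Definition causal_l2 (A : l2 -> l2) : Prop :=
  forall k x, truncl2 k (ell2_val (A (truncl2 k (ell2_val x)))) =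
              truncl2 k (ell2_val (A x)).

Definition Bc : set (l2 -> l2) :=
  [set A | bounded_linear norm2 norm2 A /\ causal_l2 A].

(* The adjoint, selected by its defining property; it exists and is unique for
   bounded operators, the only ones it is applied to. *)
Definition adj (T : l2 -> l2) : l2 -> l2 :=
  xget (0 : l2 -> l2) [set S | forall x y, inner (T x) y = inner x (S y)].

Definition op_col (E F G : Type) (A : E -> F) (B : E -> G) : E -> F * G :=
  fun x => (A x, B x).

Definition op_block (E1 E2 F1 F2 : zmodType) (A : E1 -> F1) (B : E2 -> F1)
    (C : E1 -> F2) (D : E2 -> F2) : E1 * E2 -> F1 * F2 :=
  fun x => (A x.1 + B x.2, C x.1 + D x.2).

(* The algebra of (possibly unbounded) causal linear systems: causal linear maps
   on the space of all sequences. *)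
Definition causal_system : set (sig -> sig) :=
  [set T | linear T /\ forall k x, trunc k (T (trunc k x)) = trunc k (T x)].

(* The causal system determined by A in Bc: by causality, the entry at time k of
   the output only involves the input up to time k. *)
Definition ext (A : l2 -> l2) : sig -> sig :=
  fun x k => ell2_val (A (truncl2 k x)) k.

Definition system_inverse (T S : sig -> sig) : Prop :=
  [/\ causal_system S, T \o S = id & S \o T = id].

Definition right_coprime_factorization (P : sig -> sig) (M N : l2 -> l2) : Prop :=
  [/\ Bc M, Bc N,
      (exists X Y, [/\ Bc X, Bc Y & (X \o N) + (Y \o M) = id]) &
      exists2 Minv, system_inverse (ext M) Minv & P = ext N \o Minv].

Definition left_coprime_factorization (P : sig -> sig) (M N : l2 -> l2) : Prop :=
  [/\ Bc M, Bc N,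
      (exists X Y, [/\ Bc X, Bc Y & (N \o X) + (M \o Y) = id]) &
      exists2 Minv, system_inverse (ext M) Minv & P = Minv \o ext N].

Definition normalized_rcf (P : sig -> sig) (M N : l2 -> l2) : Prop :=
  right_coprime_factorization P M N /\ (adj M \o M) + (adj N \o N) = id.

Definition normalized_lcf (P : sig -> sig) (M N : l2 -> l2) : Prop :=
  left_coprime_factorization P M N /\ (M \o adj M) + (N \o adj N) = id.

Definition sigs_of (z : l2 * l2) : sig * sig := (ell2_val z.1, ell2_val z.2).

(* S is a bounded causal inverse of T, where T is seen as the possibly unbounded
   operator on ell2 (+) ell2 with domain { z | T z in ell2 (+) ell2 }. *)
Definition bounded_causal_inverse (T : sig * sig -> sig * sig)
    (S : l2 * l2 -> l2 * l2) : Prop :=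
  [/\ bounded_linear norm2_pair norm2_pair S,
      (forall k z, trunc_pair k (S (trunc_pair k z)) = trunc_pair k (S z)),
      (forall w, T (sigs_of (S w)) = sigs_of w) &
      (forall z w, T (sigs_of z) = sigs_of w -> S w = z)].

Definition stabilizes (C P : sig -> sig) : Prop :=
  exists S, bounded_causal_inverse (op_block id C P id) S.

Definition stabilizable (P : sig -> sig) : Prop :=
  exists2 C, causal_system C & stabilizes C P.

Definition shift (x : sig) : sig := fun n => if n is m.+1 then x m else 0.

Definition time_invariant (P : sig -> sig) : Prop := P \o shift = shift \o P.

(* B_s(P, r), for P = N M^-1 the given normalized factorization. *)
Definition factor_ball (M N : l2 -> l2) (r : R) : set (sig -> sig) :=
  [set P1 | exists M1 N1, right_coprime_factorization P1 M1 N1 /\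
     opnorm norm2 norm2_pair (op_col M N - op_col M1 N1) < r].

(* r = 0 is admitted (its ball is empty) only so that the supremum is taken in
   [0, +oo] and is 0, not -oo, if no r > 0 qualifies. *)
Definition stability_margin (M N : l2 -> l2) : \bar R :=
  ereal_sup [set r%:E | r in [set r : R | 0 <= r /\
    exists2 C, causal_system C &
      forall P1, factor_ball M N r P1 -> stabilizes C P1]].

Definition trace (A : l2 -> l2) : R[i] :=
  csum (fun n => inner (A (unit_vec n)) (unit_vec n)).

Definition hilbert_schmidt : set (l2 -> l2) :=
  [set A | bounded_linear norm2 norm2 A /\
     (\sum_(n <oo) (norm2 (A (unit_vec n)) ^+ 2)%:E < +oo)%E].

Definition hs_inner (A B : l2 -> l2) : R[i] := trace (adj B \o A).

Definition hs_norm (A : l2 -> l2) : R := Num.sqrt (complex.Re (hs_inner A A)).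

Definition hs_norm_pair (A : (l2 -> l2) * (l2 -> l2)) : R :=
  Num.sqrt (hs_norm A.1 ^+ 2 + hs_norm A.2 ^+ 2).

Definition causal_hs : set (l2 -> l2) := hilbert_schmidt `&` Bc.

(* Orthogonal projection of hilbert_schmidt onto its closed subspace causal_hs. *)
Definition causal_proj (A : l2 -> l2) : l2 -> l2 :=
  xget (0 : l2 -> l2) [set B | causal_hs B /\
    forall D, causal_hs D -> hs_inner (A - B) D = 0].

(* The Hankel operator whose symbol is the column of F and G. *)
Definition hankel (F G A : l2 -> l2) : (l2 -> l2) * (l2 -> l2) :=
  ((F \o A) - causal_proj (F \o A), (G \o A) - causal_proj (G \o A)).

Definition hankel_norm (F G : l2 -> l2) : R :=
  sup [set hs_norm_pair (hankel F G A) |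
        A in [set A | causal_hs A /\ hs_norm A <= 1]].

End operators.

(* Main.v *)
From HB Require Import structures.
From mathcomp Require Import all_boot all_order all_algebra.
From mathcomp Require Import all_classical all_reals all_analysis.
From mathcomp Require Import complex.
From mathcomp Require Import ring lra.
Require Import Defs.
Import Order.TTheory GRing.Theory Num.Theory numFieldNormedType.Exports.
Local Open Scope classical_set_scope.
Local Open Scope ring_scope.
Set Implicit Arguments.
Unset Strict Implicit.
Unset Printing Implicit Defensive.

(** Write [F = (M; N)] and [G = (-Nh, Mh)]. Normalization says that [F] is an
    isometry and [G] a co-isometry, and [G F = 0]. The double Bezout identity
    provides causal [L] and [W] with [L F = 1], [G W = 1], [L W = 0] and
    [F L + W G = 1], which forces [F F* + G* G = 1]. The causal right inverses of
    [G] are [W_Q = (U; V) + F Q]. The causal left inverses of [F] correspond to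
    them one to one, and partners have the same norm, whose square is
    [1 + |F* W_Q|^2] (lemmas [right_bound_of_left] and [left_bound_of_right]).
    Hence [mu = 1 / r_o] is also the least norm of a causal left inverse of [F].

    The Hankel formula. A causal Hilbert-Schmidt operator is a sequence of columns,
    the column [n] being any vector that starts at time [n], and the Hankel
    operator acts column by column. So its norm [h] is the supremum of the norms
    of the corners of [G*] that lead from times at least [n] to times before [n].
    If [x] starts at [n], then pairing [G* x] with [W_Q x], which starts at [n]
    too, shows that the part of [G* x] from time [n] on has norm at least
    [|x| / |W_Q|]. This gives [mu^2 (1 - h^2) >= 1]. Conversely, [corner_bound]
    turns the corner norms of [G*] into the bound [h^2 / (1 - h^2)] for the squared
    norms of the strictly anticausal corners of [F* W], and [causal_completion],
    which is the distance formula for the nest of truncations, finds a causal [Q]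
    with [|F* W + Q|^2] at most that number; this [Q] attains
    [mu^2 = 1 / (1 - h^2)].

    The bound on the margin is a small gain argument. For [Q] with
    [|W_Q| r < 1], the controller [(U + M Q) (V + N Q)^-1] stabilizes
    [N1 M1^-1] because [L F1 = 1 + L (F1 - F)] is a small perturbation of [1]. A
    small diagonal change of [Q] makes [V + N Q] invertible among causal systems.

    For a time-invariant plant and [r > r_o], let [C] stabilize the plant. It
    determines a causal left inverse [L] of [F], and if [C] stabilizes
    [N1 M1^-1] too, then [L F1] is bounded below ([stabilizing_left_inverse]).
    Moving the time origin to [n] shows that the restriction of [L] to inputs
    starting at [n] still has norm at least [mu] ([tail_norm_optimal]), so there
    are inputs [w_0], [w_1], ... in successive finite time windows whose images
    [- u_k] under [L] have norm one although [|w_k| < r]. The perturbation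
    [F1 = F + D] with [D u_k = w_(k+1)] then makes [L F1] map [u_k] to
    [u_k - u_(k+1)] up to small errors, and this is not bounded below. For
    [F1] to be the factorization of a plant it must keep some causal left inverse.
    To this end each [w_k] carries a small component that [G] sees at the first
    time of the window; a causal [K] that reacts to this signal by emitting [u_k]
    makes [(L + K G) D] small, so that [(L + K G) F1] is invertible
    ([chain_perturbation]). *)

Local Notation Re := complex.Re.
Local Notation Im := complex.Im.

(** * Complex numbers and semi-inner products *)

Section complex_numbers.
Variable R : realType.
Implicit Types z w : R[i].

Lemma complexP z w : Re z = Re w -> Im z = Im w -> z = w.
Proof. by case: z w => a b [c d] /= -> ->. Qed.

Lemma Re_sum (I : Type) (r : seq I) (p : pred I) (f : I -> R[i]) :
  Re (\sum_(i <- r | p i) f i) = \sum_(i <- r | p i) Re (f i).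
Proof. exact: (raddf_sum (@complex.Re R)). Qed.

Lemma ReD z w : Re (z + w) = Re z + Re w. Proof. by case: z w => a b []. Qed.
Lemma ReN z : Re (- z) = - Re z. Proof. by case: z. Qed.
Lemma ReB z w : Re (z - w) = Re z - Re w. Proof. by case: z w => a b []. Qed.
Lemma ImD z w : Im (z + w) = Im z + Im w. Proof. by case: z w => a b []. Qed.
Lemma ReM z w : Re (z * w) = Re z * Re w - Im z * Im w.
Proof. by case: z w => a b []. Qed.
Lemma ImM z w : Im (z * w) = Re z * Im w + Im z * Re w.
Proof. by case: z w => a b []. Qed.
Lemma Re_conj z : Re (conjc z) = Re z. Proof. by case: z. Qed.
Lemma Im_conj z : Im (conjc z) = - Im z. Proof. by case: z. Qed.

Lemma mulc_conj z : z * conjc z = (sqnormc z)%:C%C.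
Proof. by apply: complexP; rewrite /sqnormc; case: z => a b /=; ring. Qed.

Lemma sqnormc_conj z : sqnormc (conjc z) = sqnormc z.
Proof. by rewrite /sqnormc Re_conj Im_conj sqrrN. Qed.

Lemma sqnormcN z : sqnormc (- z) = sqnormc z.
Proof. by case: z => a b; rewrite /sqnormc /= !sqrrN. Qed.

Lemma sqnormc0 : sqnormc (0 : R[i]) = 0.
Proof. by rewrite /sqnormc /= expr0n addr0. Qed.

Lemma sqnormc1 : sqnormc (1 : R[i]) = 1.
Proof. by rewrite /sqnormc /= expr0n addr0 expr1n. Qed.

Lemma sqnormcR (r : R) : sqnormc (r%:C%C) = r ^+ 2.
Proof. by rewrite /sqnormc /= expr0n addr0. Qed.

Lemma sqnormc_eq0 z : sqnormc z = 0 -> z = 0.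
Proof.
rewrite /sqnormc => h; have := sqr_ge0 (Re z); have := sqr_ge0 (Im z) => hi hr.
by apply: complexP; apply/eqP; rewrite -sqrf_eq0; apply/eqP => /=; lra.
Qed.

Lemma sqr_Re_le z : Re z ^+ 2 <= sqnormc z.
Proof. by rewrite /sqnormc lerDl sqr_ge0. Qed.

Lemma sqnormcV z : sqnormc (z^-1) = (sqnormc z)^-1.
Proof.
have [->|z0] := eqVneq z 0; first by rewrite invr0 sqnormc0 invr0.
have h : sqnormc z != 0 by apply: contra z0 => /eqP/sqnormc_eq0 ->.
by apply: (mulfI h); rewrite -sqnormcM divff// sqnormc1 divff.
Qed.

End complex_numbers.

Section semi_inner_products.
Variables (R : realType) (V : lmodType R[i]).
Implicit Types (x y z : V) (a : R[i]).

(** Positivity is not strict, because the completion argument uses the forms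
    [tau <x, y> - sum_i phi_i x (phi_i y)^*], which may degenerate. *)
Record semi_inner (B : V -> V -> R[i]) : Prop := SemiInner {
  semi_innerP : forall a x y z, B (a *: x + y) z = a * B x z + B y z;
  semi_innerC : forall x y, B y x = conjc (B x y);
  semi_inner_ge0 : forall x, 0 <= Re (B x x) }.

Variables (B : V -> V -> R[i]) (hB : semi_inner B).
Local Notation q x := (Re (B x x)).

Lemma siDl x y z : B (x + y) z = B x z + B y z.
Proof. by rewrite -[x]scale1r (semi_innerP hB) mul1r scale1r. Qed.
Lemma si0l z : B 0 z = 0.
Proof. by apply: (addrI (B 0 z)); rewrite -siDl !addr0. Qed.
Lemma siZl a x z : B (a *: x) z = a * B x z.
Proof. by rewrite -[a *: x]addr0 (semi_innerP hB) si0l addr0. Qed.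
Lemma siNl x z : B (- x) z = - B x z.
Proof. by rewrite -scaleN1r siZl mulN1r. Qed.
Lemma siBl x y z : B (x - y) z = B x z - B y z.
Proof. by rewrite siDl siNl. Qed.
Lemma siDr x y z : B x (y + z) = B x y + B x z.
Proof. by rewrite (semi_innerC hB) siDl rmorphD /= -!(semi_innerC hB). Qed.
Lemma si0r z : B z 0 = 0.
Proof. by rewrite (semi_innerC hB) si0l rmorph0. Qed.
Lemma siZr a x z : B z (a *: x) = conjc a * B z x.
Proof. by rewrite (semi_innerC hB) siZl rmorphM /= -(semi_innerC hB). Qed.
Lemma siNr x z : B z (- x) = - B z x.
Proof. by rewrite (semi_innerC hB) siNl rmorphN /= -(semi_innerC hB). Qed.
Lemma si_suml I (r : seq I) (f : I -> V) z :
  B (\sum_(i <- r) f i) z = \sum_(i <- r) B (f i) z.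
Proof. by elim/big_ind2: _ => [|x1 x2 y1 y2 <- <-|//]; rewrite ?si0l ?siDl. Qed.
Lemma si_sumr I (r : seq I) (f : I -> V) z :
  B z (\sum_(i <- r) f i) = \sum_(i <- r) B z (f i).
Proof. by elim/big_ind2: _ => [|x1 x2 y1 y2 <- <-|//]; rewrite ?si0r ?siDr. Qed.
Lemma Im_si x : Im (B x x) = 0.
Proof. have := congr1 (@complex.Im R) (semi_innerC hB x x); rewrite Im_conj => h; lra. Qed.
Lemma Re_siC x y : Re (B x y) = Re (B y x).
Proof. by rewrite (semi_innerC hB) Re_conj. Qed.

Lemma sqD x y : q (x + y) = q x + 2 * Re (B x y) + q y.
Proof. by rewrite siDl !siDr !ReD (Re_siC y x); ring. Qed.

Lemma sqZ a x : q (a *: x) = sqnormc a * q x.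
Proof. by rewrite siZl siZr mulrA mulc_conj ReM /= mul0r subr0. Qed.

Lemma sqN x : q (- x) = q x.
Proof. by rewrite siNl siNr opprK. Qed.

Lemma sqB x y : q (x - y) = q x - 2 * Re (B x y) + q y.
Proof. by rewrite sqD sqN siNr ReN mulrN. Qed.

(** The form is evaluated at [x - t <x, y> y] for real [t]; the large [t] used when
    [y] is a null vector shows that it is then orthogonal to everything. *)
Theorem cauchy_schwarz x y : sqnormc (B x y) <= q x * q y.
Proof.
have hx := semi_inner_ge0 hB x; have hy := semi_inner_ge0 hB y.
set b := sqnormc (B x y); have hb : 0 <= b := sqnormc_ge0 _.
have key (t : R) : 0 <= q x - 2 * (t * b) + t ^+ 2 * b * q y.
  have := semi_inner_ge0 hB (x - (t%:C%C * B x y) *: y).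
  rewrite sqB sqZ sqnormcM sqnormcR siZr /b /sqnormc; case: (B x y) => u v /=.
  by rewrite !(mul0r, mulr0, subr0, addr0, oppr0); congr (_ <= _ - 2 * _ + _); ring.
have [hc|hc] := ltP 0 (q y).
  have := key (q y)^-1; rewrite -(ler_pM2r hc); move: (q y) hc => c hc.
  have c0 : c != 0 by rewrite gt_eqF.
  suff -> : (q x - 2 * (c^-1 * b) + c^-1 ^+ 2 * b * c) * c = q x * c - b by lra.
  by field.
have qy0 : q y = 0 by apply: le_anti; rewrite hc hy.
rewrite qy0 mulr0; rewrite leNgt; apply/negP => b0.
have := key ((q x + 1) / (2 * b)); rewrite qy0 mulr0 addr0.
suff -> : 2 * ((q x + 1) / (2 * b) * b) = q x + 1 by lra.
by field; rewrite gt_eqF.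
Qed.

Lemma cauchy_schwarz_Re x y : Re (B x y) ^+ 2 <= q x * q y.
Proof. exact: le_trans (sqr_Re_le _) (cauchy_schwarz x y). Qed.

Lemma Re_si_le x y : Re (B x y) <= Num.sqrt (q x) * Num.sqrt (q y).
Proof.
rewrite -sqrtrM ?semi_inner_ge0//; apply: le_trans (ler_norm _) _.
by rewrite -sqrtr_sqr ler_wsqrtr// cauchy_schwarz_Re.
Qed.

Lemma si_triangle x y :
  Num.sqrt (q (x + y)) <= Num.sqrt (q x) + Num.sqrt (q y).
Proof.
rewrite -[leRHS]ger0_norm ?addr_ge0 ?sqrtr_ge0// -sqrtr_sqr ler_wsqrtr//.
rewrite sqD sqrrD !sqr_sqrtr ?semi_inner_ge0// lerD2r lerD2l.
by rewrite -[leRHS]mulr_natl ler_wpM2l// Re_si_le.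
Qed.

End semi_inner_products.

(** * The Hilbert space of square-summable sequences *)

Section ell2_space.
Variable R : realType.
Local Notation l2 := (ell2 R).
Local Notation "x .[ t ]" := (ell2_val x t) : ring_scope.
Implicit Types (x y z : l2) (s : signal R).

Lemma ell2P x y : (forall t, x.[t] = y.[t]) -> x = y.
Proof. by move=> h; apply/val_inj/funext. Qed.

Lemma ell2_valD x y t : (x + y).[t] = x.[t] + y.[t]. Proof. by []. Qed.
Lemma ell2_valN x t : (- x).[t] = - x.[t]. Proof. by []. Qed.
Lemma ell2_valZ a x t : (a *: x).[t] = a * x.[t]. Proof. by []. Qed.
Lemma ell2_val_sum I (r : seq I) (p : pred I) (f : I -> l2) t :
  (\sum_(i <- r | p i) f i).[t] = \sum_(i <- r | p i) (f i).[t].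
Proof. by elim/big_ind2: _ => // x1 y1 x2 y2 <- <-. Qed.

(** Partial energies are the tool for convergence: a sequence is in [ell2] as soon
    as they are bounded, and its squared norm is their limit. *)
Definition energy s (n : nat) : R := \sum_(0 <= k < n) sqnormc (s k).

Lemma energy_nd s : {homo energy s : m n / (m <= n)%N >-> m <= n}.
Proof.
by apply/nondecreasing_seqP => n; rewrite /energy big_nat_recr//= lerDl sqnormc_ge0.
Qed.

Lemma energy_ge0 s n : 0 <= energy s n.
Proof. by apply: sumr_ge0 => k _; exact: sqnormc_ge0. Qed.

Lemma energy_bounded x : exists c, forall n, energy (ell2_val x) n <= c.
Proof.
have /asboolP := ell2_valP x; set S := (X in (X < _)%E) => hS.
have S0 : (0 <= S)%E by apply: nneseries_ge0 => n _ _; rewrite lee_fin sqnormc_ge0.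
exists (fine S) => n; rewrite -lee_fin fineK ?ge0_fin_numE// /energy -sumEFin.
by apply: nneseries_lim_ge => k _ _; rewrite lee_fin sqnormc_ge0.
Qed.

Lemma energy_cvgP x : cvgn (energy (ell2_val x)).
Proof.
have [c hc] := energy_bounded x; apply: nondecreasing_is_cvgn (@energy_nd _) _.
by exists c => _ [n _ <-].
Qed.

Lemma bounded_energy_summable s (c : R) :
  (forall n, energy s n <= c) -> s \in @square_summable R.
Proof.
move=> h; apply/asboolP; apply: (@le_lt_trans _ _ c%:E); last exact: ltry.
apply: lime_le.
  by apply: is_cvg_nneseries => n _ _; rewrite lee_fin sqnormc_ge0.
by apply: nearW => n; rewrite sumEFin lee_fin; exact: h.
Qed.

Definition nsq x : R := limn (energy (ell2_val x)).

Lemma energy_cvg x : energy (ell2_val x) @ \oo --> nsq x.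
Proof. exact: energy_cvgP. Qed.

Lemma energy_le_nsq x n : energy (ell2_val x) n <= nsq x.
Proof. exact: (nondecreasing_cvgn_le (@energy_nd _) (@energy_cvgP x)). Qed.

Lemma nsq_le x c : (forall n, energy (ell2_val x) n <= c) -> nsq x <= c.
Proof.
move=> h; apply: limr_le; first exact: energy_cvgP.
by apply: nearW.
Qed.

(** Polarization: the convergence of inner products follows from that of
    energies. *)
Lemma ReM_conj_polar (z w : R[i]) :
  Re (z * conjc w) = 2^-1 * (sqnormc (z + w) - sqnormc z - sqnormc w).
Proof. by case: z w => a b [c d]; rewrite /sqnormc /=; field. Qed.

Lemma ReM_conj_cvg x y : cvgn (series (fun n => Re (x.[n] * conjc y.[n]))).
Proof.
have -> : series (fun n => Re (x.[n] * conjc y.[n])) =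
    (fun n => 2^-1 * (energy (ell2_val (x + y)) n - energy (ell2_val x) n
                      - energy (ell2_val y) n)).
  apply/funext => n; rewrite /series /energy /= -!sumrB mulr_sumr.
  by apply: eq_bigr => k _; rewrite ReM_conj_polar.
apply: is_cvgMr; apply: is_cvgB; last exact: energy_cvgP.
by apply: is_cvgB; exact: energy_cvgP.
Qed.

Lemma ImM_conj_cvg x y : cvgn (series (fun n => Im (x.[n] * conjc y.[n]))).
Proof.
have -> : (fun n => Im (x.[n] * conjc y.[n])) =
    (fun n => Re (x.[n] * conjc (('i%C *: y) : l2).[n])).
  apply/funext => n; rewrite ell2_valZ; case: (x.[n]) (y.[n]) => a b [c d] /=; ring.
exact: ReM_conj_cvg.
Qed.

Lemma inner_Re_cvg x y :
  series (fun n => Re (x.[n] * conjc y.[n])) @ \oo --> Re (inner x y).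
Proof. exact: ReM_conj_cvg. Qed.

Lemma inner_Im_cvg x y :
  series (fun n => Im (x.[n] * conjc y.[n])) @ \oo --> Im (inner x y).
Proof. exact: ImM_conj_cvg. Qed.

Lemma inner_uniq x y (z : R[i]) :
  series (fun n => Re (x.[n] * conjc y.[n])) @ \oo --> Re z ->
  series (fun n => Im (x.[n] * conjc y.[n])) @ \oo --> Im z -> inner x y = z.
Proof.
by move=> hr hi; apply: complexP => /=; apply/cvg_lim.
Qed.

Lemma nsqE x : nsq x = Re (inner x x).
Proof.
apply/esym/cvg_lim => //=; have -> : (fun n => Re (x.[n] * conjc x.[n])) =
  (fun n => sqnormc x.[n]) by apply/funext => n; rewrite mulc_conj.
exact: energy_cvg.
Qed.

Lemma innerP a x y z : inner (a *: x + y) z = a * inner x z + inner y z.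
Proof.
apply: inner_uniq.
- have -> : series (fun n => Re ((a *: x + y).[n] * conjc z.[n])) =
    (fun n => Re a * series (fun n => Re (x.[n] * conjc z.[n])) n
            - Im a * series (fun n => Im (x.[n] * conjc z.[n])) n
            + series (fun n => Re (y.[n] * conjc z.[n])) n).
    apply/funext => n; rewrite /series; cbv beta; rewrite !mulr_sumr -sumrB -big_split.
    by apply: eq_bigr => k _; rewrite ell2_valD ell2_valZ mulrDl ReD -mulrA (ReM a).
  rewrite ReD (ReM a); apply: cvgD; last exact: inner_Re_cvg.
  by apply: cvgB; apply: cvgMr; [exact: inner_Re_cvg|exact: inner_Im_cvg].
- have -> : series (fun n => Im ((a *: x + y).[n] * conjc z.[n])) =
    (fun n => Re a * series (fun n => Im (x.[n] * conjc z.[n])) n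
            + Im a * series (fun n => Re (x.[n] * conjc z.[n])) n
            + series (fun n => Im (y.[n] * conjc z.[n])) n).
    apply/funext => n; rewrite /series; cbv beta; rewrite !mulr_sumr -!big_split.
    by apply: eq_bigr => k _; rewrite ell2_valD ell2_valZ mulrDl ImD -mulrA (ImM a).
  rewrite ImD (ImM a); apply: cvgD; last exact: inner_Im_cvg.
  by apply: cvgD; apply: cvgMr; [exact: inner_Im_cvg|exact: inner_Re_cvg].
Qed.

Lemma inner_semi : semi_inner (@inner R).
Proof.
split; first exact: innerP.
- move=> x y; apply: inner_uniq.
    rewrite Re_conj; have -> : (fun n => Re (y.[n] * conjc x.[n])) =
      (fun n => Re (x.[n] * conjc y.[n])).
      by apply/funext => n; case: (x.[n]) (y.[n]) => a b [c d] /=; ring.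
    exact: inner_Re_cvg.
  rewrite Im_conj; have -> : (fun n => Im (y.[n] * conjc x.[n])) =
      (fun n => - Im (x.[n] * conjc y.[n])).
    by apply/funext => n; case: (x.[n]) (y.[n]) => a b [c d] /=; ring.
  have -> : series (fun n => - Im (x.[n] * conjc y.[n])) =
      - series (fun n => Im (x.[n] * conjc y.[n])).
    by apply/funext => n; rewrite /series /= sumrN.
  by apply: cvgN; exact: inner_Im_cvg.
- move=> x; rewrite -nsqE; apply: le_trans (energy_le_nsq x 0).
  exact: energy_ge0.
Qed.

Lemma nsq_ge0 x : 0 <= nsq x.
Proof. by rewrite nsqE; exact: semi_inner_ge0 inner_semi _. Qed.

Lemma norm2_sqr x : norm2 x ^+ 2 = nsq x.
Proof. by rewrite sqr_sqrtr -nsqE// nsq_ge0. Qed.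

Lemma norm2E x : norm2 x = Num.sqrt (nsq x).
Proof. by rewrite nsqE. Qed.

Lemma norm2_ge0 x : 0 <= norm2 x.
Proof. exact: sqrtr_ge0. Qed.

Lemma sqnormc_le_nsq x t : sqnormc x.[t] <= nsq x.
Proof.
apply: le_trans (energy_le_nsq x t.+1); rewrite /energy big_nat_recr//=.
by rewrite lerDr; exact: energy_ge0.
Qed.

Lemma nsq_eq0 x : nsq x = 0 -> x = 0.
Proof.
move=> h; apply: ell2P => t; apply: sqnormc_eq0; apply: le_anti.
by rewrite sqnormc_ge0 -h sqnormc_le_nsq.
Qed.

Lemma nsq0 : nsq 0 = 0. Proof. by rewrite nsqE (si0l inner_semi). Qed.
Lemma nsqZ a x : nsq (a *: x) = sqnormc a * nsq x.
Proof. by rewrite !nsqE (sqZ inner_semi). Qed.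
Lemma nsqN x : nsq (- x) = nsq x.
Proof. by rewrite !nsqE (sqN inner_semi). Qed.
Lemma nsqD x y : nsq (x + y) = nsq x + 2 * Re (inner x y) + nsq y.
Proof. by rewrite !nsqE (sqD inner_semi). Qed.
Lemma nsqB x y : nsq (x - y) = nsq x - 2 * Re (inner x y) + nsq y.
Proof. by rewrite !nsqE (sqB inner_semi). Qed.
Lemma norm2D x y : norm2 (x + y) <= norm2 x + norm2 y.
Proof. exact: si_triangle inner_semi _ _. Qed.
Lemma norm2Z a x : norm2 (a *: x) = Num.sqrt (sqnormc a) * norm2 x.
Proof. by rewrite !norm2E nsqZ sqrtrM ?sqnormc_ge0. Qed.
Lemma norm2N x : norm2 (- x) = norm2 x.
Proof. by rewrite !norm2E nsqN. Qed.
Lemma norm20 : norm2 (0 : l2) = 0.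
Proof. by rewrite norm2E nsq0 sqrtr0. Qed.
Lemma norm2_sum I (r : seq I) (f : I -> l2) :
  norm2 (\sum_(i <- r) f i) <= \sum_(i <- r) norm2 (f i).
Proof.
elim: r => [|i r ih]; first by rewrite !big_nil norm20.
by rewrite !big_cons; apply: le_trans (norm2D _ _) _; rewrite lerD2l.
Qed.
Lemma norm2_eq0 x : norm2 x = 0 -> x = 0.
Proof. by move=> h; apply: nsq_eq0; rewrite -norm2_sqr h expr0n. Qed.

Definition starts n x := forall t, (t < n)%N -> x.[t] = 0.
Definition ends n x := forall t, (n <= t)%N -> x.[t] = 0.

(** [head n] keeps the times before [n], whereas [truncl2 k] keeps those up to [k];
    with this indexing [head 0 = 0] and [tail 0] is the identity. *)
Definition head n x : l2 := if n is k.+1 then truncl2 k (ell2_val x) else 0.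
Definition tail n x : l2 := x - head n x.

Lemma headE n x t : (head n x).[t] = if (t < n)%N then x.[t] else 0.
Proof. by case: n. Qed.
Lemma tailE n x t : (tail n x).[t] = if (t < n)%N then 0 else x.[t].
Proof. by rewrite ell2_valD ell2_valN headE; case: ifP; rewrite ?subrr ?subr0. Qed.
Lemma head_tail n x : head n x + tail n x = x.
Proof. by rewrite addrC subrK. Qed.
Lemma tail_starts n x : starts n (tail n x).
Proof. by move=> t h; rewrite tailE h. Qed.
Lemma head_ends n x : ends n (head n x).
Proof. by move=> t h; rewrite headE ltnNge h. Qed.
Lemma starts_tail n x : starts n x -> tail n x = x.
Proof. by move=> h; apply: ell2P => t; rewrite tailE; case: ifP => // /h ->. Qed.
Lemma starts_head n x : starts n x -> head n x = 0.
Proof. by move=> h; apply: ell2P => t; rewrite headE; case: ifP => // /h ->. Qed.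
Lemma head_starts n x : head n x = 0 -> starts n x.
Proof.
by move=> h t tn; have := congr1 (fun y => y.[t]) h; rewrite /= headE tn.
Qed.
Lemma ends_head n x : ends n x -> head n x = x.
Proof.
by move=> h; apply: ell2P => t; rewrite headE; case: ltnP => // /h ->.
Qed.

Lemma starts0 n : starts n 0. Proof. by []. Qed.
Lemma startsD n x y : starts n x -> starts n y -> starts n (x + y).
Proof. by move=> hx hy t h; rewrite ell2_valD hx// hy// addr0. Qed.
Lemma startsN n x : starts n x -> starts n (- x).
Proof. by move=> hx t h; rewrite ell2_valN hx// oppr0. Qed.
Lemma startsB n x y : starts n x -> starts n y -> starts n (x - y).
Proof. by move=> hx /startsN; exact: startsD. Qed.
Lemma startsZ n a x : starts n x -> starts n (a *: x).
Proof. by move=> hx t h; rewrite ell2_valZ hx// mulr0. Qed.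
Lemma starts_le m n x : (m <= n)%N -> starts n x -> starts m x.
Proof. by move=> mn h t tm; apply: h; exact: leq_trans tm mn. Qed.
Lemma ends_le m n x : (m <= n)%N -> ends m x -> ends n x.
Proof. by move=> mn h t nt; apply: h; exact: leq_trans mn nt. Qed.

Lemma head_linear n : linear (head n).
Proof.
move=> a x y; apply: ell2P => t; rewrite ell2_valD ell2_valZ !headE.
by case: ifP; rewrite // mulr0 addr0.
Qed.

Lemma csum_finite n (u : nat -> R[i]) : (forall k, (n <= k)%N -> u k = 0) ->
  csum u = \sum_(0 <= k < n) u k.
Proof.
move=> u0; have aux (f : {additive R[i] -> R}) :
    series (fun k => f (u k)) @ \oo --> f (\sum_(0 <= k < n) u k).
  apply: cvg_near_cst; exists n => // m /= nm.
  rewrite /series /= raddf_sum (@big_cat_nat _ _ _ n)//= [X in _ + X]big_nat_cond.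
  by rewrite [X in _ + X]big1 ?addr0// => k /andP[/andP[nk _] _]; rewrite u0// raddf0.
by apply: complexP => /=; apply/cvg_lim => //; exact: aux.
Qed.

Lemma inner_ends n x y : ends n x ->
  inner x y = \sum_(0 <= k < n) x.[k] * conjc y.[k].
Proof.
by move=> h; apply: csum_finite => k nk; rewrite h// mul0r.
Qed.

Lemma inner_ends_starts n x y : ends n x -> starts n y -> inner x y = 0.
Proof.
move=> hx hy; rewrite (inner_ends y hx) big_nat_cond big1// => k /andP[/andP[_ kn] _].
by rewrite hy// conjc0 mulr0.
Qed.

Lemma inner_starts_ends n x y : starts n x -> ends n y -> inner x y = 0.
Proof.
by move=> hx hy; rewrite (semi_innerC inner_semi) (inner_ends_starts hy hx) conjc0.
Qed.

Lemma nsq_ends n x : ends n x -> nsq x = energy (ell2_val x) n.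
Proof.
move=> h; rewrite nsqE (inner_ends x h) Re_sum; apply: eq_bigr => k _.
by rewrite mulc_conj.
Qed.

Lemma nsq_head n x : nsq (head n x) = energy (ell2_val x) n.
Proof.
rewrite (nsq_ends (@head_ends n x)) /energy big_nat_cond [RHS]big_nat_cond.
by apply: eq_bigr => k /andP[/andP[_ kn] _]; rewrite headE kn.
Qed.

Lemma nsq_head_tail n x : nsq x = nsq (head n x) + nsq (tail n x).
Proof.
rewrite -{1}(head_tail n x) nsqD (inner_ends_starts (@head_ends n x) (@tail_starts n x)).
by rewrite mulr0 addr0.
Qed.

Lemma nsq_headD m x y : ends m x -> starts m y -> nsq (x + y) = nsq x + nsq y.
Proof.
by move=> hx hy; rewrite nsqD (inner_ends_starts hx hy) mulr0 addr0.
Qed.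

Lemma nsq_tail_le n x : nsq (tail n x) <= nsq x.
Proof. by rewrite [leRHS](nsq_head_tail n) lerDr nsq_ge0. Qed.
Lemma nsq_head_le n x : nsq (head n x) <= nsq x.
Proof. by rewrite [leRHS](nsq_head_tail n) lerDl nsq_ge0. Qed.
Lemma norm2_head_le n x : norm2 (head n x) <= norm2 x.
Proof. by rewrite !norm2E ler_wsqrtr// nsq_head_le. Qed.

Lemma nsq_le_heads x c : (forall n, nsq (head n x) <= c) -> nsq x <= c.
Proof. by move=> h; apply: nsq_le => n; rewrite -nsq_head. Qed.

Lemma tail_small x (e : R) : 0 < e ->
  exists n0, forall n, (n0 <= n)%N -> nsq (tail n x) <= e.
Proof.
move=> e0; have /cvgrPdist_le /(_ e e0) [n0 _ h] := @energy_cvg x.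
exists n0 => n nn; have := h n nn; rewrite -nsq_head [nsq x](nsq_head_tail n).
by rewrite addrAC subrr add0r ger0_norm ?nsq_ge0.
Qed.

Lemma unit_vecE n t : (unit_vec R n).[t] = (t == n)%:R.
Proof.
by rewrite /= /trunc; case: leqP => // h; case: eqP => // e; rewrite e ltnn in h.
Qed.
Lemma unit_vec_starts n : starts n (unit_vec R n).
Proof. by move=> t h; rewrite unit_vecE; case: eqP => // e; rewrite e ltnn in h. Qed.
Lemma unit_vec_ends n : ends n.+1 (unit_vec R n).
Proof. by move=> t h; rewrite unit_vecE; case: eqP => // e; rewrite e ltnn in h. Qed.

Lemma inner_unitr x n : inner x (unit_vec R n) = x.[n].
Proof.
rewrite -[RHS]conjcK.
rewrite (semi_innerC inner_semi) (inner_ends _ (@unit_vec_ends n)).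
rewrite big_nat_recr//= big_nat_cond big1 ?add0r; last first.
  move=> k /andP[/andP[_ kn] _]; have := unit_vec_starts kn; rewrite /= => ->.
  by rewrite mul0r.
by have := unit_vecE n n; rewrite /= => ->; rewrite eqxx mul1r.
Qed.

Lemma nsq_unit n : nsq (unit_vec R n) = 1.
Proof. by rewrite nsqE inner_unitr unit_vecE eqxx. Qed.

Lemma tail_succ n x : tail n x = x.[n] *: unit_vec R n + tail n.+1 x.
Proof.
apply: ell2P => t; rewrite [LHS]tailE ell2_valD ell2_valZ unit_vecE tailE ltnS.
by case: ltngtP => [h|h|->]; rewrite ?mulr0 ?mulr1 ?add0r ?addr0.
Qed.

Lemma head_succ n x : head n.+1 x = head n x + x.[n] *: unit_vec R n.
Proof.
apply: ell2P => t; rewrite ell2_valD ell2_valZ unit_vecE !headE ltnS.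
by case: ltngtP => [h|h|->]; rewrite ?mulr0 ?mulr1 ?add0r ?addr0.
Qed.

Lemma head_sum n x : head n x = \sum_(0 <= k < n) x.[k] *: unit_vec R k.
Proof.
by elim: n => [|n ih]; [rewrite big_geq|rewrite head_succ ih big_nat_recr].
Qed.

Lemma inner_ext x y : (forall z, inner z x = inner z y) -> x = y.
Proof.
move=> h; apply: ell2P => t; have := congr1 conjc (h (unit_vec R t)).
by rewrite -!(semi_innerC inner_semi) !inner_unitr.
Qed.

End ell2_space.
Arguments nsq {R} x.
Arguments starts {R} n x.
Arguments ends {R} n x.
Arguments head {R} n x.
Arguments tail {R} n x.
Arguments unit_vec : simpl never.
Arguments head : simpl never.
Arguments tail : simpl never.
Opaque inner norm2.

(** * Bounded operators and their adjoints *)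

Section bounded_operators.
Variable R : realType.
Local Notation l2 := (ell2 R).
Local Notation "x .[ t ]" := (ell2_val x t) : ring_scope.

Section linearity.
Variables (E F : lmodType R[i]) (T : E -> F) (hT : linear T).
Lemma lin0 : T 0 = 0.
Proof. by have := hT (-1) 0 0; rewrite scaler0 addr0 scaleN1r addNr. Qed.
Lemma linD x y : T (x + y) = T x + T y.
Proof. by rewrite -{1}[x]scale1r hT scale1r. Qed.
Lemma linZ a x : T (a *: x) = a *: T x.
Proof. by rewrite -[a *: x]addr0 hT lin0 addr0. Qed.
Lemma linN x : T (- x) = - T x.
Proof. by rewrite -scaleN1r linZ scaleN1r. Qed.
Lemma linB x y : T (x - y) = T x - T y.
Proof. by rewrite linD linN. Qed.
Lemma lin_sum I (r : seq I) (f : I -> E) :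
  T (\sum_(i <- r) f i) = \sum_(i <- r) T (f i).
Proof. by elim/big_ind2: _ => [|x1 x2 y1 y2 <- <-|//]; rewrite ?lin0 ?linD. Qed.
End linearity.

Lemma linear_add (E F : lmodType R[i]) (S T : E -> F) :
  linear S -> linear T -> linear (S + T).
Proof.
by move=> hS hT a x y; rewrite /= !fctE hS hT scalerDr !addrA; congr (_ + _); rewrite addrAC.
Qed.

Lemma linear_opp (E F : lmodType R[i]) (S : E -> F) : linear S -> linear (- S).
Proof. by move=> hS a x y; rewrite !fctE hS opprD scalerN. Qed.

Lemma linear_comp (E F G : lmodType R[i]) (S : F -> G) (T : E -> F) :
  linear S -> linear T -> linear (S \o T).
Proof. by move=> hS hT a x y /=; rewrite hT hS. Qed.

Definition bnd (c : R) (T : l2 -> l2) := forall x, norm2 (T x) <= c * norm2 x.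

Lemma bnd_sqr c T : bnd c T -> forall x, nsq (T x) <= c ^+ 2 * nsq x.
Proof.
move=> h x; rewrite -!norm2_sqr -exprMn.
by rewrite lerXn2r ?nnegrE ?norm2_ge0// (le_trans _ (h x))// norm2_ge0.
Qed.

Lemma norm2_le_sqr c x y : 0 <= c -> nsq x <= c ^+ 2 * nsq y ->
  norm2 x <= c * norm2 (y : l2).
Proof.
move=> c0 h; rewrite -[c]ger0_norm// -sqrtr_sqr !norm2E -sqrtrM ?sqr_ge0//.
exact: ler_wsqrtr.
Qed.

Lemma bounded_bnd (T : l2 -> l2) : bounded_linear (@norm2 R) (@norm2 R) T ->
  exists2 c, 0 <= c & bnd c T.
Proof.
move=> [_ [K hK]]; exists `|K| => // x; apply: le_trans (hK x) _.
by rewrite ler_wpM2r ?norm2_ge0// ler_norm.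
Qed.

Section adjoint.
Variables (T : l2 -> l2) (hT : bounded_linear (@norm2 R) (@norm2 R) T).

Let adj_coord (y : l2) : signal R := fun t => inner y (T (unit_vec R t)).

(** Cauchy-Schwarz on [y] and [T v], where [v] is the candidate cut at time [n],
    bounds the squared energy [e] of [v] by a multiple of [e] itself. *)
Lemma adj_coord_summable y : adj_coord y \in @square_summable R.
Proof.
have [c c0 hc] := bounded_bnd hT; have linT := hT.1.
apply: (@bounded_energy_summable _ _ (c ^+ 2 * nsq y)) => n.
set e := energy _ _; set v : l2 := \sum_(0 <= t < n) adj_coord y t *: unit_vec R t.
have e0 : 0 <= e := energy_ge0 _ _.
have vE t : v.[t] = if (t < n)%N then adj_coord y t else 0.
  rewrite /v ell2_val_sum; case: ltnP => tn.
    rewrite (bigD1_seq t) ?mem_index_iota ?iota_uniq// big1_seq ?addr0.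
      by rewrite ell2_valZ unit_vecE eqxx mulr1; exact: addr0.
    by move=> i /andP[it _]; rewrite ell2_valZ unit_vecE eq_sym (negbTE it) mulr0.
  rewrite big_nat_cond big1// => i /andP[/andP[_ i_n] _].
  rewrite ell2_valZ unit_vecE; case: eqP; rewrite ?mulr0// => ti.
  by move: i_n; rewrite -ti ltnNge tn.
have nv : nsq v = e.
  have -> : nsq v = energy (ell2_val v) n.
    by apply: nsq_ends => t; rewrite vE leqNgt => /negbTE ->.
  rewrite /e /energy big_nat_cond [RHS]big_nat_cond.
  by apply: eq_bigr => k /andP[/andP[_ kn] _]; rewrite vE kn.
have iv : inner y (T v) = e%:C%C.
  rewrite /v (lin_sum linT) (si_sumr (inner_semi R)) /e /energy rmorph_sum/=.
  apply: eq_bigr => k _; rewrite (linZ linT) (siZr (inner_semi R)).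
  by rewrite mulrC mulc_conj.
have := cauchy_schwarz (inner_semi R) y (T v); rewrite iv sqnormcR -!nsqE => h.
have {}h : e ^+ 2 <= (c ^+ 2 * nsq y) * e.
  rewrite -{2}nv mulrAC; apply: le_trans h _; rewrite mulrC ler_wpM2r ?nsq_ge0//.
  exact: bnd_sqr.
have [->|en] := eqVneq e 0; first by rewrite mulr_ge0 ?sqr_ge0 ?nsq_ge0.
by rewrite -(@ler_pM2r _ e) ?lt_neqAle ?e0 1?eq_sym ?en// -expr2.
Qed.

Let adj_fun y : l2 := Ell2 (adj_coord_summable y).

(** The identity is algebraic on finitely supported [x]; the error for general [x]
    only involves the tail of [x], by boundedness of both sides. *)
Lemma adj_funP x y : inner (T x) y = inner x (adj_fun y).
Proof.
have [c c0 hc] := bounded_bnd hT; have linT := hT.1.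
have fin n : inner (T (head n x)) y = inner (head n x) (adj_fun y).
  rewrite head_sum (lin_sum linT) !(si_suml (inner_semi R)); apply: eq_bigr => k _.
  rewrite (linZ linT) !(siZl (inner_semi R)); congr (_ * _).
  rewrite (semi_innerC (inner_semi R)) [RHS](semi_innerC (inner_semi R)).
  by rewrite inner_unitr.
apply/eqP; rewrite -subr_eq0; apply/eqP/sqnormc_eq0.
set d := _ - _; apply/eqP; rewrite eq_le sqnormc_ge0 andbT.
apply/ler_addgt0Pr => e e0; rewrite add0r.
pose D := 2 * c ^+ 2 * nsq y + 2 * nsq (adj_fun y) + 1.
have D0 : 0 < D.
  by rewrite ltr_wpDl// addr_ge0// !mulr_ge0 ?nsq_ge0// sqr_ge0.
have [n0 /(_ n0 (leqnn _)) hn] := tail_small x (divr_gt0 e0 D0).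
have dE : d = inner (T (tail n0 x)) y + - inner (tail n0 x) (adj_fun y).
  rewrite /d /tail (linB linT) !(siBl (inner_semi R)) fin; ring.
rewrite dE; apply: le_trans (sqnormcD _ _) _; rewrite sqnormcN.
have h1 : sqnormc (inner (T (tail n0 x)) y) <= c ^+ 2 * nsq (tail n0 x) * nsq y.
  apply: le_trans (cauchy_schwarz (inner_semi R) _ _) _; rewrite -!nsqE.
  by rewrite ler_wpM2r ?nsq_ge0// bnd_sqr.
have h2 : sqnormc (inner (tail n0 x) (adj_fun y)) <= nsq (tail n0 x) * nsq (adj_fun y).
  by apply: le_trans (cauchy_schwarz (inner_semi R) _ _) _; rewrite -!nsqE.
have h3 : nsq (tail n0 x) * D <= e by rewrite -ler_pdivlMr.
by move: h3; rewrite /D; have := nsq_ge0 (tail n0 x); lra.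
Qed.

Lemma adjP x y : inner (T x) y = inner x (adj T y).
Proof.
rewrite /adj; case: xgetP => [S _ -> //|/(_ adj_fun) hn].
by exfalso; apply: hn => a b; exact: adj_funP.
Qed.

Lemma adjP' x y : inner (adj T x) y = inner x (T y).
Proof.
by rewrite (semi_innerC (inner_semi R)) -adjP -(semi_innerC (inner_semi R)).
Qed.

Lemma adj_linear : linear (adj T).
Proof.
move=> a x y; apply: inner_ext => z; rewrite -adjP (siDr (inner_semi R)).
by rewrite [RHS](siDr (inner_semi R)) !(siZr (inner_semi R)) -!adjP.
Qed.

Lemma adj_bnd c : 0 <= c -> bnd c T -> bnd c (adj T).
Proof.
move=> c0 hc y; apply: norm2_le_sqr => //; set z := adj T y.
have h : nsq z ^+ 2 <= nsq (T z) * nsq y.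
  by have := cauchy_schwarz_Re (inner_semi R) (T z) y; rewrite adjP -/z -!nsqE.
have [->|z0] := eqVneq (nsq z) 0; first by rewrite mulr_ge0 ?nsq_ge0 ?sqr_ge0.
have zp : 0 < nsq z by rewrite lt_neqAle eq_sym z0 nsq_ge0.
rewrite -(ler_pM2r zp) -expr2 mulrAC; apply: le_trans h _.
by rewrite ler_wpM2r ?nsq_ge0// bnd_sqr.
Qed.

Lemma adj_bounded : bounded_linear (@norm2 R) (@norm2 R) (adj T).
Proof.
split; first exact: adj_linear.
by have [c c0 hc] := bounded_bnd hT; exists c; exact: adj_bnd.
Qed.

End adjoint.
End bounded_operators.

Section causal_operators.
Variable R : realType.
Local Notation l2 := (ell2 R).
Local Notation sig := (signal R).
Local Notation "x .[ t ]" := (ell2_val x t) : ring_scope.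
Implicit Types (A B : l2 -> l2) (x y : l2) (s : sig).

Lemma BcI A c : linear A -> bnd c A ->
  (forall n x, starts n x -> starts n (A x)) -> Bc A.
Proof.
move=> lA bA sA; split; first by split=> //; exists c.
move=> k x; apply: ell2P => t; rewrite /= /trunc; case: leqP => // tk.
apply/eqP; rewrite -subr_eq0 -ell2_valN -ell2_valD -(linB lA).
by apply/eqP; apply: (sA k.+1) => // u uk; rewrite ell2_valD ell2_valN /= /trunc -ltnS uk subrr.
Qed.

Section one_operator.
Variables (A : l2 -> l2) (hA : Bc A).
Lemma Bc_bounded : bounded_linear (@norm2 R) (@norm2 R) A. Proof. exact: hA.1. Qed.
Lemma Bc_lin : linear A. Proof. exact: hA.1.1. Qed.
Lemma Bc_bnd : exists2 c, 0 <= c & bnd c A. Proof. exact: bounded_bnd Bc_bounded. Qed.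
Lemma Bc_starts n x : starts n x -> starts n (A x).
Proof.
case: n => // n sx; have := hA.2 n x.
have -> : truncl2 n (ell2_val x) = 0 by exact: (@starts_head _ n.+1).
rewrite (lin0 Bc_lin) => h; apply: head_starts; rewrite /head -h.
by apply: ell2P => t; rewrite /= /trunc if_same.
Qed.
Lemma Bc_head n x : head n (A (head n x)) = head n (A x).
Proof. by case: n => // n; exact: hA.2. Qed.
End one_operator.

Lemma BcD A B : Bc A -> Bc B -> Bc (A + B).
Proof.
move=> hA hB; have [a a0 ha] := Bc_bnd hA; have [b b0 hb] := Bc_bnd hB.
apply: (@BcI _ (a + b)).
- exact: linear_add (Bc_lin hA) (Bc_lin hB).
- by move=> x; apply: le_trans (norm2D _ _) _; rewrite mulrDl lerD.
- by move=> n x sx; apply: startsD; [exact: Bc_starts hA _ _ sx|exact: Bc_starts hB _ _ sx].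
Qed.

Lemma BcN A : Bc A -> Bc (- A).
Proof.
move=> hA; have [a a0 ha] := Bc_bnd hA; apply: (@BcI _ a).
- exact: linear_opp (Bc_lin hA).
- by move=> x; rewrite norm2N.
- by move=> n x sx; apply: startsN; exact: Bc_starts hA _ _ sx.
Qed.

Lemma BcB A B : Bc A -> Bc B -> Bc (A - B).
Proof. by move=> hA /BcN; exact: BcD. Qed.

Lemma Bc_comp A B : Bc A -> Bc B -> Bc (A \o B).
Proof.
move=> hA hB; have [a a0 ha] := Bc_bnd hA; have [b b0 hb] := Bc_bnd hB.
apply: (@BcI _ (a * b)).
- exact: linear_comp (Bc_lin hA) (Bc_lin hB).
- by move=> x; apply: le_trans (ha _) _; rewrite -mulrA ler_wpM2l.
- by move=> n x sx; apply: (Bc_starts hA); exact: Bc_starts hB _ _ sx.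
Qed.

Lemma Bc_0 : Bc (0 : l2 -> l2).
Proof.
apply: (@BcI _ 0) => [a x y|x|n x _ t _ //]; first by rewrite -[RHS]/(a *: 0 + 0) scaler0 addr0.
by rewrite mul0r norm20.
Qed.

(** Causality lets [ext A] be computed on any truncation that keeps the time in
    question ([ext_val]), which makes [ext] a homomorphism of algebras. *)
Definition sig_head n s : l2 := if n is k.+1 then truncl2 k s else 0.
Lemma sig_headE n s t : (sig_head n s).[t] = if (t < n)%N then s t else 0.
Proof. by case: n. Qed.

Lemma sig_headZD n a s s' :
  sig_head n (a *: s + s') = a *: sig_head n s + sig_head n s'.
Proof.
apply: ell2P => t; rewrite ell2_valD ell2_valZ !sig_headE.
by case: ifP; rewrite // mulr0 addr0.
Qed.

Lemma ext_val A n s t : Bc A -> (t < n)%N -> ext A s t = (A (sig_head n s)).[t].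
Proof.
move=> hA tn; rewrite /ext -/(sig_head t.+1 s); apply/eqP; rewrite -subr_eq0.
rewrite -ell2_valN -ell2_valD -(linB (Bc_lin hA)); apply/eqP.
apply: (Bc_starts hA (n := t.+1)) => // u ut.
by rewrite ell2_valD ell2_valN !sig_headE ut (leq_trans ut tn) subrr.
Qed.

Lemma ext_ell2 A x : Bc A -> ext A (ell2_val x) = ell2_val (A x).
Proof.
move=> hA; apply/funext => t; rewrite (ext_val _ hA (ltnSn t)).
have := congr1 (fun y => y.[t]) (Bc_head hA t.+1 x).
by rewrite !headE ltnSn.
Qed.

Lemma sig_head_ext A n s : Bc A -> sig_head n (ext A s) = head n (A (sig_head n s)).
Proof.
move=> hA; apply: ell2P => t; rewrite sig_headE headE; case: ltnP => // tn.
exact: ext_val.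
Qed.

Lemma ext_comp A B s : Bc A -> Bc B -> ext (A \o B) s = ext A (ext B s).
Proof.
move=> hA hB; apply/funext => t.
rewrite (ext_val _ (Bc_comp hA hB) (ltnSn t)) (ext_val _ hA (ltnSn t)).
rewrite sig_head_ext//=; have := congr1 (fun y => y.[t]) (Bc_head hA t.+1 (B (sig_head t.+1 s))).
by rewrite !headE ltnSn => ->.
Qed.

Lemma ext_add A B s : ext (A + B) s = ext A s + ext B s. Proof. by []. Qed.
Lemma ext_id s : ext id s = s.
Proof. by apply/funext => t; rewrite /ext /= /trunc leqnn. Qed.

Lemma ext_causal A : Bc A -> causal_system (ext A).
Proof.
move=> hA; split.
  move=> a s s'; apply/funext => t; rewrite /ext.
  by rewrite -!/(sig_head t.+1 _) sig_headZD (Bc_lin hA).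
move=> k s; apply/funext => t; rewrite /trunc; case: leqP => // tk.
rewrite !(ext_val _ hA (ltnSn t)); congr ((A _).[t]); apply: ell2P => u.
by rewrite !sig_headE; case: ltnP => // ut; rewrite (leq_trans _ tk).
Qed.

Lemma causal_comp (S T : sig -> sig) :
  causal_system S -> causal_system T -> causal_system (S \o T).
Proof.
move=> [lS cS] [lT cT]; split; first exact: linear_comp.
by move=> k s /=; rewrite -cS cT cS.
Qed.

Definition impulse n : sig := fun k => (k == n)%:R.

Section causal_systems.
Variables (T : sig -> sig) (hT : causal_system T).

Lemma causal_zero n s : (forall t, (t < n)%N -> s t = 0) ->
  forall t, (t < n)%N -> T s t = 0.
Proof.
move=> h t tn; have := congr1 (@^~ t) (hT.2 t s); rewrite /trunc leqnn /= => <-.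
have -> : (fun n0 => if (n0 <= t)%N then s n0 else 0) = 0.
  by apply/funext => u; case: leqP => // ut; rewrite h// (leq_ltn_trans ut tn).
by rewrite (lin0 hT.1).
Qed.

Lemma causal_eq n s s' : (forall t, (t < n)%N -> s t = s' t) ->
  forall t, (t < n)%N -> T s t = T s' t.
Proof.
move=> h t tn; apply/eqP; rewrite -subr_eq0; apply/eqP.
have -> : T s t - T s' t = T (s - s') t by rewrite (linB hT.1).
apply: (causal_zero (n := n)) => // u un; rewrite !fctE h// subrr//.
Qed.

(** If the diagonal entry at [n] vanished, [T (impulse n)] would start after [n],
    and so would its image [impulse n] under the causal inverse. *)
Lemma system_inverse_diag S n : system_inverse T S -> T (impulse n) n != 0.
Proof.
move=> [hS _ ST]; apply/eqP => h0.
have ST' s : S (T s) = s by rewrite -[S (T s)]/((S \o T) s) ST.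
have Tz t : (t < n.+1)%N -> T (impulse n) t = 0.
  rewrite ltnS leq_eqVlt => /orP[/eqP ->//|tn].
  apply: (causal_zero (n := n)) => // u un.
  by rewrite /impulse; case: eqP => // e; rewrite e ltnn in un.
have : S (T (impulse n)) n = 0.
  have -> : S (T (impulse n)) n = S 0 n; last by rewrite (lin0 hS.1).
  have [lS cS] := hS.
  have := congr1 (@^~ n) (cS n (T (impulse n))); rewrite /trunc leqnn /= => <-.
  congr (S _ n); apply/funext => u; case: leqP => // un; exact: Tz.
by rewrite ST' /impulse eqxx => /eqP; rewrite oner_eq0.
Qed.

Hypothesis diag : forall n, T (impulse n) n != 0.

Lemma diag_zero n s : (forall t, (t < n)%N -> T s t = 0) ->
  forall t, (t < n)%N -> s t = 0.
Proof.
move=> h t; elim/ltn_ind: t => t ih tn.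
have -> : s t = (s t * T (impulse t) t) / T (impulse t) t by rewrite mulfK.
suff -> : s t * T (impulse t) t = 0 by rewrite mul0r.
rewrite -(h t tn) -[LHS]/((s t *: T (impulse t)) t) -(linZ hT.1).
apply: (causal_eq (n := t.+1)) => // u; rewrite ltnS leq_eqVlt => /orP[/eqP ->|ut].
  by rewrite /impulse !fctE eqxx -[LHS]/(s t * 1) mulr1.
rewrite (ih u)// ?(ltn_trans ut tn)//.
by rewrite /impulse !fctE (ltn_eqF ut) -[LHS]/(s t * false%:R) mulr0.
Qed.

(** Forward substitution: [approx s n] solves the equation before time [n]. *)
Let step s n (a : sig) : sig :=
  a + ((s n - T a n) / T (impulse n) n) *: impulse n.
Let approx s : nat -> sig :=
  fix approx n := if n is m.+1 then step s m (approx m) else 0.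
Let solve s : sig := fun n => approx s n.+1 n.

Lemma approx_solve s n t : (t < n)%N -> approx s n t = solve s t.
Proof.
elim: n => // n ih; rewrite ltnS leq_eqVlt => /orP[/eqP ->//|tn].
rewrite -ih// [approx s n.+1]/= /step -[LHS]/(_ + _ * impulse n t).
by rewrite /impulse (ltn_eqF tn) mulr0 addr0.
Qed.

Lemma solveP s : T (solve s) = s.
Proof.
apply/funext => n; rewrite -(causal_eq (n := n.+1) (@approx_solve s n.+1) (ltnSn n)).
rewrite [approx _ _]/= /step (linD hT.1) (linZ hT.1).
by rewrite -[LHS]/(_ + _ * T (impulse n) n) divfK// addrC subrK.
Qed.

Lemma system_inverseP : exists S, system_inverse T S.
Proof.
have inj s s' : T s = T s' -> s = s'.
  move=> e; apply/eqP; rewrite -subr_eq0; apply/eqP/funext => t.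
  by apply: (diag_zero (n := t.+1)) => // u _; rewrite (linB hT.1) e subrr.
exists solve; split.
- split.
    by move=> a s s'; apply: inj; rewrite hT.1 !solveP.
  move=> k s; apply/funext => t; rewrite /trunc; case: leqP => // tk.
  apply/eqP; rewrite -subr_eq0; apply/eqP.
  rewrite -[LHS]/((solve (fun n => if (n <= k)%N then s n else 0) - solve s) t).
  apply: (diag_zero (n := k.+1)) => // u uk.
  by rewrite (linB hT.1) !solveP !fctE -ltnS uk subrr.
- by apply/funext => s; exact: solveP.
- by apply/funext => s; apply: inj; rewrite /= solveP.
Qed.

End causal_systems.

Lemma ext_impulse A n t : Bc A -> ext A (impulse n) t = (A (unit_vec R n)).[t].
Proof.
move=> hA; rewrite -ext_ell2//; congr (ext A _ t); apply/funext => u.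
by rewrite unit_vecE.
Qed.

Lemma Bc_inverse J (k : R) : Bc J -> 0 < k ->
  (forall x, exists y, J y = x) ->
  (forall n x, starts n (J x) -> starts n x) ->
  (forall x, norm2 x <= k * norm2 (J x)) ->
  exists J', [/\ Bc J', forall x, J (J' x) = x & forall x, J' (J x) = x].
Proof.
move=> hJ k0 surj sJ bJ.
have [J' hJ'] := choice surj.
have inj x y : J x = J y -> x = y.
  move=> e; apply/eqP; rewrite -subr_eq0; apply/eqP/norm2_eq0/le_anti.
  by rewrite norm2_ge0 (le_trans (bJ _))// (linB (Bc_lin hJ)) e subrr norm20 mulr0.
exists J'; split=> // [|x]; last by apply: inj; rewrite hJ'.
apply: (@BcI _ k).
- by move=> a x y; apply: inj; rewrite (Bc_lin hJ) !hJ'.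
- by move=> x; have := bJ (J' x); rewrite hJ'.
- by move=> n x sx; apply: sJ; rewrite hJ'.
Qed.

(** The truncation to times before [n] of the equation [J y = x] is finite
    triangular, and the bound on [J - 1] makes its solution bounded uniformly in
    [n]. *)
Lemma small_perturbation_inverse J (k : R) : Bc J -> k < 1 ->
  (forall x, norm2 (J x - x) <= k * norm2 x) ->
  exists J', [/\ Bc J', forall x, J (J' x) = x & forall x, J' (J x) = x].
Proof.
move=> hJ k1 hk; have lJ := Bc_lin hJ.
have headJ n (h : l2) : ends n h -> norm2 h <= (1 - k)^-1 * norm2 (head n (J h)).
  move=> eh; rewrite mulrC ler_pdivlMr ?subr_gt0//.
  have : norm2 h <= norm2 (head n (J h)) + norm2 (head n (J h - h)).
    rewrite -[norm2 (head n (J h - h))]norm2N; apply: le_trans (norm2D _ _).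
    rewrite (linB (@head_linear R n)) (ends_head eh).
    by rewrite opprB addrCA subrr addr0.
  have := norm2_head_le n (J h - h); have := hk h; lra.
have k1' : 0 < (1 - k)^-1 by rewrite invr_gt0 subr_gt0.
have diag n : ext J (impulse n) n != 0.
  rewrite ext_impulse//; apply/eqP => h0.
  have := headJ n.+1 (unit_vec R n) (@unit_vec_ends R n).
  have -> : head n.+1 (J (unit_vec R n)) = 0.
    apply: starts_head => t; rewrite ltnS leq_eqVlt => /orP[/eqP ->//|tn].
    by apply: (Bc_starts hJ (n := n)) => //; exact: unit_vec_starts.
  by rewrite norm20 mulr0 norm2E nsq_unit sqrtr1 leNgt ltr01.
have [S [cS JS SJ]] := system_inverseP (ext_causal hJ) diag.
apply: (Bc_inverse (k := (1 - k)^-1)) => //.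
- move=> x; set s := S (ell2_val x).
  have Js : ext J s = ell2_val x by rewrite -[LHS]/((ext J \o S) _) JS.
  have hd n : head n (J (sig_head n s)) = head n x.
    by rewrite -sig_head_ext// Js.
  have sl : s \in @square_summable R.
    apply: (@bounded_energy_summable _ _ (((1 - k)^-1) ^+ 2 * nsq x)) => n.
    have -> : energy s n = nsq (sig_head n s).
      rewrite (@nsq_ends _ n); last by move=> t nt; rewrite sig_headE ltnNge nt.
      rewrite /energy big_nat_cond [RHS]big_nat_cond.
      by apply: eq_bigr => i /andP[/andP[_ i_n] _]; rewrite sig_headE i_n.
    rewrite -!norm2_sqr -exprMn lerXn2r ?nnegrE ?mulr_ge0 ?norm2_ge0 ?(ltW k1')//.
    apply: le_trans (headJ n _ _) _; first by move=> t nt; rewrite sig_headE ltnNge nt.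
    by rewrite hd ler_wpM2l ?(ltW k1')// norm2_head_le.
  exists (Ell2 sl); apply/val_inj; rewrite /= -ext_ell2//=.
- move=> n x sx; apply: head_starts; apply: norm2_eq0; apply: le_anti.
  rewrite norm2_ge0 andbT; apply: le_trans (headJ n _ (@head_ends _ n x)) _.
  by rewrite Bc_head// starts_head// norm20 mulr0.
- move=> x; rewrite mulrC ler_pdivlMr ?subr_gt0//.
  have : norm2 x <= norm2 (J x) + norm2 (J x - x).
    rewrite -[norm2 (J x - x)]norm2N; apply: le_trans (norm2D _ _).
    by rewrite opprB addrCA subrr addr0.
  have := hk x; lra.
Qed.

End causal_operators.

(** * Pairs of signals and the geometry of normalized coprime factors *)

Section pairs.
Variable R : realType.
Local Notation l2 := (ell2 R).
Implicit Types (x y : l2) (z w : l2 * l2).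

Definition inner2 z w : R[i] := inner z.1 w.1 + inner z.2 w.2.
Definition nsq2 z : R := nsq z.1 + nsq z.2.
Definition starts2 n z := starts n z.1 /\ starts n z.2.
Definition tail2 n z : l2 * l2 := (tail n z.1, tail n z.2).
Definition head2 n z : l2 * l2 := (head n z.1, head n z.2).
Definition row (A B : l2 -> l2) z : l2 := A z.1 + B z.2.

Lemma inner2_semi : semi_inner inner2.
Proof.
split.
- by move=> a x y z; rewrite /inner2 !innerP /=; ring.
- move=> x y; rewrite /inner2 rmorphD /=.
  by rewrite (semi_innerC (inner_semi R)) [X in _ + X](semi_innerC (inner_semi R)).
- by move=> x; rewrite ReD addr_ge0// semi_inner_ge0//; exact: inner_semi.
Qed.

Lemma nsq2E z : nsq2 z = Re (inner2 z z).
Proof. by rewrite /nsq2 !nsqE ReD. Qed.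
Lemma nsq2_ge0 z : 0 <= nsq2 z. Proof. by rewrite addr_ge0 ?nsq_ge0. Qed.
Lemma nsq2D z w : nsq2 (z + w) = nsq2 z + 2 * Re (inner2 z w) + nsq2 w.
Proof. by rewrite !nsq2E (sqD inner2_semi). Qed.
Lemma nsq2Z a z : nsq2 (a *: z) = sqnormc a * nsq2 z.
Proof. by rewrite !nsq2E (sqZ inner2_semi). Qed.
Lemma nsq2N z : nsq2 (- z) = nsq2 z.
Proof. by rewrite !nsq2E (sqN inner2_semi). Qed.
Lemma norm2_pair_sqr z : norm2_pair z ^+ 2 = nsq2 z.
Proof. by rewrite sqr_sqrtr ?addr_ge0 ?sqr_ge0// !norm2_sqr. Qed.
Lemma norm2_pairE z : norm2_pair z = Num.sqrt (nsq2 z).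
Proof. by rewrite /norm2_pair !norm2_sqr. Qed.
Lemma norm2_pair_ge0 z : 0 <= norm2_pair z. Proof. exact: sqrtr_ge0. Qed.
Lemma norm2_pairD z w : norm2_pair (z + w) <= norm2_pair z + norm2_pair w.
Proof. by rewrite !norm2_pairE !nsq2E; exact: si_triangle inner2_semi _ _. Qed.
Lemma norm2_pairZ a z : norm2_pair (a *: z) = Num.sqrt (sqnormc a) * norm2_pair z.
Proof. by rewrite !norm2_pairE nsq2Z sqrtrM ?sqnormc_ge0. Qed.
Lemma norm2_pairN z : norm2_pair (- z) = norm2_pair z.
Proof. by rewrite !norm2_pairE nsq2N. Qed.
Lemma norm2_pair0 : norm2_pair (0 : l2 * l2) = 0.
Proof. by rewrite norm2_pairE /nsq2 /= !nsq0 addr0 sqrtr0. Qed.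
Lemma norm2_fst z : norm2 z.1 <= norm2_pair z.
Proof. by rewrite norm2E norm2_pairE ler_wsqrtr// lerDl nsq_ge0. Qed.
Lemma norm2_snd z : norm2 z.2 <= norm2_pair z.
Proof. by rewrite norm2E norm2_pairE ler_wsqrtr// lerDr nsq_ge0. Qed.
Lemma norm2_pair_le z : norm2_pair z <= norm2 z.1 + norm2 z.2.
Proof.
rewrite -[leRHS]ger0_norm ?addr_ge0 ?norm2_ge0// -sqrtr_sqr ler_wsqrtr//.
by rewrite sqrrD addrAC lerDl mulrn_wge0// mulr_ge0 ?norm2_ge0.
Qed.

Lemma nsq2_head_tail n z : nsq2 z = nsq2 (head2 n z) + nsq2 (tail2 n z).
Proof.
by rewrite /nsq2 /= (nsq_head_tail n z.1) (nsq_head_tail n z.2) addrACA.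
Qed.

Lemma inner_tail n x y : inner x (tail n y) = inner (tail n x) y.
Proof.
rewrite -{1}(head_tail n x) -{2}(head_tail n y) (siDl (inner_semi R)).
rewrite (inner_ends_starts (@head_ends _ n x) (@tail_starts _ n y)) add0r.
rewrite [RHS](siDr (inner_semi R)).
by rewrite (inner_starts_ends (@tail_starts _ n x) (@head_ends _ n y)) add0r.
Qed.

Lemma inner2_tail n z w : inner2 z (tail2 n w) = inner2 (tail2 n z) w.
Proof. by rewrite /inner2 /= !inner_tail. Qed.

Lemma tail2_starts n z : starts2 n (tail2 n z).
Proof. by split; exact: tail_starts. Qed.
Lemma starts2_tail n z : starts2 n z -> tail2 n z = z.
Proof. by case: z => a b [/= ha hb]; rewrite /tail2 /= !starts_tail. Qed.

Lemma inner2_ext z w : (forall e, inner2 e z = inner2 e w) -> z = w.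
Proof.
case: z w => a b [c d] h; congr (_, _); apply: inner_ext => e.
  by have := h (e, 0); rewrite /inner2 /= !(si0l (inner_semi R)) !addr0.
by have := h (0, e); rewrite /inner2 /= !(si0l (inner_semi R)) !add0r.
Qed.

Lemma row_linear A B : linear A -> linear B -> linear (row A B).
Proof. by move=> lA lB a x y; rewrite /row /= lA lB scalerDr !addrA; congr (_ + _); rewrite addrAC. Qed.
Lemma col_linear (A B : l2 -> l2) : linear A -> linear B -> linear (op_col A B).
Proof. by move=> lA lB a x y; rewrite /op_col lA lB. Qed.

Lemma row_starts A B n z : Bc A -> Bc B -> starts2 n z -> starts n (row A B z).
Proof. by move=> hA hB [h1 h2]; apply: startsD; apply: Bc_starts. Qed.
Lemma col_starts A B n x : Bc A -> Bc B -> starts n x -> starts2 n (op_col A B x).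
Proof. by move=> hA hB h; split; apply: Bc_starts. Qed.

Lemma row_head A B n z : Bc A -> Bc B ->
  head n (row A B (head2 n z)) = head n (row A B z).
Proof.
move=> hA hB; rewrite /row !(linD (@head_linear R n)) /=.
by rewrite (Bc_head hA) (Bc_head hB).
Qed.

Lemma pairE z : (z.1, z.2) = z. Proof. by case: z. Qed.

End pairs.
Arguments nsq2 {R} z.
Arguments row {R} A B z.
Arguments starts2 {R} n z.

Section coprime_geometry.
Variable R : realType.
Local Notation l2 := (ell2 R).
Variables M N Mh Nh : l2 -> l2.
Implicit Types (x y : l2) (z w : l2 * l2).

(** [F] is the graph isometry of the plant and [G] the co-isometry whose kernel
    is the range of [F]. *)
Definition graph_map := op_col M N.
Definition graph_adj z : l2 := adj M z.1 + adj N z.2.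
Definition cograph_map := row (- Nh) Mh.
Definition cograph_adj := op_col (- adj Nh) (adj Mh).
Local Notation F := graph_map.
Local Notation Fs := graph_adj.
Local Notation G := cograph_map.
Local Notation Gs := cograph_adj.

Record normalized_pair : Prop := NormalizedPair {
  np_M : Bc M; np_N : Bc N; np_Mh : Bc Mh; np_Nh : Bc Nh;
  graph_isometry : forall x, Fs (F x) = x;
  cograph_coisometry : forall y, G (Gs y) = y;
  cograph_graph : forall x, G (F x) = 0 }.

(** [L] and [W] complete [F] and [G] to a pair of mutually inverse block
    operators. When [V] is invertible among causal systems, [U V^-1] is a
    stabilizing controller of the plant. *)
Record complement (La Lb U V : l2 -> l2) : Prop := Complement {
  cp_La : Bc La; cp_Lb : Bc Lb; cp_U : Bc U; cp_V : Bc V;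
  left_graph : forall x, row La Lb (F x) = x;
  cograph_right : forall y, G (op_col U V y) = y;
  left_right : forall y, row La Lb (op_col U V y) = 0;
  complementP : forall z, F (row La Lb z) + op_col U V (G z) = z }.

Hypothesis hnp : normalized_pair.
Let bM := Bc_bounded (np_M hnp).
Let bN := Bc_bounded (np_N hnp).
Let bMh := Bc_bounded (np_Mh hnp).
Let bNh := Bc_bounded (np_Nh hnp).

Lemma graph_linear : linear F.
Proof. exact: col_linear bM.1 bN.1. Qed.
Lemma cograph_linear : linear G.
Proof. exact: row_linear (linear_opp bNh.1) bMh.1. Qed.
Lemma graph_adj_linear : linear Fs.
Proof.
move=> a x y; rewrite /Fs /= !adj_linear// scalerDr !addrA.
by congr (_ + _); rewrite addrAC.
Qed.

Lemma graph_adjP x z : inner2 (F x) z = inner x (Fs z).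
Proof. by rewrite /inner2 /= !adjP// (siDr (inner_semi R)). Qed.
Lemma cograph_adjP z y : inner (G z) y = inner2 z (Gs y).
Proof.
rewrite /inner2 /= (siDl (inner_semi R)) -[(- Nh) _]/(- Nh z.1).
by rewrite -[(- adj Nh) _]/(- adj Nh y) (siNl (inner_semi R)) (siNr (inner_semi R)) !adjP.
Qed.

Lemma graph_cograph_adj y : Fs (Gs y) = 0.
Proof.
apply: inner_ext => x; rewrite -graph_adjP -cograph_adjP cograph_graph//.
by rewrite (si0l (inner_semi R)) (si0r (inner_semi R)).
Qed.

Lemma nsq2_graph x : nsq2 (F x) = nsq x.
Proof. by rewrite nsq2E graph_adjP graph_isometry// nsqE. Qed.
Lemma nsq2_cograph_adj y : nsq2 (Gs y) = nsq y.
Proof. by rewrite nsq2E -cograph_adjP cograph_coisometry// nsqE. Qed.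

Section one_complement.
Variables (La Lb U V : l2 -> l2) (hc : complement La Lb U V).
Local Notation L := (row La Lb).
Local Notation W := (op_col U V).

Let lL : linear L. Proof. exact: row_linear (Bc_lin (cp_La hc)) (Bc_lin (cp_Lb hc)). Qed.
Let lW : linear W. Proof. exact: col_linear (Bc_lin (cp_U hc)) (Bc_lin (cp_V hc)). Qed.

Lemma cograph_kernel z : G z = 0 -> z = F (L z).
Proof. by move=> h; rewrite -{1}(complementP hc z) h (lin0 lW) addr0. Qed.

(** [F F* + G* G = 1]: a vector killed by both [G] and [F*] lies in the range
    of [F], hence vanishes. *)
Lemma graph_decomposition z : F (Fs z) + Gs (G z) = z.
Proof.
set d := z - (F (Fs z) + Gs (G z)).
have Gd : G d = 0.
  rewrite (linB cograph_linear) (linD cograph_linear) cograph_graph// cograph_coisometry//.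
  by rewrite add0r subrr.
have Fd : Fs d = 0.
  rewrite (linB graph_adj_linear) (linD graph_adj_linear) graph_isometry//.
  by rewrite graph_cograph_adj addr0 subrr.
have := cograph_kernel Gd; rewrite -{1}[L d](graph_isometry hnp) -cograph_kernel// Fd.
by rewrite (lin0 graph_linear) => /eqP; rewrite subr_eq0 => /eqP.
Qed.

Lemma nsq2_decomposition z : nsq2 z = nsq (Fs z) + nsq (G z).
Proof.
rewrite -{1}(graph_decomposition z) nsq2D nsq2_graph nsq2_cograph_adj.
by rewrite graph_adjP graph_cograph_adj (si0r (inner_semi R)) mulr0 addr0.
Qed.

Lemma left_cograph_adj x : L (Gs x) = - Fs (W x).
Proof.
have := left_right hc x; rewrite -{1}(graph_decomposition (W x)) (cograph_right hc).
by rewrite (linD lL) (left_graph hc) addrC => /eqP; rewrite addr_eq0 => /eqP.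
Qed.

Lemma nsq2_right x : nsq2 (W x) = nsq (Fs (W x)) + nsq x.
Proof. by rewrite nsq2_decomposition (cograph_right hc). Qed.

Lemma right_ge1 (c : R) : (forall x, nsq2 (W x) <= c * nsq x) -> 1 <= c.
Proof.
move=> /(_ (unit_vec R 0)); rewrite nsq_unit mulr1 nsq2_right nsq_unit => h.
by have := nsq_ge0 (Fs (W (unit_vec R 0))); lra.
Qed.

(** Both norms are governed by [F* W = - L G*]; the test vector below is the
    one on which a row [(1, a)] attains its norm. *)
Lemma right_bound_of_left (c : R) :
  (forall z, nsq (L z) <= c * nsq2 z) -> forall x, nsq2 (W x) <= c * nsq x.
Proof.
move=> h x.
have c1 : 1 <= c.
  have := h (F (unit_vec R 0)); rewrite (left_graph hc) nsq2_graph nsq_unit; lra.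
rewrite nsq2_right; set a := Fs (W x).
have A0 := nsq_ge0 a; have X0 := nsq_ge0 x.
pose z := - (nsq x)%:C%C *: F a + (nsq a)%:C%C *: Gs x.
have Lz : L z = - (nsq x + nsq a)%:C%C *: a.
  rewrite /z (linD lL) !(linZ lL) (left_graph hc) left_cograph_adj -/a.
  by rewrite scalerN -scalerBl rmorphD opprD.
have Nz : nsq2 z = nsq x ^+ 2 * nsq a + nsq a ^+ 2 * nsq x.
  rewrite /z nsq2D !nsq2Z nsq2_graph nsq2_cograph_adj.
  rewrite (siZl (inner2_semi R)) (siZr (inner2_semi R)) graph_adjP graph_cograph_adj.
  by rewrite (si0r (inner_semi R)) !mulr0 addr0 sqnormcN !sqnormcR.
have := h z; rewrite Lz Nz nsqZ sqnormcN sqnormcR => hz.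
have [a0|a0] := eqVneq (nsq a) 0; first by rewrite a0; nra.
have {}A0 : 0 < nsq a by rewrite lt_neqAle eq_sym a0.
have S0 : 0 < (nsq x + nsq a) * nsq a by rewrite mulr_gt0// ltr_wpDl.
rewrite -(ler_pM2r S0); nra.
Qed.

Lemma left_bound_of_right (c : R) :
  (forall x, nsq2 (W x) <= c * nsq x) -> forall z, nsq (L z) <= c * nsq2 z.
Proof.
move=> h z; have c1 := right_ge1 h.
set b := Fs z; set y := G z; set a := Fs (W y).
have -> : L z = b - a.
  rewrite -{1}(graph_decomposition z) (linD lL) (left_graph hc).
  by rewrite left_cograph_adj.
have ha : nsq a <= (c - 1) * nsq y by have := h y; rewrite nsq2_right -/a; lra.
rewrite nsq2_decomposition -/b -/y nsqB.
have A0 := nsq_ge0 a; have Y0 := nsq_ge0 y; have B0 := nsq_ge0 b.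
have [e|c1'] := eqVneq c 1.
  have a0 : nsq a = 0 by move: ha; rewrite e; lra.
  by rewrite (nsq_eq0 a0) (si0r (inner_semi R)) nsq0 e; lra.
have k0 : 0 < c - 1 by rewrite subr_gt0 lt_neqAle eq_sym c1'.
have := nsq_ge0 ((c - 1)%:C%C *: b + a); rewrite nsqD nsqZ sqnormcR.
rewrite (siZl (inner_semi R)) ReM /= mul0r subr0 => hq.
rewrite -(ler_pM2l k0); nra.
Qed.

(** Pairing [G* x] with [W x], which starts at [n] together with [x]. *)
Lemma tail_cograph_lower (c : R) n x :
  (forall x, nsq2 (W x) <= c * nsq x) -> starts n x ->
  nsq x <= c * nsq2 (tail2 n (Gs x)).
Proof.
move=> h sx; have c1 := right_ge1 h; have X0 := nsq_ge0 x.
have T0 := nsq2_ge0 (tail2 n (Gs x)).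
have e : Re (inner2 (W x) (tail2 n (Gs x))) = nsq x.
  rewrite inner2_tail starts2_tail; last by apply: col_starts => //; case: hc.
  by rewrite -cograph_adjP (cograph_right hc) nsqE.
have := cauchy_schwarz_Re (inner2_semi R) (W x) (tail2 n (Gs x)).
rewrite e -!nsq2E => hcs; have := h x => hx.
have [->|x0] := eqVneq (nsq x) 0; first by rewrite mulr_ge0// (le_trans _ c1).
have {}X0 : 0 < nsq x by rewrite lt_neqAle eq_sym x0.
rewrite -(ler_pM2l X0); nra.
Qed.

(** The dual of the previous estimate. For [y] starting at [n] the vector
    [z = F b + G* y] is the element of least norm with [G z = y] that starts at
    [n], and it is the compression of [G*] applied to some [x]: the adjoint
    of the map from [y] to [z] produces this [x]. *)
Lemma corner_bound (k : R) n y :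
  (forall x, starts n x -> k * nsq x <= nsq2 (tail2 n (Gs x))) -> 0 < k ->
  starts n y -> k * (nsq (head n (Fs (W y))) + nsq y) <= nsq y.
Proof.
move=> h k0 sy; set b := head n _; pose z := F b + Gs y.
have zE : z = W y - F (tail n (Fs (W y))).
  rewrite /z -{1}(graph_decomposition (W y)) (cograph_right hc) /b.
  rewrite -{2}(head_tail n (Fs (W y))) (linD graph_linear).
  by rewrite -[in RHS]addrA -[in RHS]addrA; congr (_ + _); rewrite addrCA subrr addr0.
have sz : starts2 n z.
  have [h1 h2] := col_starts (cp_U hc) (cp_V hc) sy.
  have [h3 h4] := col_starts (np_M hnp) (np_N hnp) (@tail_starts _ n (Fs (W y))).
  by rewrite zE; split; apply: startsB.
have Fz : Fs z = b.
  by rewrite /z (linD graph_adj_linear) graph_isometry// graph_cograph_adj addr0.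
have Gz : G z = y.
  by rewrite /z (linD cograph_linear) cograph_graph// cograph_coisometry// add0r.
pose x := tail n (adj U z.1 + adj V z.2).
have zx : tail2 n (Gs x) = z.
  apply: inner2_ext => e; rewrite inner2_tail -[in RHS](starts2_tail sz) inner2_tail.
  set e' := tail2 n e; have se : starts2 n e' by exact: tail2_starts.
  rewrite -cograph_adjP /x inner_tail starts_tail; last first.
    by apply: row_starts se; [apply: BcN|]; case: hnp.
  have [bU bV] := (Bc_bounded (cp_U hc), Bc_bounded (cp_V hc)).
  rewrite (siDr (inner_semi R)) -!adjP//.
  rewrite -[LHS]/(inner2 (W (G e')) z) -[in RHS](complementP hc e').
  rewrite (siDl (inner2_semi R)) graph_adjP Fz (inner_starts_ends (n := n)) ?add0r//.
    by apply: row_starts se; case: hc.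
  exact: head_ends.
have Zx : nsq2 z = Re (inner y x).
  by rewrite -Gz cograph_adjP -[in RHS](starts2_tail sz) -inner2_tail zx nsq2E.
have := h x (@tail_starts _ n _); rewrite zx => hx.
have := cauchy_schwarz_Re (inner_semi R) y x; rewrite -Zx -!nsqE => hcs.
have Ze : nsq2 z = nsq b + nsq y by rewrite nsq2_decomposition Fz Gz.
rewrite -Ze; have Y0 := nsq_ge0 y; have X0 := nsq_ge0 x; have Z0 := nsq2_ge0 z.
have [->|z0] := eqVneq (nsq2 z) 0; first by rewrite mulr0.
have {}Z0 : 0 < nsq2 z by rewrite lt_neqAle eq_sym z0.
rewrite -(ler_pM2r Z0); nra.
Qed.

Lemma left_shiftE (Q : l2 -> l2) z : linear Q ->
  row (La + (Q \o Nh)) (Lb - (Q \o Mh)) z = L z - Q (G z).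
Proof.
move=> lQ; rewrite /row !fctE /= /G /row (linD lQ) -[(- Nh) z.1]/(- Nh z.1) (linN lQ).
by rewrite opprD opprK addrACA.
Qed.

(** Adding [F Q] to [W] and subtracting [Q G] from [L] are changes that [G F = 0]
    hides from [G] and [F], and that compensate each other in [F L + W G]. *)
Lemma complement_shift (Q : l2 -> l2) : Bc Q ->
  complement (La + (Q \o Nh)) (Lb - (Q \o Mh)) (U + (M \o Q)) (V + (N \o Q)).
Proof.
move=> hQ; have [bLa bLb bU bV _ _ _ _] := hc; have [cM cN cMh cNh _ _ _] := hnp.
have lQ := Bc_lin hQ.
have WE y : op_col (U + (M \o Q)) (V + (N \o Q)) y = W y + F (Q y) by [].
have LE z := left_shiftE z lQ.
split; rewrite ?WE ?LE.
- by apply: BcD => //; apply: Bc_comp.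
- by apply: BcB => //; apply: Bc_comp.
- by apply: BcD => //; apply: Bc_comp.
- by apply: BcD => //; apply: Bc_comp.
- by move=> x; rewrite LE (left_graph hc) cograph_graph// (lin0 lQ) subr0.
- by move=> y; rewrite WE (linD cograph_linear) (cograph_right hc) cograph_graph// addr0.
- move=> y; rewrite LE WE (linD lL) (linD cograph_linear) (cograph_right hc).
  by rewrite (left_right hc) (left_graph hc) cograph_graph// addr0 add0r subrr.
- move=> z; rewrite LE WE (linB graph_linear) -[RHS](complementP hc z).
  by rewrite -addrA; congr (_ + _); rewrite addrCA addNr addr0.
Qed.

(** The parameter is forced: for [W_Q = W + F Q] the equation [L W_Q = 0] reads
    [L W + Q = 0]. *)
Lemma complement_of_left A B : Bc A -> Bc B -> (forall x, row A B (F x) = x) ->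
  exists2 Q, Bc Q & complement A B (U + (M \o Q)) (V + (N \o Q)).
Proof.
move=> hA hB hAB; pose Q : l2 -> l2 := - ((A \o U) + (B \o V)).
have [bLa bLb bU bV _ _ _ _] := hc; have [cM cN cMh cNh _ _ _] := hnp.
have hQ : Bc Q by apply: BcN; apply: BcD; apply: Bc_comp.
have lA : linear (row A B) by exact: row_linear (Bc_lin hA) (Bc_lin hB).
have e z : row (La + (Q \o Nh)) (Lb - (Q \o Mh)) z = row A B z.
  rewrite (left_shiftE z (Bc_lin hQ)) -[in RHS](complementP hc z) (linD lA) hAB.
  by congr (_ + _); rewrite /Q !fctE opprK.
exists Q => //; have [_ _ cU cV c1 c2 c3 c4] := complement_shift hQ.
by split=> // x; rewrite -e.
Qed.

End one_complement.
End coprime_geometry.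

(** * Dominated extension and causal completion *)

Section extension.
Variable R : realType.
Local Notation l2 := (ell2 R).
Local Notation "x .[ t ]" := (ell2_val x t) : ring_scope.

Lemma between (I : Type) (i0 : I) (l u : I -> R) :
  (forall i j, l i <= u j) -> exists a, forall i, l i <= a <= u i.
Proof.
move=> h; exists (sup (range l)) => i; apply/andP; split.
  by apply: ub_le_sup; [exists (u i0) => _ [j _ <-]|exists i].
by apply: sup_le_ub; [exists (l i0); exists i0|move=> _ [j _ <-]].
Qed.

(** The one-dimensional Hahn-Banach step for real scalars. The functional lives
    on a space [D] mapped to [V] by [g], so that the step can be iterated even
    if the new direction [e] already lies in the range of [g]. *)
Lemma real_extension_step (D V : lmodType R[i]) (S : D -> Prop) (f : D -> R)
    (g : D -> V) (p : V -> R) (e : V) :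
  S 0 -> (forall x y, S x -> S y -> S (x + y)) ->
  (forall (r : R) x, S x -> S (r%:C%C *: x)) ->
  (forall x y, f (x + y) = f x + f y) ->
  (forall (r : R) x, f (r%:C%C *: x) = r * f x) ->
  (forall x y, g (x + y) = g x + g y) ->
  (forall (r : R) x, g (r%:C%C *: x) = r%:C%C *: g x) ->
  (forall x y, p (x + y) <= p x + p y) ->
  (forall (r : R) x, p (r%:C%C *: x) = `|r| * p x) ->
  (forall d, S d -> f d <= p (g d)) ->
  exists a, forall d (t : R), S d -> f d + t * a <= p (g d + t%:C%C *: e).
Proof.
move=> S0 SD SZ fD fZ gD gZ pD pZ fp.
pose I := {d | S d}; pose i0 : I := exist _ 0 S0.
have [|a ha] := between i0 (l := fun i => f (sval i) - p (g (sval i) - e))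
  (u := fun i => p (g (sval i) + e) - f (sval i)).
  move=> [d hd] [d' hd'] /=; rewrite lerBrDr addrAC lerBlDr -fD.
  apply: le_trans (fp _ (SD _ _ hd hd')) _; rewrite gD.
  have -> : g d + g d' = (g d' + e) + (g d - e).
    by rewrite addrACA subrr addr0 addrC.
  exact: pD.
exists a => d t hd; have [t0|t0|->] := ltgtP t 0; last first.
- by rewrite mul0r addr0 scale0r addr0; exact: fp.
- have := ha (exist _ _ (SZ t^-1 _ hd)) => /= /andP[_].
  rewrite fZ gZ lerBrDr => h.
  have -> : g d + t%:C%C *: e = t%:C%C *: ((t^-1)%:C%C *: g d + e).
    rewrite scalerDr scalerA -rmorphM mulfV ?gt_eqF//= -[X in X *: g d]/(1%:C%C).
    by rewrite rmorph1 scale1r.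
  rewrite pZ gtr0_norm// -(ler_pM2l t0) in h *.
  by rewrite mulrDr mulrA mulfV ?gt_eqF// mul1r addrC in h.
- have t1 : 0 < - t by rewrite oppr_gt0.
  have := ha (exist _ _ (SZ (- t)^-1 _ hd)) => /= /andP[+ _].
  rewrite fZ gZ lerBlDr => h.
  have -> : g d + t%:C%C *: e = (- t)%:C%C *: (((- t)^-1)%:C%C *: g d - e).
    rewrite scalerBr scalerA -rmorphM mulfV ?gt_eqF//= -[X in X *: g d]/(1%:C%C).
    by rewrite rmorph1 scale1r rmorphN scaleNr opprK.
  rewrite pZ gtr0_norm// -(ler_pM2l t1) in h *.
  rewrite mulrA mulfV ?gt_eqF// mul1r mulrDr in h.
  by move: h; lra.
Qed.

Definition lin_form (V : lmodType R[i]) (phi : V -> R[i]) :=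
  forall a x y, phi (a *: x + y) = a * phi x + phi y.

Lemma lin_formP (V : lmodType R[i]) (phi : V -> R[i]) : lin_form phi ->
  linear (phi : V -> R[i]^o).
Proof. by []. Qed.

(** Two real steps, in the directions [e] and ['i e], extend the real part. The
    complex functional is then recovered from its real part, and rotating the
    argument by [conjc w] turns the bound on the real part into one on the
    modulus. *)
Lemma complex_extension_step (V : lmodType R[i]) (B : V -> V -> R[i])
    (S : V -> Prop) (phi : V -> R[i]) (e : V) :
  semi_inner B -> lin_form phi ->
  S 0 -> (forall x y, S x -> S y -> S (x + y)) -> (forall a x, S x -> S (a *: x)) ->
  (forall s, S s -> sqnormc (phi s) <= Re (B s s)) ->
  exists c, forall s a, S s ->
    sqnormc (phi s + a * c) <= Re (B (s + a *: e) (s + a *: e)).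
Proof.
move=> hB lphi S0 SD SZ hphi; pose p x := Num.sqrt (Re (B x x)).
have pD x y : p (x + y) <= p x + p y := si_triangle hB x y.
have pZc a x : p (a *: x) = Num.sqrt (sqnormc a) * p x.
  by rewrite /p (sqZ hB) sqrtrM ?sqnormc_ge0.
have pZ (r : R) x : p (r%:C%C *: x) = `|r| * p x by rewrite pZc sqnormcR sqrtr_sqr.
have phiD x y : phi (x + y) = phi x + phi y := linD (lin_formP lphi) x y.
have phiZ a x : phi (a *: x) = a * phi x := linZ (lin_formP lphi) a x.
have ReZ (r : R) (z : R[i]) : Re (r%:C%C * z) = r * Re z by rewrite ReM /= mul0r subr0.
have [|||||||a ha] // := @real_extension_step V V S (fun x => Re (phi x)) id p e S0 SD
  (fun r => SZ _).
- by move=> x y; rewrite phiD ReD.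
- by move=> r x; rewrite phiZ ReZ.
- move=> s hs; apply: le_trans (ler_norm _) _; rewrite -sqrtr_sqr ler_wsqrtr//.
  exact: le_trans (sqr_Re_le _) (hphi s hs).
have [||||||||||b hb] // := @real_extension_step (V * R[i]^o)%type V (fun d => S d.1)
  (fun d => Re (phi d.1) + Re d.2 * a) (fun d => d.1 + (Re d.2)%:C%C *: e) p ('i%C *: e).
- by move=> x y; exact: SD.
- by move=> r x; exact: SZ.
- by move=> x y; rewrite /= phiD !ReD; ring.
- by move=> r x; rewrite -[(_ *: x).2]/(r%:C%C * x.2) phiZ !ReZ; ring.
- by move=> x y; rewrite /= ReD rmorphD scalerDl addrACA.
- by move=> r x; rewrite -[(_ *: x).2]/(r%:C%C * x.2) ReZ rmorphM -scalerA scalerDr.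
- by move=> d; exact: ha.
have key s z : S s -> Re (phi s + z * (a -i* b)%C) <= p (s + z *: e).
  move=> hs; have := hb (s, (Re z)%:C%C) (Im z) hs.
  have -> : s + z *: e = s + (Re z)%:C%C *: e + (Im z)%:C%C *: ('i%C *: e).
    rewrite -addrA scalerA -scalerDl; congr (_ + _ *: _).
    by apply: complexP; case: z => u v /=; ring.
  by rewrite ReD ReM /= mulrN opprK addrA.
exists (a -i* b)%C => s z hs; set w := phi s + _.
have := key (conjc w *: s) (conjc w * z) (SZ _ _ hs).
rewrite phiZ -mulrA -mulrDr -/w -scalerA -scalerDr pZc sqnormc_conj.
rewrite mulrC mulc_conj /= => h.
have [->|w0] := eqVneq (sqnormc w) 0; first exact: semi_inner_ge0.
have {}w0 : 0 < sqnormc w by rewrite lt_neqAle eq_sym w0 sqnormc_ge0.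
rewrite -(ler_pM2l w0) -expr2.
rewrite -[leRHS]sqr_sqrtr ?mulr_ge0 ?(ltW w0) ?semi_inner_ge0//.
by rewrite sqrtrM ?(ltW w0)// lerXn2r ?nnegrE ?(ltW w0)// mulr_ge0 ?sqrtr_ge0.
Qed.

(** A functional on the sequences that start at [m] is extended by adding the
    directions [unit_vec (m - 1)], ..., [unit_vec 0] one after the other. *)
Lemma extend_functional (B : l2 -> l2 -> R[i]) m (phi : l2 -> R[i]) :
  semi_inner B -> lin_form phi ->
  (forall x, starts m x -> sqnormc (phi x) <= Re (B x x)) ->
  exists psi, [/\ lin_form psi, forall x, starts m x -> psi x = phi x &
    forall x, sqnormc (psi x) <= Re (B x x)].
Proof.
move=> hB; elim: m phi => [|m ih] phi lphi hphi; first by exists phi; split=> // x; exact: hphi.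
have [|||c hc] // := complex_extension_step (unit_vec R m) hB lphi _ _ _ hphi.
- by move=> x y; exact: startsD.
- by move=> a x; exact: startsZ.
pose phi' x := phi x + (c - phi (unit_vec R m)) * x.[m].
have lphi' : lin_form phi'.
  by move=> a x y; rewrite /phi' lphi ell2_valD ell2_valZ; ring.
have [|psi [lpsi epsi bpsi]] := ih phi' lphi'.
  move=> x sx; have xE : x = x.[m] *: unit_vec R m + tail m.+1 x.
    by rewrite -tail_succ starts_tail.
  have -> : phi' x = phi (tail m.+1 x) + x.[m] * c.
    by rewrite /phi' {1}xE lphi; ring.
  by rewrite [in leRHS]xE [_ *: _ + _]addrC; apply: hc; exact: tail_starts.
exists psi; split=> // x sx; rewrite epsi; last exact: starts_le sx.
by rewrite /phi' sx// mulr0 addr0.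
Qed.

End extension.

(** Dependent choice, where each value may depend on all previous ones. *)
Lemma list_choice (X : Type) (P : seq X -> Prop) :
  P [::] -> (forall l, P l -> exists x, P (rcons l x)) ->
  exists f : nat -> X, forall n, P (mkseq f n).
Proof.
move=> P0 PS.
have [next hn] := choice (fun l : {l | P l} => PS _ (svalP l)).
pose g := fix g n : {l | P l} :=
  if n is m.+1 then exist P _ (hn (g m)) else exist P _ P0.
exists (fun n => next (g n)) => n.
suff -> : mkseq (fun n => next (g n)) n = sval (g n) by exact: svalP.
by elim: n => // n ih; rewrite mkseqS ih.
Qed.

Section completion.
Variable R : realType.
Local Notation l2 := (ell2 R).
Local Notation "x .[ t ]" := (ell2_val x t) : ring_scope.

(** The distance of [T] to the causal operators is the largest norm of its
    strictly anticausal corners. The rows of [T + Q] are chosen one after the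
    other: on inputs starting after time [n] the row [n] is prescribed, the
    corner bound says that it is dominated by what the previous rows leave of
    [tau |x|^2], and a dominated extension to all inputs is the next row. *)
Theorem causal_completion (T : l2 -> l2) (tau : R) :
  bounded_linear (@norm2 R) (@norm2 R) T -> 0 <= tau ->
  (forall n x, starts n x -> nsq (head n (T x)) <= tau * nsq x) ->
  exists2 Q, Bc Q & forall x, nsq (T x + Q x) <= tau * nsq x.
Proof.
move=> bT tau0 corner; have lT := bT.1.
pose rowf (l : seq (l2 -> R[i])) i := nth (fun=> 0) l i.
pose rows l :=
  (forall i, (i < size l)%N -> lin_form (rowf l i) /\
     forall x, starts i.+1 x -> rowf l i x = (T x).[i]) /\
  forall x, \sum_(i < size l) sqnormc (rowf l i x) <= tau * nsq x.
have [||f hf] := @list_choice _ rows.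
- by split=> // x; rewrite big_ord0 mulr_ge0 ?nsq_ge0.
- move=> l [hl bl]; set n := size l.
  pose B x y := tau%:C%C * inner x y - \sum_(i < n) rowf l i x * conjc (rowf l i y).
  have qE x : Re (B x x) = tau * nsq x - \sum_(i < n) sqnormc (rowf l i x).
    rewrite /B ReB nsqE (ReM tau%:C%C) [Re _]/= mul0r subr0 Re_sum; congr (_ - _).
    by apply: eq_bigr => i _; rewrite mulc_conj.
  have hB : semi_inner B.
    split.
    - move=> a x y z; rewrite /B innerP.
      suff -> : \sum_(i < n) rowf l i (a *: x + y) * conjc (rowf l i z) =
          a * \sum_(i < n) rowf l i x * conjc (rowf l i z)
          + \sum_(i < n) rowf l i y * conjc (rowf l i z) by ring.
      rewrite mulr_sumr -big_split; apply: eq_bigr => i _ /=.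
      by rewrite (hl i (ltn_ord i)).1; ring.
    - move=> x y; rewrite /B rmorphB rmorphM rmorph_sum /= oppr0.
      rewrite (semi_innerC (inner_semi R) x y); congr (_ - _).
      by apply: eq_bigr => i _; rewrite rmorphM /= conjcK mulrC.
    - by move=> x; rewrite qE subr_ge0.
  have [|x sx|psi [lpsi epsi bpsi]] := @extend_functional R B n.+1 (fun x => (T x).[n]) hB.
  - by move=> a x y; rewrite lT.
  - rewrite qE lerBrDl; apply: le_trans (corner n.+1 x sx).
    rewrite nsq_head /energy big_mkord big_ord_recr /= lerD2r ler_sum// => i _.
    by rewrite (hl i (ltn_ord i)).2//; apply: starts_le sx; rewrite ltnS ltnW.
  exists psi; split.
  + move=> i; rewrite size_rcons ltnS leq_eqVlt /rowf nth_rcons => /orP[/eqP ->|il].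
      by rewrite ltnn eqxx.
    by rewrite il; exact: hl.
  + move=> x; rewrite size_rcons big_ord_recr /= /rowf nth_rcons ltnn eqxx.
    have := bpsi x; rewrite qE -/n lerBrDl; congr (_ + _ <= _).
    by apply: eq_bigr => i _; rewrite nth_rcons ltn_ord.
have lf t : lin_form (f t).
  have [/(_ t) + _] := hf t.+1.
  by rewrite size_mkseq ltnSn /rowf nth_mkseq// => -[].
have ef t x : starts t.+1 x -> f t x = (T x).[t].
  have [/(_ t) + _] := hf t.+1.
  by rewrite size_mkseq ltnSn /rowf nth_mkseq// => -[//|_]; exact.
have bf n x : energy (fun t => f t x) n <= tau * nsq x.
  have [_ /(_ x)] := hf n; rewrite size_mkseq /energy big_mkord.
  by congr (_ <= _); apply: eq_bigr => i _; rewrite /rowf nth_mkseq.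
pose T' x := Ell2 (bounded_energy_summable (bf ^~ x)).
have T'E x : nsq (T' x) <= tau * nsq x by apply: nsq_le => n; exact: bf.
have lT' : linear T' by move=> a x y; apply: ell2P => t; exact: lf.
have [c c0 hc] := bounded_bnd bT.
exists (T' - T); last first.
  by move=> x; rewrite -[(T' - T) x]/(T' x - T x) addrC subrK.
apply: (@BcI _ _ (Num.sqrt tau + c)).
- exact: linear_add lT' (linear_opp lT).
- move=> x; apply: le_trans (norm2D _ _) _; rewrite mulrDl lerD//.
    by apply: norm2_le_sqr; rewrite ?sqrtr_ge0// sqr_sqrtr.
  by rewrite norm2N.
- move=> n x sx t tn; rewrite ell2_valD -[(T' x).[t]]/(f t x) ef.
    by rewrite -[((- T) x).[t]]/(- (T x).[t]) subrr.
  exact: starts_le sx.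
Qed.

End completion.

(** * Hilbert-Schmidt operators and the Hankel norm *)

Section hilbert_schmidt_operators.
Variable R : realType.
Local Notation l2 := (ell2 R).
Local Notation "x .[ t ]" := (ell2_val x t) : ring_scope.
Local Notation e_ := (unit_vec R).
Implicit Types (A B T D : l2 -> l2) (x y : l2).
Local Notation bounded_op := (bounded_linear (@norm2 R) (@norm2 R)).

Definition colsum A n : R := \sum_(0 <= k < n) nsq (A (e_ k)).
Definition hs2 A : R := limn (colsum A).

Lemma colsum_nd A : {homo colsum A : m n / (m <= n)%N >-> m <= n}.
Proof.
by apply/nondecreasing_seqP => n; rewrite /colsum big_nat_recr//= lerDl nsq_ge0.
Qed.

Lemma hilbert_schmidtI A c : bounded_op A -> (forall n, colsum A n <= c) ->
  hilbert_schmidt A.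
Proof.
move=> bA h; split=> //; apply: (@le_lt_trans _ _ c%:E); last exact: ltry.
apply: lime_le.
  by apply: is_cvg_nneseries => n _ _; rewrite lee_fin sqr_ge0.
apply: nearW => n; rewrite sumEFin lee_fin; apply: le_trans (h n).
by rewrite /colsum; under eq_bigr do rewrite norm2_sqr.
Qed.

Lemma colsum_cvg A : hilbert_schmidt A -> cvgn (colsum A).
Proof.
move=> [bA]; set S := (X in (X < _)%E) => hS.
have S0 : (0 <= S)%E by apply: nneseries_ge0 => n _ _; rewrite lee_fin sqr_ge0.
apply: nondecreasing_is_cvgn (@colsum_nd A) _; exists (fine S) => _ [n _ <-].
rewrite -lee_fin fineK ?ge0_fin_numE// /colsum -sumEFin.
under eq_bigr do rewrite -norm2_sqr.
by apply: nneseries_lim_ge => k _ _; rewrite lee_fin sqr_ge0.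
Qed.

Lemma hs_bounded A : hilbert_schmidt A -> bounded_op A.
Proof. by case. Qed.

Local Opaque hilbert_schmidt.

Lemma colsum_le_hs2 A n : hilbert_schmidt A -> colsum A n <= hs2 A.
Proof. by move=> hA; apply: nondecreasing_cvgn_le (@colsum_nd A) (colsum_cvg hA) n. Qed.

Lemma hs2_le A c : hilbert_schmidt A -> (forall n, colsum A n <= c) -> hs2 A <= c.
Proof.
by move=> hA h; apply: limr_le; [exact: colsum_cvg|exact: nearW].
Qed.

Lemma hs2_ge0 A : hilbert_schmidt A -> 0 <= hs2 A.
Proof. by move=> hA; apply: le_trans (colsum_le_hs2 0 hA); rewrite /colsum big_geq. Qed.

Lemma hs2_add_le A D1 D2 s : 0 <= s ->
  hilbert_schmidt D1 -> hilbert_schmidt D2 -> hilbert_schmidt A ->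
  (forall k, nsq (D1 (e_ k)) + nsq (D2 (e_ k)) <= s * nsq (A (e_ k))) ->
  hs2 D1 + hs2 D2 <= s * hs2 A.
Proof.
move=> s0 h1 h2 hA h.
have key n : colsum D1 n + colsum D2 n <= s * hs2 A.
  apply: (@le_trans _ _ (s * colsum A n)).
    by rewrite /colsum mulr_sumr -big_split; apply: ler_sum => k _; exact: h.
  by rewrite ler_wpM2l// colsum_le_hs2.
rewrite addrC -lerBrDr; apply: hs2_le => // m; rewrite lerBrDl -lerBrDr.
apply: hs2_le => // n; rewrite lerBrDr; apply: le_trans (key (maxn n m)).
by rewrite lerD// colsum_nd// ?leq_maxl ?leq_maxr.
Qed.

(** The trace is a sum over columns, so orthogonality can be checked columnwise. *)
Lemma hs_innerE A B : bounded_op B ->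
  hs_inner A B = csum (fun n => inner (A (e_ n)) (B (e_ n))).
Proof.
move=> bB; rewrite /hs_inner /trace; congr csum; apply/funext => n /=.
exact: adjP'.
Qed.

Lemma hs_norm_sqr A : hilbert_schmidt A -> hs_norm A ^+ 2 = hs2 A.
Proof.
move=> hA; have e : Re (hs_inner A A) = hs2 A.
  rewrite hs_innerE; last exact: hs_bounded.
  rewrite /csum /= /hs2; congr (limn _); apply/funext => n.
  by rewrite /series /colsum /=; apply: eq_bigr => k _; rewrite nsqE.
by rewrite /hs_norm e sqr_sqrtr// hs2_ge0.
Qed.

Lemma hs_norm_ge0 A : 0 <= hs_norm A. Proof. exact: sqrtr_ge0. Qed.

Definition rank1 y n x : l2 := x.[n] *: y.

Lemma rank1_causal_hs y n : starts n y -> causal_hs (rank1 y n).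
Proof.
move=> sy; have hB : Bc (rank1 y n).
  apply: (@BcI _ _ (norm2 y)).
  - by move=> a x z; rewrite /rank1 ell2_valD ell2_valZ scalerDl scalerA.
  - move=> x; rewrite /rank1 norm2Z mulrC ler_wpM2l ?norm2_ge0//.
    by rewrite norm2E ler_wsqrtr// sqnormc_le_nsq.
  - move=> m x sx t tm; rewrite ell2_valZ.
    by case: (ltnP n m) => [nm|mn]; [rewrite sx ?mul0r|rewrite sy ?mulr0// (leq_trans tm)].
split=> //; apply: (@hilbert_schmidtI _ (nsq y)); first exact: Bc_bounded.
have z k : k != n -> nsq (rank1 y n (e_ k)) = 0.
  by move=> kn; rewrite /rank1 unit_vecE eq_sym (negbTE kn) scale0r nsq0.
move=> m; rewrite /colsum; have [nm|mn] := ltnP n m.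
  rewrite (bigD1_seq n) ?mem_index_iota ?iota_uniq//= big1 ?addr0//.
  by rewrite /rank1 unit_vecE eqxx scale1r.
rewrite big_nat_cond big1 ?nsq_ge0// => k /andP[/andP[_ km] _]; apply: z.
by rewrite neq_ltn (leq_trans km mn).
Qed.

Lemma rank1_unit y n : rank1 y n (e_ n) = y.
Proof. by rewrite /rank1 unit_vecE eqxx scale1r. Qed.
Lemma rank1_unit0 y n k : k != n -> rank1 y n (e_ k) = 0.
Proof. by move=> kn; rewrite /rank1 unit_vecE eq_sym (negbTE kn) scale0r. Qed.

Section triangular_truncation.
Variables (T : l2 -> l2) (hT : hilbert_schmidt T).
Let lT : linear T. Proof. exact: (hs_bounded hT).1. Qed.

Let low_sig x : signal R := fun t => (T (head t.+1 x)).[t].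

(** The entry [t] of the lower triangular part of [T x] is the inner product of
    [x] with row [t], cut at time [t]; the squared norms of the cut rows sum up
    to at most the squared Hilbert-Schmidt norm. *)
Let low_energy x n : energy (low_sig x) n <= hs2 T * nsq x.
Proof.
pose r t : l2 := head t.+1 (adj T (e_ t)).
have lowE t : low_sig x t = inner x (r t).
  rewrite /low_sig -inner_unitr adjP; last exact: hs_bounded.
  rewrite -{1}(head_tail t.+1 x) /r.
  rewrite -[X in inner _ X](head_tail t.+1) (siDr (inner_semi R)).
  rewrite (inner_ends_starts (@head_ends _ t.+1 _) (@tail_starts _ t.+1 _)) addr0.
  rewrite -[in RHS](head_tail t.+1 x) (siDl (inner_semi R)).
  rewrite (inner_starts_ends (@tail_starts _ t.+1 _) (@head_ends _ t.+1 _)) addr0.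
  by rewrite head_tail.
have rE t k : (k <= t)%N -> (r t).[k] = conjc (T (e_ k)).[t].
  move=> kt; rewrite headE ltnS kt -inner_unitr adjP'; last exact: hs_bounded.
  by rewrite (semi_innerC (inner_semi R)) inner_unitr.
apply: (@le_trans _ _ (\sum_(0 <= t < n) nsq x * nsq (r t))).
  apply: ler_sum => t _; rewrite lowE; apply: le_trans (cauchy_schwarz (inner_semi R) _ _) _.
  by rewrite -!nsqE.
rewrite -mulr_sumr mulrC ler_wpM2r ?nsq_ge0//; apply: le_trans (colsum_le_hs2 n hT).
apply: (@le_trans _ _ (\sum_(0 <= t < n) \sum_(0 <= k < n) sqnormc (T (e_ k)).[t])).
  rewrite big_nat_cond [leRHS]big_nat_cond; apply: ler_sum => t /andP[/andP[_ tn] _].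
  have -> : nsq (r t) = energy (ell2_val (r t)) t.+1 by exact: nsq_ends (@head_ends _ t.+1 _).
  rewrite /energy.
  rewrite [leRHS](@big_cat_nat _ _ _ t.+1)//= -[leLHS]addr0 lerD//.
    rewrite big_nat_cond [leRHS]big_nat_cond; apply: ler_sum => k /andP[/andP[_ kt] _].
    by rewrite -[X in sqnormc X <= _]/(ell2_val (r t) k) rE// sqnormc_conj.
  by apply: sumr_ge0 => k _; exact: sqnormc_ge0.
rewrite exchange_big; apply: ler_sum => k _; exact: energy_le_nsq.
Qed.

Let low x : l2 := Ell2 (bounded_energy_summable (low_energy x)).

Let lowE x t : (low x).[t] = (T (head t.+1 x)).[t]. Proof. by []. Qed.

Let low_unit n : low (e_ n) = tail n (T (e_ n)).
Proof.
apply: ell2P => t; rewrite lowE tailE; case: ltnP => tn.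
  rewrite starts_head ?(lin0 lT)//; exact: starts_le (@unit_vec_starts R n).
by rewrite ends_head//; exact: ends_le (@unit_vec_ends R n).
Qed.

Let low_causal_hs : causal_hs low.
Proof.
have lB : Bc low.
  apply: (@BcI _ _ (Num.sqrt (hs2 T))).
  - move=> a x y; apply: ell2P => t.
    by rewrite ell2_valD ell2_valZ !lowE head_linear lT.
  - move=> x; apply: norm2_le_sqr; rewrite ?sqrtr_ge0// sqr_sqrtr ?hs2_ge0//.
    by apply: nsq_le => n; exact: low_energy.
  - move=> n x sx t tn; rewrite lowE starts_head ?(lin0 lT)//.
    exact: starts_le sx.
split; last exact: lB.
apply: (@hilbert_schmidtI _ (hs2 T)); first exact: (Bc_bounded lB).
move=> n; apply: le_trans (colsum_le_hs2 n hT); apply: ler_sum => k _.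
by rewrite low_unit nsq_tail_le.
Qed.

(** The lower triangular truncation of [T] satisfies the defining property, since
    its complement and a causal operator have columns with disjoint supports.
    Conversely, testing the property on matrix units on or below the diagonal
    determines every column of [T - causal_proj T]. *)
Lemma causal_projP : causal_hs (causal_proj T) /\
  forall n, (T - causal_proj T) (e_ n) = head n (T (e_ n)).
Proof.
rewrite /causal_proj; case: xgetP => [B _ [hB ortho]|/(_ low) hn].
  split=> // n; set d := (T - B) (e_ n).
  have Bs : starts n (B (e_ n)) by apply: Bc_starts hB.2 _ _ (@unit_vec_starts R n).
  apply: ell2P => t; rewrite headE; case: ltnP => tn.
    by rewrite /d !fctE ell2_valD ell2_valN Bs// subr0.
  have := ortho _ (rank1_causal_hs (starts_le tn (@unit_vec_starts R t))).
  rewrite hs_innerE; last by apply: Bc_bounded; apply: (rank1_causal_hs _).2; exact: (starts_le tn (@unit_vec_starts R t)).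
  rewrite (@csum_finite _ n.+1); last first.
    by move=> k nk; rewrite rank1_unit0 ?gtn_eqF// (si0r (inner_semi R)).
  rewrite big_nat_recr//= big_nat_cond big1 ?add0r.
    by rewrite rank1_unit inner_unitr.
  move=> k /andP[/andP[_ kn] _].
  by rewrite rank1_unit0 ?(ltn_eqF kn)// (si0r (inner_semi R)).
exfalso; apply: hn; split=> // D hD; rewrite hs_innerE; last exact: Bc_bounded hD.2.
rewrite (@csum_finite _ 0) ?big_geq// => n _.
apply: (inner_ends_starts (n := n)).
  rewrite !fctE low_unit => t nt.
  by rewrite ell2_valD ell2_valN tailE ltnNge nt subrr.
by apply: Bc_starts hD.2 _ _ _; exact: unit_vec_starts.
Qed.

Lemma anticausal_hs : hilbert_schmidt (T - causal_proj T).
Proof.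
have [hp pE] := causal_projP; apply: (@hilbert_schmidtI _ (hs2 T)).
  split; first exact: linear_add lT (linear_opp (Bc_lin hp.2)).
  have [c c0 hc] := bounded_bnd (hs_bounded hT); have [c' c0' hc'] := Bc_bnd hp.2.
  exists (c + c') => x; apply: le_trans (norm2D _ _) _.
  by rewrite mulrDl lerD// norm2N.
move=> n; apply: le_trans (colsum_le_hs2 n hT); apply: ler_sum => k _.
by rewrite pE nsq_head_le.
Qed.

End triangular_truncation.

Local Opaque hs2 causal_proj.

Section hankel.
Variables (F G : l2 -> l2) (bF : bounded_op F) (bG : bounded_op G).

Lemma comp_hs A : hilbert_schmidt A -> forall H : l2 -> l2, bounded_op H -> hilbert_schmidt (H \o A).
Proof.
move=> hA H bH; have [c c0 hc] := bounded_bnd bH; have [a a0 ha] := bounded_bnd (hs_bounded hA).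
apply: (@hilbert_schmidtI _ (c ^+ 2 * hs2 A)).
  split; first exact: linear_comp bH.1 (hs_bounded hA).1.
  by exists (c * a) => x /=; apply: le_trans (hc _) _; rewrite -mulrA ler_wpM2l.
move=> n; apply: (@le_trans _ _ (c ^+ 2 * colsum A n)).
  by rewrite /colsum mulr_sumr; apply: ler_sum => k _; exact: (bnd_sqr hc (A _)).
by rewrite ler_wpM2l ?sqr_ge0// colsum_le_hs2.
Qed.

Lemma hankel_sqr A : causal_hs A ->
  hs_norm_pair (hankel F G A) ^+ 2 =
  hs2 (F \o A - causal_proj (F \o A)) + hs2 (G \o A - causal_proj (G \o A)).
Proof.
move=> [hA _]; have h1 := anticausal_hs (comp_hs hA bF).
have h2 := anticausal_hs (comp_hs hA bG).
rewrite /hs_norm_pair sqr_sqrtr; last by rewrite addr_ge0 ?sqr_ge0.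
by congr (_ + _); [exact: hs_norm_sqr h1|exact: hs_norm_sqr h2].
Qed.

Lemma hankel_corner_le s A :
  0 <= s -> (forall n x, starts n x ->
    nsq (head n (F x)) + nsq (head n (G x)) <= s * nsq x) ->
  causal_hs A -> hs_norm_pair (hankel F G A) ^+ 2 <= s * hs_norm A ^+ 2.
Proof.
move=> s0 h hA; have [hF hG] := (comp_hs hA.1 bF, comp_hs hA.1 bG).
rewrite (hankel_sqr hA) (hs_norm_sqr hA.1).
apply: (hs2_add_le s0 (anticausal_hs hF) (anticausal_hs hG) hA.1) => k.
have -> := (causal_projP hF).2 k; have -> := (causal_projP hG).2 k.
by apply: h; apply: Bc_starts hA.2 _ _ _; exact: unit_vec_starts.
Qed.

Section bounded_corners.
Variable s : R.
Hypotheses (s0 : 0 <= s) (hs : forall n x, starts n x ->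
    nsq (head n (F x)) + nsq (head n (G x)) <= s * nsq x).

Lemma hankel_unit_le A : causal_hs A -> hs_norm A <= 1 ->
  hs_norm_pair (hankel F G A) <= Num.sqrt s.
Proof.
move=> hA nA; rewrite -[leLHS]ger0_norm ?sqrtr_ge0// -sqrtr_sqr ler_wsqrtr//.
apply: le_trans (hankel_corner_le s0 hs hA) _; rewrite -[leRHS]mulr1 ler_wpM2l//.
by rewrite expr_le1 ?hs_norm_ge0.
Qed.

Lemma zero_causal_hs : causal_hs (rank1 (0 : l2) 0).
Proof. exact: rank1_causal_hs. Qed.

Lemma hs_norm_rank1 y n : starts n y -> hs_norm (rank1 y n) = norm2 y.
Proof.
move=> sy; have [h _] := rank1_causal_hs sy.
rewrite -[LHS]ger0_norm ?hs_norm_ge0// -sqrtr_sqr hs_norm_sqr// norm2E; congr Num.sqrt.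
apply: le_anti; apply/andP; split.
  apply: hs2_le => // m; rewrite /colsum; have [nm|mn] := ltnP n m.
    rewrite (bigD1_seq n) ?mem_index_iota ?iota_uniq//= big1 ?addr0 ?rank1_unit//.
    by move=> k kn; rewrite rank1_unit0// nsq0.
  rewrite big_nat_cond big1 ?nsq_ge0// => k /andP[/andP[_ km] _].
  by rewrite rank1_unit0 ?nsq0// neq_ltn (leq_trans km mn).
apply: le_trans (colsum_le_hs2 n.+1 h); rewrite /colsum big_nat_recr//= rank1_unit.
by rewrite lerDr; apply: sumr_ge0 => k _; exact: nsq_ge0.
Qed.

Lemma hankel_norm_ub A : causal_hs A -> hs_norm A <= 1 ->
  hs_norm_pair (hankel F G A) <= hankel_norm F G.
Proof.
move=> hA nA; apply: ub_le_sup; last by exists A.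
by exists (Num.sqrt s) => _ [B [hB nB] <-]; exact: hankel_unit_le.
Qed.

Lemma hankel_norm_ge0 : 0 <= hankel_norm F G.
Proof.
apply: le_trans (hankel_norm_ub zero_causal_hs _); first exact: sqrtr_ge0.
by rewrite hs_norm_rank1// norm20.
Qed.

Lemma hankel_norm_sqr_le : hankel_norm F G ^+ 2 <= s.
Proof.
rewrite -[leRHS]sqr_sqrtr// lerXn2r ?nnegrE ?sqrtr_ge0 ?hankel_norm_ge0//.
apply: sup_le_ub; last by move=> _ [B [hB nB] <-]; exact: hankel_unit_le.
exists (hs_norm_pair (hankel F G (rank1 0 0))), (rank1 0 0) => //; split.
  exact: zero_causal_hs.
by rewrite hs_norm_rank1// norm20.
Qed.

(** The rank one operator with column [x] at time [n] sees exactly one corner of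
    the symbol. *)
Lemma corner_le_hankel_norm n x : starts n x ->
  nsq (head n (F x)) + nsq (head n (G x)) <= hankel_norm F G ^+ 2 * nsq x.
Proof.
move=> sx; have [x0|x0] := eqVneq (nsq x) 0.
  rewrite (nsq_eq0 x0) (lin0 bF.1) (lin0 bG.1) !starts_head ?nsq0 ?addr0 ?mulr0//;
  exact: starts0.
have {}x0 : 0 < nsq x by rewrite lt_neqAle eq_sym x0 nsq_ge0.
pose a : R[i] := ((Num.sqrt (nsq x))^-1)%:C%C; pose y := a *: x.
have ha : sqnormc a = (nsq x)^-1 by rewrite sqnormcR exprVn sqr_sqrtr// ltW.
have sy : starts n y by exact: startsZ.
have hA := rank1_causal_hs sy; set A := rank1 y n in hA.
have nA : hs_norm A <= 1.
  by rewrite hs_norm_rank1// norm2E nsqZ ha mulVf ?gt_eqF// sqrtr1.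
have : hs_norm_pair (hankel F G A) ^+ 2 <= hankel_norm F G ^+ 2.
  by rewrite lerXn2r ?nnegrE ?sqrtr_ge0 ?hankel_norm_ge0// hankel_norm_ub.
rewrite (hankel_sqr hA) => hle.
have col (H : l2 -> l2) : bounded_op H ->
    nsq (head n (H y)) <= hs2 (H \o A - causal_proj (H \o A)).
  move=> bH; have hH := comp_hs hA.1 bH.
  apply: le_trans (colsum_le_hs2 n.+1 (anticausal_hs hH)).
  rewrite /colsum big_nat_recr//= (causal_projP hH).2 /= /A rank1_unit lerDr.
  by apply: sumr_ge0 => k _; exact: nsq_ge0.
have := le_trans (lerD (col F bF) (col G bG)) hle.
rewrite /y (linZ bF.1) (linZ bG.1) !(linZ (@head_linear R n)) !nsqZ ha -mulrDr.
by rewrite mulrC ler_pdivrMr.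
Qed.

End bounded_corners.
End hankel.
End hilbert_schmidt_operators.

Section operator_norm.
Variable R : realType.
Local Notation l2 := (ell2 R).
Implicit Types (T : l2 -> l2 * l2).
Local Notation opn := (opnorm (@norm2 R) (@norm2_pair R)).

Lemma opnorm_ub T : linear T -> (exists c, forall x, norm2_pair (T x) <= c * norm2 x) ->
  forall x, norm2_pair (T x) <= opn T * norm2 x.
Proof.
move=> lT [c hc] x; have [x0|x0] := eqVneq (norm2 x) 0.
  by rewrite x0 mulr0 (norm2_eq0 x0) (lin0 lT) norm2_pair0.
have {}x0 : 0 < norm2 x by rewrite lt_neqAle eq_sym x0 norm2_ge0.
pose a : R[i] := ((norm2 x)^-1)%:C%C.
have ha : Num.sqrt (sqnormc a) = (norm2 x)^-1.
  by rewrite sqnormcR sqrtr_sqr ger0_norm// invr_ge0 ltW.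
rewrite -ler_pdivrMr// mulrC -ha -norm2_pairZ -(linZ lT).
apply: ub_le_sup; last by exists (a *: x) => //=; rewrite norm2Z ha mulVf// gt_eqF.
exists `|c| => _ [y /= y1 <-]; apply: le_trans (hc y) _.
apply: le_trans (ler_norm _) _; rewrite normrM -[leRHS]mulr1 ler_wpM2l//.
by rewrite ger0_norm ?norm2_ge0.
Qed.

Lemma opnorm_le T c : 0 <= c -> (forall x, norm2_pair (T x) <= c * norm2 x) -> opn T <= c.
Proof.
move=> c0 hc; apply: sup_le_ub.
  by exists (norm2_pair (T 0)), 0 => //=; rewrite norm20.
move=> _ [y /= y1 <-]; apply: le_trans (hc y) _.
by rewrite -[leRHS]mulr1 ler_wpM2l.
Qed.

Lemma opnorm_ge0 T : linear T -> (exists c, forall x, norm2_pair (T x) <= c * norm2 x) ->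
  0 <= opn T.
Proof.
move=> lT bT; have := opnorm_ub lT bT (unit_vec R 0).
rewrite norm2E nsq_unit sqrtr1 mulr1; exact: le_trans (norm2_pair_ge0 _).
Qed.

Lemma col_bounded A B : Bc A -> Bc B ->
  exists c, forall x : l2, norm2_pair (op_col A B x) <= c * norm2 x.
Proof.
move=> hA hB; have [a _ ha] := Bc_bnd hA; have [b _ hb] := Bc_bnd hB.
exists (a + b) => x; apply: le_trans (norm2_pair_le _) _; rewrite mulrDl.
by apply: lerD; [exact: ha|exact: hb].
Qed.

Lemma nsq2_le_sqr c (z : l2 * l2) (x : l2) :
  0 <= c -> norm2_pair z <= c * norm2 x -> nsq2 z <= c ^+ 2 * nsq x.
Proof.
move=> c0 h; rewrite -norm2_pair_sqr -norm2_sqr -exprMn.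
by rewrite lerXn2r ?nnegrE ?norm2_pair_ge0 ?mulr_ge0 ?norm2_ge0.
Qed.

Lemma norm2_pair_le_sqr c (z : l2 * l2) (x : l2) :
  0 <= c -> nsq2 z <= c ^+ 2 * nsq x -> norm2_pair z <= c * norm2 x.
Proof.
move=> c0 h; rewrite -[c]ger0_norm// -sqrtr_sqr norm2_pairE norm2E -sqrtrM ?sqr_ge0//.
exact: ler_wsqrtr.
Qed.

End operator_norm.

(** * The optimal norm and the Hankel formula *)

Section optimal_radius.
Variable R : realType.
Local Notation l2 := (ell2 R).
Variables M N Mh Nh : l2 -> l2.
Hypothesis hnp : normalized_pair M N Mh Nh.
Variables (La Lb U V : l2 -> l2).
Hypothesis hc : complement M N Mh Nh La Lb U V.
Local Notation F := (graph_map M N).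
Local Notation Fs := (graph_adj M N).
Local Notation Gs := (cograph_adj Mh Nh).
Local Notation opn := (opnorm (@norm2 R) (@norm2_pair R)).

(** The columns over which the infimum is taken: numerator and denominator of
    the controllers in the Youla parametrization. *)
Definition youla_column (Q : l2 -> l2) : l2 -> l2 * l2 :=
  op_col U V + (op_col M N \o Q).
Definition optimal_norm : R := inf [set opn (youla_column Q) | Q in @Bc R].
Local Notation W_ := youla_column.
Local Notation mu := optimal_norm.
Local Notation h := (hankel_norm (adj Mh) (adj Nh)).

Lemma youla_columnE Q : W_ Q = op_col (U + (M \o Q)) (V + (N \o Q)).
Proof. by []. Qed.

Lemma youla_column_cp Q : Bc Q -> complement M N Mh Nh
  (La + (Q \o Nh)) (Lb - (Q \o Mh)) (U + (M \o Q)) (V + (N \o Q)).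
Proof. exact: complement_shift. Qed.

Lemma youla_column_linear Q : Bc Q -> linear (W_ Q).
Proof.
move=> hQ; have [_ _ bU bV _ _ _ _] := youla_column_cp hQ.
exact: col_linear (Bc_lin bU) (Bc_lin bV).
Qed.

Lemma youla_column_bounded Q : Bc Q ->
  exists c, forall x, norm2_pair (W_ Q x) <= c * norm2 x.
Proof.
move=> hQ; have [_ _ bU bV _ _ _ _] := youla_column_cp hQ.
exact: col_bounded bU bV.
Qed.

Lemma youla_column_opnorm Q : Bc Q -> 0 <= opn (W_ Q) /\
  forall x, nsq2 (W_ Q x) <= opn (W_ Q) ^+ 2 * nsq x.
Proof.
move=> hQ; have lW := youla_column_linear hQ; have bW := youla_column_bounded hQ.
have p0 := opnorm_ge0 lW bW; split=> // x; apply: nsq2_le_sqr => //.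
exact: opnorm_ub.
Qed.

Lemma opnorm_youla_column_ge1 Q : Bc Q -> 1 <= opn (W_ Q).
Proof.
move=> hQ; have [p0 ho] := youla_column_opnorm hQ.
have := right_ge1 hnp (youla_column_cp hQ) ho; rewrite expr2.
set c := opn _ in p0 *; nra.
Qed.

Lemma has_inf_norms : has_inf [set opn (W_ Q) | Q in @Bc R].
Proof.
split; first by exists (opn (W_ 0)), 0 => //; exact: Bc_0.
by exists 1 => _ [Q hQ <-]; exact: opnorm_youla_column_ge1.
Qed.

Lemma optimal_norm_ge1 : 1 <= mu.
Proof.
apply: lb_le_inf; first by case: has_inf_norms.
by move=> _ [Q hQ <-]; exact: opnorm_youla_column_ge1.
Qed.

Lemma optimal_norm_le Q c : Bc Q -> 0 <= c ->
  (forall x, nsq2 (W_ Q x) <= c ^+ 2 * nsq x) -> mu <= c.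
Proof.
move=> hQ c0 hW; apply: (@le_trans _ _ (opn (W_ Q))).
  by apply: ge_inf; [case: has_inf_norms|exists Q].
by apply: opnorm_le => // x; exact: norm2_pair_le_sqr.
Qed.

Lemma nsq2_head_cograph n x :
  nsq (head n (adj Mh x)) + nsq (head n (adj Nh x)) = nsq2 (head2 n (Gs x)).
Proof.
rewrite addrC /nsq2 /= -[(- adj Nh) x]/(- adj Nh x).
by rewrite (linN (@head_linear R n)) nsqN.
Qed.

(** For [x] starting at [n], what [G* x] does before [n] and what it does from [n] on
    share [|x|^2], and the latter is bounded below. *)
Lemma hankel_norm_bound Q : Bc Q -> opn (W_ Q) ^+ 2 * (1 - h ^+ 2) >= 1.
Proof.
move=> hQ; have [p0 ho] := youla_column_opnorm hQ.
have p1 := opnorm_youla_column_ge1 hQ.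
set c := opn (W_ Q) in p0 ho p1 *.
have c2 : 1 <= c ^+ 2 by rewrite expr2; nra.
have ci : c ^+ 2 * (c ^+ 2)^-1 = 1 by rewrite mulfV// gt_eqF// (lt_le_trans _ c2).
have s0 : 0 <= 1 - (c ^+ 2)^-1 by rewrite subr_ge0 invf_le1// (lt_le_trans _ c2).
have corner n x : starts n x ->
    nsq (head n (adj Mh x)) + nsq (head n (adj Nh x)) <= (1 - (c ^+ 2)^-1) * nsq x.
  move=> sx; rewrite nsq2_head_cograph.
  have := tail_cograph_lower hnp (youla_column_cp hQ) ho sx.
  have := nsq2_head_tail n (Gs x); rewrite (nsq2_cograph_adj hnp) => e.
  rewrite -ler_pdivrMl ?(lt_le_trans _ c2)//; lra.
have [bMh bNh] := (Bc_bounded (np_Mh hnp), Bc_bounded (np_Nh hnp)).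
have := hankel_norm_sqr_le (adj_bounded bMh) (adj_bounded bNh) s0 corner.
by move=> hle; rewrite -[leLHS]ci ler_wpM2l ?sqr_ge0// lerBrDr addrC -lerBrDr.
Qed.

Lemma hankel_corner n x : starts n x ->
  nsq2 (head2 n (Gs x)) <= h ^+ 2 * nsq x.
Proof.
move=> sx; rewrite -nsq2_head_cograph.
have [bMh bNh] := (Bc_bounded (np_Mh hnp), Bc_bounded (np_Nh hnp)).
apply: (@corner_le_hankel_norm _ _ _ (adj_bounded bMh) (adj_bounded bNh) 1) => //.
move=> m y sy; rewrite nsq2_head_cograph mul1r -[leRHS](nsq2_cograph_adj hnp).
by rewrite [leRHS](nsq2_head_tail m) lerDl nsq2_ge0.
Qed.

Lemma hankel_norm_lt1 : 0 < 1 - h ^+ 2.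
Proof.
rewrite ltNge; apply/negP => le0; have := hankel_norm_bound (Bc_0 R).
by rewrite leNgt => /negP; apply; apply: le_lt_trans ltr01; rewrite mulr_ge0_le0// sqr_ge0.
Qed.

(** The infimum is attained: the corner bound makes the anticausal part of
    [F* W] as small as the Hankel norm allows, and a causal completion of least
    norm gives the parameter [Q]. *)
Lemma optimal_youla_column : exists2 Q, Bc Q &
  forall x, nsq2 (W_ Q x) <= (1 - h ^+ 2)^-1 * nsq x.
Proof.
set k := 1 - h ^+ 2; have k0 : 0 < k := hankel_norm_lt1.
have ki : k * k^-1 = 1 by rewrite mulfV// gt_eqF.
have k1 : k <= 1 by rewrite /k lerBlDr lerDl sqr_ge0.
have low n x : starts n x -> k * nsq x <= nsq2 (tail2 n (Gs x)).
  move=> sx; have := hankel_corner sx.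
  have := nsq2_head_tail n (Gs x); rewrite (nsq2_cograph_adj hnp) /k; lra.
have tau0 : 0 <= k^-1 - 1 by rewrite subr_ge0 invf_ge1.
pose T x := Fs (op_col U V x).
have [bM bN] := (Bc_bounded (np_M hnp), Bc_bounded (np_N hnp)).
have bT : bounded_linear (@norm2 R) (@norm2 R) T.
  split.
    move=> a x y; rewrite /T (col_linear (Bc_lin (cp_U hc)) (Bc_lin (cp_V hc))).
    exact: (graph_adj_linear hnp).
  have [a a0 ha] := bounded_bnd (adj_bounded bM); have [b b0 hb] := bounded_bnd (adj_bounded bN).
  have [u u0 hu] := Bc_bnd (cp_U hc); have [v v0 hv] := Bc_bnd (cp_V hc).
  exists (a * u + b * v) => x; rewrite /T /graph_adj /=; apply: le_trans (norm2D _ _) _.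
  rewrite mulrDl lerD// -mulrA.
    by apply: le_trans (ha _) _; rewrite ler_wpM2l.
  by apply: le_trans (hb _) _; rewrite ler_wpM2l.
have corner n x : starts n x -> nsq (head n (T x)) <= (k^-1 - 1) * nsq x.
  move=> sx; have := corner_bound hnp hc (low n) k0 sx.
  rewrite -(ler_pM2l (_ : 0 < k^-1)) ?invr_gt0// mulrA mulVf ?gt_eqF// mul1r; rewrite /T; lra.
have [Q hQ hTQ] := causal_completion bT tau0 corner.
exists Q => // x; rewrite youla_columnE (nsq2_right hnp (youla_column_cp hQ)).
have -> : Fs (op_col (U + (M \o Q)) (V + (N \o Q)) x) = T x + Q x.
  rewrite /T -[X in _ = _ + X](graph_isometry hnp) -(linD (graph_adj_linear hnp)).
  by congr graph_adj.
have := hTQ x; lra.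
Qed.

Theorem optimal_norm_hankel : mu^-1 ^+ 2 = 1 - h ^+ 2.
Proof.
have k0 := hankel_norm_lt1; set k := 1 - h ^+ 2 in k0 *.
have m1 := optimal_norm_ge1; have m0 : 0 < mu := lt_le_trans ltr01 m1.
have [Q hQ hW] := optimal_youla_column; rewrite -/k in hW.
have up : mu <= Num.sqrt k^-1.
  apply: (optimal_norm_le hQ); rewrite ?sqrtr_ge0// => x.
  by rewrite sqr_sqrtr// invr_ge0 ltW.
have lo : Num.sqrt k^-1 <= mu.
  apply: lb_le_inf; first by case: has_inf_norms.
  move=> _ [Q' hQ' <-]; have [p0 _] := youla_column_opnorm hQ'.
  rewrite -[leRHS]ger0_norm// -sqrtr_sqr ler_wsqrtr//.
  by rewrite -[leLHS]mul1r ler_pdivrMr//; exact: hankel_norm_bound.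
have -> : mu = Num.sqrt k^-1 by apply: le_anti; rewrite up lo.
by rewrite exprVn sqr_sqrtr ?invr_ge0 ?(ltW k0)// invrK.
Qed.

Lemma optimal_attained : exists2 Q, Bc Q & forall x, nsq2 (W_ Q x) <= mu ^+ 2 * nsq x.
Proof.
have [Q hQ hW] := optimal_youla_column; exists Q => // x.
by rewrite -[mu]invrK exprVn optimal_norm_hankel.
Qed.

(** A causal left inverse of [F] is as good as the right inverse of [G] that it
    belongs to. *)
Lemma optimal_norm_le_left A B c : Bc A -> Bc B -> (forall x, row A B (F x) = x) ->
  0 <= c -> (forall z, nsq (row A B z) <= c ^+ 2 * nsq2 z) -> mu <= c.
Proof.
move=> hA hB hAB c0 hL; have [Q hQ hcp] := complement_of_left hnp hc hA hB hAB.
by apply: (optimal_norm_le hQ) => // x; exact: (right_bound_of_left hnp hcp).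
Qed.

End optimal_radius.

(** * Robust stabilization by small gain *)

Section diagonals.
Variable R : realType.
Local Notation l2 := (ell2 R).
Local Notation "x .[ t ]" := (ell2_val x t) : ring_scope.
Implicit Types A B : l2 -> l2.

Definition diag_entry A n : R[i] := (A (unit_vec R n)).[n].

(** On a signal that starts at [n] the output of a causal operator at time [n] is
    governed by one diagonal entry; diagonals are therefore multiplicative. *)
Lemma diag_apply A n (x : l2) : Bc A -> starts n x -> (A x).[n] = diag_entry A n * x.[n].
Proof.
move=> hA sx; rewrite -{1}(starts_tail sx) tail_succ (linD (Bc_lin hA)) (linZ (Bc_lin hA)).
rewrite ell2_valD ell2_valZ (Bc_starts hA (@tail_starts _ n.+1 _))// addr0.
by rewrite mulrC.
Qed.

Lemma diag_entry_comp A B n : Bc A -> Bc B ->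
  diag_entry (A \o B) n = diag_entry A n * diag_entry B n.
Proof.
by move=> hA hB; exact: (diag_apply hA (Bc_starts hB (@unit_vec_starts R n))).
Qed.

Lemma system_inverse_entry A S n : Bc A -> system_inverse (ext A) S -> diag_entry A n != 0.
Proof.
move=> hA hS; rewrite /diag_entry -ext_impulse//.
exact: (system_inverse_diag (ext_causal hA) n hS).
Qed.

Lemma entry_system_inverse A : Bc A -> (forall n, diag_entry A n != 0) ->
  exists S, system_inverse (ext A) S.
Proof.
move=> hA h; apply: system_inverseP (ext_causal hA) _ => n.
by rewrite ext_impulse//; exact: h.
Qed.

Lemma diagonal_operator (d : nat -> R[i]) (delta : R) : 0 <= delta ->
  (forall t, sqnormc (d t) <= delta ^+ 2) ->
  exists D, [/\ Bc D, bnd delta D & forall x t, (D x).[t] = d t * x.[t]].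
Proof.
move=> d0 hd; have en (x : l2) n : energy (fun t => d t * x.[t]) n <= delta ^+ 2 * nsq x.
  apply: (@le_trans _ _ (delta ^+ 2 * energy (ell2_val x) n)).
    rewrite /energy mulr_sumr; apply: ler_sum => t _.
    by rewrite sqnormcM ler_wpM2r ?sqnormc_ge0.
  by rewrite ler_wpM2l ?sqr_ge0// energy_le_nsq.
pose D x := Ell2 (bounded_energy_summable (en x)).
have bD : bnd delta D.
  by move=> x; apply: norm2_le_sqr => //; apply: nsq_le => n; exact: en.
exists D; split=> //; apply: (BcI _ bD).
- move=> a x y; apply: ell2P => t; rewrite [RHS]ell2_valD ell2_valZ.
  rewrite -[LHS]/(d t * (a * x.[t] + y.[t])) -[RHS]/(a * (d t * x.[t]) + d t * y.[t]).
  by rewrite mulrDr mulrCA.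
- by move=> n x sx t tn /=; rewrite sx// mulr0.
Qed.

Lemma block_bounded A B C D : Bc A -> Bc B -> Bc C -> Bc D ->
  bounded_linear (@norm2_pair R) (@norm2_pair R) (op_block A B C D).
Proof.
move=> hA hB hC hD; split.
  move=> a x y; rewrite /op_block /=.
  have rl := row_linear (Bc_lin hA) (Bc_lin hB) a x y.
  have rl' := row_linear (Bc_lin hC) (Bc_lin hD) a x y.
  by congr (_, _).
have [a a0 ha] := Bc_bnd hA; have [b b0 hb] := Bc_bnd hB.
have [c c0 hc] := Bc_bnd hC; have [d d0 hd] := Bc_bnd hD.
exists ((a + b) + (c + d)) => z; apply: le_trans (norm2_pair_le _) _ => /=.
have le1 (X Y : l2 -> l2) u v : 0 <= u -> 0 <= v -> bnd u X -> bnd v Y ->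
    norm2 (X z.1 + Y z.2) <= (u + v) * norm2_pair z.
  move=> u0 v0 hX hY; apply: le_trans (norm2D _ _) _; rewrite mulrDl; apply: lerD.
    by apply: le_trans (hX _) _; rewrite ler_wpM2l// norm2_fst.
  by apply: le_trans (hY _) _; rewrite ler_wpM2l// norm2_snd.
by rewrite mulrDl; apply: lerD; apply: le1.
Qed.

Lemma block_truncation A B C D : Bc A -> Bc B -> Bc C -> Bc D ->
  forall k z, trunc_pair k (op_block A B C D (trunc_pair k z)) =
              trunc_pair k (op_block A B C D z).
Proof.
move=> hA hB hC hD k z.
have h (X Y : l2 -> l2) : Bc X -> Bc Y ->
   head k.+1 (X (head k.+1 z.1) + Y (head k.+1 z.2)) = head k.+1 (X z.1 + Y z.2).
  move=> hX hY; rewrite !(linD (@head_linear R k.+1)).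
  by rewrite (Bc_head hX) (Bc_head hY).
by congr (_, _); exact: h.
Qed.

End diagonals.
Arguments diag_entry {R} A n.

Section robust_stabilization.
Variable R : realType.
Local Notation l2 := (ell2 R).
Variables M N Mh Nh : l2 -> l2.
Hypothesis hnp : normalized_pair M N Mh Nh.
Variables (La Lb U V : l2 -> l2).
Hypothesis hc : complement M N Mh Nh La Lb U V.
Local Notation F := (graph_map M N).
Local Notation G := (cograph_map Mh Nh).
Local Notation L := (row La Lb).
Local Notation W := (op_col U V).

(** Compare the diagonals of [G F = 0] and [G W = 1]: were the entries of [V] and [N]
    both zero, the former would annihilate the entry of [Nh], and the latter would
    then read [0 = 1]. *)
Lemma diag_entry_VN n : diag_entry M n != 0 -> diag_entry V n = 0 -> diag_entry N n != 0.
Proof.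
move=> M0 V0; apply/eqP => N0.
have [cM cN cMh cNh _ _ GF] := hnp; have [_ _ cU cV _ GW _ _] := hc.
have e x : starts n x -> forall A B, Bc A -> Bc B ->
    ell2_val (G (op_col A B x)) n = (diag_entry Mh n * diag_entry B n
      - diag_entry Nh n * diag_entry A n) * ell2_val x n.
  move=> sx A B cA cB; have -> : G (op_col A B x) = - Nh (A x) + Mh (B x) by [].
  rewrite ell2_valD ell2_valN (diag_apply cNh (Bc_starts cA sx)).
  rewrite (diag_apply cMh (Bc_starts cB sx)) (diag_apply cA sx) (diag_apply cB sx).
  ring.
have s1 := @unit_vec_starts R n; have u1 := unit_vecE R n n; rewrite eqxx in u1.
have := e _ s1 _ _ cM cN; rewrite -/(graph_map M N _) GF N0 u1 mulr0 sub0r mulr1.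
move=> /esym/eqP; rewrite oppr_eq0 mulf_eq0 (negbTE M0) orbF => /eqP Nh0.
have := e _ s1 _ _ cU cV; rewrite GW V0 Nh0 u1 mulr0 mul0r subrr mul0r => /eqP.
by rewrite oner_eq0.
Qed.

(** Requiring that [V + N Q] be invertible as a causal system costs nothing in
    the infimum: a diagonal change of [Q], as small as desired, repairs the
    vanishing diagonal entries. *)
Lemma invertible_denominator (delta : R) : 0 < delta -> (forall n, diag_entry M n != 0) ->
  exists D, [/\ Bc D, bnd delta D & forall n, diag_entry (V + (N \o D)) n != 0].
Proof.
move=> d0 M0; pose d n : R[i] := if diag_entry V n == 0 then delta%:C%C else 0.
have [|D [cD bD DE]] := @diagonal_operator R d delta (ltW d0).
  by move=> t; rewrite /d; case: ifP => _; [rewrite sqnormcR|rewrite sqnormc0 sqr_ge0].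
exists D; split=> // n.
have De : diag_entry D n = d n by rewrite /diag_entry DE unit_vecE eqxx mulr1.
have -> : diag_entry (V + (N \o D)) n = diag_entry V n + diag_entry (N \o D) n by [].
rewrite diag_entry_comp ?De//; last by case: hnp.
rewrite /d; have [V0|V0] := eqVneq (diag_entry V n) 0; last by rewrite mulr0 addr0.
rewrite V0 add0r mulf_neq0//; first exact: diag_entry_VN.
by apply/eqP => /(congr1 (@complex.Re R)) /= /eqP; rewrite gt_eqF.
Qed.

Lemma row_bnd c z : 0 <= c -> (forall z, nsq (L z) <= c ^+ 2 * nsq2 z) ->
  norm2 (L z) <= c * norm2_pair z.
Proof.
move=> c0 h; rewrite -[c]ger0_norm// -sqrtr_sqr norm2E norm2_pairE -sqrtrM ?sqr_ge0//.
exact: ler_wsqrtr.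
Qed.

(** With [W = (U; V)] and [C = U V^-1], the loop with a perturbed plant
    [N1 M1^-1] is governed by [J = L F1 = 1 + L (F1 - F)], a small perturbation
    of the identity. *)
Theorem small_gain (c r : R) Vinv P1 :
  0 <= c -> (forall x, nsq2 (W x) <= c ^+ 2 * nsq x) -> c * r <= 1 ->
  system_inverse (ext V) Vinv -> factor_ball M N r P1 ->
  stabilizes (ext U \o Vinv) P1.
Proof.
move=> c0 hW cr [cVi VVi ViV] [M1 [N1 [[cM1 cN1 _ [Minv [cMi MMi MiM]] ->] hr]]].
have [cM cN cMh cNh _ _ GF] := hnp; have [cLa cLb cU cV LF GW LW cp] := hc.
have hL := left_bound_of_right hnp hc hW.
pose F1 := op_col M1 N1.
have lF : linear F := graph_linear hnp.
have lG : linear G := cograph_linear hnp.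
have lL : linear L := row_linear (Bc_lin cLa) (Bc_lin cLb).
have lW : linear W := col_linear (Bc_lin cU) (Bc_lin cV).
have cM1' := BcB cM cM1; have cN1' := BcB cN cN1.
set E := op_col M N - op_col M1 N1 in hr.
have EE : E = op_col (M - M1) (N - N1) by [].
have hE := opnorm_ub (col_linear (Bc_lin cM1') (Bc_lin cN1')) (col_bounded cM1' cN1').
rewrite -EE in hE; set e := opnorm _ _ E in hr hE.
have e0 : 0 <= e by apply: opnorm_ge0 (col_linear (Bc_lin cM1') (Bc_lin cN1')) (col_bounded cM1' cN1').
pose J := (La \o M1) + (Lb \o N1).
have cJ : Bc J by apply: BcD; apply: Bc_comp.
have JE x : J x = L (F1 x) by [].
have ce1 : c * e < 1.
  have [->|cn] := eqVneq c 0; first by rewrite mul0r.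
  by apply: lt_le_trans cr; rewrite ltr_pM2l// lt_neqAle eq_sym cn.
have [|J' [cJ' JJ' J'J]] := small_perturbation_inverse cJ ce1.
  move=> x; rewrite JE -{2}(LF x) -(linB lL).
  apply: le_trans (row_bnd _ c0 hL) _; rewrite -mulrA ler_wpM2l//.
  by rewrite -norm2_pairN opprB; exact: hE.
pose K := (- Nh \o M1) + (Mh \o N1).
have KE x : K x = G (F1 x) by [].
have cK : Bc K by apply: BcD; apply: Bc_comp => //; exact: BcN.
(* [(a w, b w)] solves [F1 a + W b = w], by block elimination. *)
pose a w := J' (L w); pose b w := G w - K (a w).
pose S := op_block (M1 \o J' \o La) (M1 \o J' \o Lb)
  (V \o (- Nh - (K \o J' \o La))) (V \o (Mh - (K \o J' \o Lb))).
have SE w : S w = (M1 (a w), V (b w)).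
  rewrite /S /op_block /a /b /cograph_map /row /=; congr (_, _).
    by rewrite -(linD (Bc_lin cM1)) -(linD (Bc_lin cJ')).
  rewrite -(linD (Bc_lin cV)) !fctE /= addrACA -opprD -(linD (Bc_lin cK)).
  by rewrite -(linD (Bc_lin cJ')).
have [c11 c12] : Bc (M1 \o J' \o La) /\ Bc (M1 \o J' \o Lb).
  by split; apply: Bc_comp => //; apply: Bc_comp.
have [c21 c22] : Bc (V \o (- Nh - (K \o J' \o La))) /\ Bc (V \o (Mh - (K \o J' \o Lb))).
  split; apply: Bc_comp => //; apply: BcB => //; try exact: BcN.
    by apply: Bc_comp => //; apply: Bc_comp.
  by apply: Bc_comp => //; apply: Bc_comp.
have loop w : F1 (a w) + W (b w) = w.
  rewrite /b KE (linB lW); have e1 := cp (F1 (a w)); rewrite -JE /a JJ' in e1.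
  rewrite -[X in X + _]e1 addrCA -addrA addrN addr0.
  by rewrite addrC cp.
have ViVs s : Vinv (ext V s) = s by rewrite -[LHS]/((Vinv \o ext V) s) ViV.
have VVis s : ext V (Vinv s) = s by rewrite -[LHS]/((ext V \o Vinv) s) VVi.
have MiMs s : Minv (ext M1 s) = s by rewrite -[LHS]/((Minv \o ext M1) s) MiM.
have MMis s : ext M1 (Minv s) = s by rewrite -[LHS]/((ext M1 \o Minv) s) MMi.
exists S; split.
- exact: block_bounded.
- exact: block_truncation.
- move=> w; rewrite SE /op_block /sigs_of /= -(ext_ell2 _ cV) ViVs -(ext_ell2 _ cM1) MiMs.
  rewrite !ext_ell2//; have := loop w; rewrite /F1 /op_col => h.
  by congr (_, _); rewrite -[in RHS]h.
- move=> z w h; rewrite SE.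
  set s := Minv (ell2_val z.1); set t := Vinv (ell2_val z.2).
  have hs : ell2_val z.1 = ext M1 s by rewrite MMis.
  have ht : ell2_val z.2 = ext V t by rewrite VVis.
  have h1 : ell2_val w.1 = ext M1 s + ext U t.
    by have := congr1 fst h; rewrite /op_block /= hs => <-.
  have h2 : ell2_val w.2 = ext N1 s + ext V t.
    by have := congr1 snd h; rewrite /op_block /= ht => <-.
  have lx (A : l2 -> l2) : Bc A -> linear (ext A) by move=> hA; case: (ext_causal hA).
  have ext0 u : ext (0 : l2 -> l2) u = 0 by apply/funext => i.
  have sE : s = ell2_val (a w).
    have JL : ell2_val (L w) = ext J s.
      rewrite /row -[LHS]/(ell2_val (La w.1) + ell2_val (Lb w.2)).
      rewrite -(ext_ell2 _ cLa) -(ext_ell2 _ cLb) h1 h2 (linD (lx _ cLa)) (linD (lx _ cLb)).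
      rewrite -!ext_comp// addrACA -!ext_add -/J.
      have -> : (La \o U) + (Lb \o V) = 0 by apply/funext => x; exact: LW.
      by rewrite ext0 addr0.
    rewrite /a -ext_ell2// JL -ext_comp//.
    have -> : J' \o J = id by apply/funext => x; exact: J'J.
    by rewrite ext_id.
  have tE : t = ell2_val (b w).
    have GL : ell2_val (G w) = ext K s + t.
      rewrite /cograph_map /row -[LHS]/(ell2_val ((- Nh) w.1) + ell2_val (Mh w.2)).
      rewrite -(ext_ell2 _ (BcN cNh)) -(ext_ell2 _ cMh) h1 h2.
      rewrite (linD (lx _ (BcN cNh))) (linD (lx _ cMh)) -!ext_comp//; try exact: BcN.
      rewrite addrACA -!ext_add -/K.
      have -> : (- Nh \o U) + (Mh \o V) = id by apply/funext => x; exact: GW.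
      by rewrite ext_id.
    rewrite /b -[RHS]/(ell2_val (G w) - ell2_val (K (a w))) GL -(ext_ell2 _ cK) -sE.
    by rewrite addrAC subrr add0r.
  rewrite -[RHS]pairE; congr (_, _); apply: val_inj.
    by rewrite -[LHS]/(ell2_val (M1 (a w))) -(ext_ell2 _ cM1) -sE -hs.
  by rewrite -[LHS]/(ell2_val (V (b w))) -(ext_ell2 _ cV) -tE -ht.
Qed.

End robust_stabilization.

(** * Shifts and time-invariant plants *)

Section shifts.
Variable R : realType.
Local Notation l2 := (ell2 R).
Local Notation "x .[ t ]" := (ell2_val x t) : ring_scope.
Implicit Types x y : l2.

Lemma iter_shiftE n (s : signal R) t :
  iter n (@shift R) s t = if (t < n)%N then 0 else s (t - n)%N.
Proof.
elim: n t => [|n ih] t; first by rewrite subn0.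
by rewrite iterS /shift; case: t => // t; rewrite ih ltnS subSS.
Qed.

Lemma energy_shift n (s : signal R) m :
  energy (iter n (@shift R) s) (n + m) = energy s m.
Proof.
rewrite /energy (@big_cat_nat _ _ _ n)//= ?leq_addr// big_nat_cond big1 ?add0r; last first.
  by move=> k /andP[/andP[_ kn] _]; rewrite iter_shiftE kn sqnormc0.
rewrite -{1}[n]add0n big_addn addKn; apply: eq_bigr => k _.
by rewrite iter_shiftE ltnNge leq_addl addnK.
Qed.

Lemma delay_energy n x m : energy (iter n (@shift R) (ell2_val x)) m <= nsq x.
Proof.
apply: le_trans (energy_nd _ (leq_addl n m)) _.
by rewrite energy_shift energy_le_nsq.
Qed.

Lemma advance_energy n x m : energy (fun t => x.[t + n]) m <= nsq x.
Proof.
apply: le_trans (energy_le_nsq x (m + n)); rewrite /energy.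
rewrite [leRHS](@big_cat_nat _ _ _ n)//= ?leq_addl// -[leLHS]add0r lerD//.
  by apply: sumr_ge0 => k _; exact: sqnormc_ge0.
by rewrite -[X in _ <= \sum_(X <= _ < _) _]add0n big_addn addnK.
Qed.

Definition delay n x : l2 := Ell2 (bounded_energy_summable (delay_energy n x)).
Definition advance n x : l2 := Ell2 (bounded_energy_summable (advance_energy n x)).

Lemma delayE n x t : (delay n x).[t] = if (t < n)%N then 0 else x.[t - n].
Proof. exact: iter_shiftE. Qed.
Lemma advanceE n x t : (advance n x).[t] = x.[t + n]. Proof. by []. Qed.

Lemma delay_linear n : linear (delay n).
Proof.
move=> a x y; apply: ell2P => t; rewrite ell2_valD ell2_valZ !delayE.
by case: ifP; rewrite // mulr0 addr0.
Qed.
Lemma advance_linear n : linear (advance n).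
Proof. by move=> a x y; apply: ell2P => t. Qed.

Lemma advance_delay n x : advance n (delay n x) = x.
Proof. by apply: ell2P => t; rewrite advanceE delayE ltnNge leq_addl addnK. Qed.
Lemma delay_advance n x : starts n x -> delay n (advance n x) = x.
Proof.
move=> sx; apply: ell2P => t; rewrite delayE advanceE; case: ltnP => [/sx ->//|nt].
by rewrite subnK.
Qed.
Lemma delay_starts n x : starts n (delay n x).
Proof. by move=> t tn; rewrite delayE tn. Qed.

Lemma nsq_delay n x : nsq (delay n x) = nsq x.
Proof.
apply: le_anti; apply/andP; split; first by apply: nsq_le => m; exact: delay_energy.
by apply: nsq_le => m; rewrite -(energy_shift n); exact: (@energy_le_nsq _ (delay n x)).
Qed.
Lemma nsq_advance n x : nsq (advance n x) <= nsq x.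
Proof. by apply: nsq_le => m; exact: advance_energy. Qed.

(** [A] seen by an observer whose clock starts at time [n]. *)
Definition recenter n (A : l2 -> l2) : l2 -> l2 := advance n \o A \o delay n.

Lemma recenter_Bc n A : Bc A -> Bc (recenter n A).
Proof.
move=> hA; have [a a0 ha] := Bc_bnd hA; apply: (@BcI _ _ a).
- apply: linear_comp (@delay_linear n); apply: linear_comp (Bc_lin hA).
  exact: advance_linear.
- move=> x; apply: norm2_le_sqr => //=; apply: le_trans (nsq_advance _ _) _.
  by rewrite -(nsq_delay n x); exact: bnd_sqr.
- move=> m x sx t tm; rewrite advanceE; apply: (Bc_starts hA (n := m + n)); last by rewrite ltn_add2r.
  move=> k kmn; rewrite delayE; case: ltnP => // nk; apply: sx.
  by rewrite ltn_subLR// addnC.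
Qed.

Lemma delay_recenter n A x : Bc A -> delay n (recenter n A x) = A (delay n x).
Proof.
by move=> hA; apply: delay_advance; apply: Bc_starts hA _ _ (@delay_starts n x).
Qed.

End shifts.

Section time_invariant_plants.
Variable R : realType.
Local Notation l2 := (ell2 R).
Variables (P : signal R -> signal R) (M N Mh Nh : l2 -> l2).
Hypothesis hnp : normalized_pair M N Mh Nh.
Variables (La Lb U V : l2 -> l2).
Hypothesis hc : complement M N Mh Nh La Lb U V.
Variable Minv : signal R -> signal R.
Hypotheses (hMinv : system_inverse (ext M) Minv) (hP : P = ext N \o Minv).
Local Notation F := (graph_map M N).

Lemma plant_graph x : P (ell2_val (M x)) = ell2_val (N x).
Proof.
have [_ _ ViV] := hMinv; have [cM cN _ _ _ _ _] := hnp.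
rewrite hP /= -(ext_ell2 _ cM) -[Minv (ext M _)]/((Minv \o ext M) _) ViV.
exact: ext_ell2.
Qed.

(** The graph of the plant inside [ell2 (+) ell2] is the range of [F]: a causal
    left inverse of [F] recovers the parameter of a graph element. *)
Lemma graph_range A B u v : Bc A -> Bc B -> (forall x, row A B (F x) = x) ->
  P (ell2_val u) = ell2_val v -> F (row A B (u, v)) = (u, v).
Proof.
move=> cA cB hAB huv; have [_ VVi _] := hMinv; have [cM cN _ _ _ _ _] := hnp.
set s := Minv (ell2_val u).
have hu : ell2_val u = ext M s by rewrite -[RHS]/((ext M \o Minv) _) VVi.
have hv : ell2_val v = ext N s by rewrite -huv hP.
have hs : ell2_val (row A B (u, v)) = s.
  rewrite /row -[LHS]/(ell2_val (A u) + ell2_val (B v)).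
  rewrite -(ext_ell2 _ cA) -(ext_ell2 _ cB) hu hv -!ext_comp// -ext_add.
  have -> : (A \o M) + (B \o N) = id by apply/funext => x; exact: hAB.
  by rewrite ext_id.
rewrite /graph_map /op_col; congr (_, _); apply: val_inj => /=.
  by rewrite -(ext_ell2 _ cM) hs hu.
by rewrite -(ext_ell2 _ cN) hs hv.
Qed.

Lemma plant_delay n u v : time_invariant P ->
  P (ell2_val u) = ell2_val v -> P (ell2_val (delay n u)) = ell2_val (delay n v).
Proof.
move=> hT huv; have PS s : P (shift s) = shift (P s).
  by rewrite -[LHS]/((P \o @shift R) s) hT.
rewrite /= -huv; elim: n => // n ih.
by rewrite !iterS PS ih.
Qed.

Lemma plant_advance n u v : time_invariant P ->
  P (ell2_val (delay n u)) = ell2_val (delay n v) -> P (ell2_val u) = ell2_val v.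
Proof.
move=> hT h; have PS s : P (shift s) = shift (P s).
  by rewrite -[LHS]/((P \o @shift R) s) hT.
have e : iter n (@shift R) (P (ell2_val u)) = iter n (@shift R) (ell2_val v).
  rewrite -[RHS]h /=; elim: n {h} => // n ih.
  by rewrite !iterS PS ih.
apply/funext => t; have := congr1 (@^~ (t + n)%N) e.
by rewrite !iter_shiftE ltnNge leq_addl /= addnK.
Qed.

(** For a time-invariant plant the late behaviour of a left inverse is as bad as
    its overall behaviour: recentring at time [n] and correcting by the causal
    unitary relating [F] to its recentred version gives a left inverse of [F]
    whose norm is that of the restriction to inputs starting at [n]. *)
Theorem tail_norm_optimal A B n (c : R) : time_invariant P -> Bc A -> Bc B ->
  (forall x, row A B (F x) = x) -> 0 <= c ->
  (forall w, starts2 n w -> nsq (row A B w) <= c ^+ 2 * nsq2 w) ->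
  optimal_norm M N U V <= c.
Proof.
move=> hT cA cB hAB c0 hw; have [cM cN _ _ _ _ _] := hnp.
have [An Bn Mn Nn] := And4 (recenter_Bc n cA) (recenter_Bc n cB)
  (recenter_Bc n cM) (recenter_Bc n cN).
pose Fn := op_col (recenter n M) (recenter n N).
pose Z := (A \o recenter n M) + (B \o recenter n N).
have cZ : Bc Z by apply: BcD; apply: Bc_comp.
(* [Fn] and [F] are normalized factors of the same plant, hence differ by [Z]. *)
pose Ln := row (recenter n A) (recenter n B).
have FZ x : F (Z x) = Fn x.
  have h : P (ell2_val (recenter n M x)) = ell2_val (recenter n N x).
    by apply: (plant_advance (n := n) hT); rewrite !delay_recenter// plant_graph.
  exact: (graph_range cA cB hAB h).
have LnE x y : delay n (Ln (x, y)) = row A B (delay n x, delay n y).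
  rewrite /Ln /row /= (linD (@delay_linear R n)).
  by rewrite !delay_recenter.
have FnL x : Fn (Ln (F x)) = F x.
  have h : F (row A B (delay n (M x), delay n (N x))) = (delay n (M x), delay n (N x)).
    by apply: (graph_range cA cB hAB); apply: (plant_delay n hT); exact: plant_graph.
  rewrite -LnE in h; rewrite /Fn /op_col /recenter /=.
  by case: h => -> ->; rewrite !advance_delay.
have Zn x : nsq (Z x) = nsq x.
  rewrite -(nsq2_graph hnp (Z x)) FZ -(nsq_delay n x) -(nsq2_graph hnp (delay n x)).
  rewrite /nsq2 /Fn /op_col /= -(nsq_delay n (recenter n M x)) -(nsq_delay n (recenter n N x)).
  by rewrite !delay_recenter.
apply: (@optimal_norm_le_left _ _ _ _ _ hnp _ _ _ _ hc (Z \o recenter n A) (Z \o recenter n B) c) => //.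
- exact: Bc_comp.
- exact: Bc_comp.
- move=> x; rewrite /row /= -(linD (Bc_lin cZ)).
  rewrite -[X in X = _](graph_isometry hnp) -[RHS](graph_isometry hnp); congr graph_adj.
  by rewrite FZ; exact: FnL.
- move=> z; rewrite /row /= -(linD (Bc_lin cZ)) Zn.
  rewrite -[X in nsq X]/(Ln (z.1, z.2)) -(nsq_delay n) LnE.
  apply: le_trans (hw _ _) _; first by split; exact: delay_starts.
  by rewrite /nsq2 /= !nsq_delay.
Qed.

End time_invariant_plants.

(** * Operators assembled from blocks in successive time windows *)

Section block_operators.
Variable R : realType.
Local Notation l2 := (ell2 R).
Local Notation "x .[ t ]" := (ell2_val x t) : ring_scope.
Implicit Types x y : l2.

Variables (n : nat -> nat) (n_lt : forall k, (n k < n k.+1)%N).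

Lemma window_le j k : (j <= k)%N -> (n j <= n k)%N.
Proof.
move=> /subnK <-; elim: (k - j)%N => // d ih.
by rewrite addSn; apply: leq_trans ih (ltnW _).
Qed.

Lemma window_ge k : (k <= n k)%N.
Proof. by elim: k => // k ih; exact: leq_ltn_trans ih (n_lt k). Qed.

Section expansion.
Variable b : nat -> l2.
Hypotheses (bs : forall k, starts (n k) (b k)) (be : forall k, ends (n k.+1) (b k)).

Lemma block_sum_ends (c : nat -> R[i]) K :
  ends (n K) (\sum_(0 <= k < K) c k *: b k).
Proof.
move=> t nt; rewrite ell2_val_sum big_nat_cond big1// => k /andP[/andP[_ kK] _].
by rewrite ell2_valZ be ?mulr0// (leq_trans (window_le kK)).
Qed.

Lemma nsq_block_sum (c : nat -> R[i]) K :
  nsq (\sum_(0 <= k < K) c k *: b k) = \sum_(0 <= k < K) sqnormc (c k) * nsq (b k).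
Proof.
elim: K => [|K ih]; first by rewrite !big_geq// nsq0.
rewrite !big_nat_recr//= -ih -nsqZ; apply: (nsq_headD (m := n K)).
  exact: block_sum_ends.
by apply: startsZ.
Qed.

Lemma bessel : (forall k, nsq (b k) = 1) -> forall x K,
  \sum_(0 <= k < K) sqnormc (inner x (b k)) <= nsq x.
Proof.
move=> b1 x K; set s := \sum_(_ <= _ < _) _.
pose y : l2 := \sum_(0 <= k < K) inner x (b k) *: b k.
have ys : nsq y = s.
  by rewrite nsq_block_sum; apply: eq_bigr => k _; rewrite b1 mulr1.
have xy : inner x y = s%:C%C.
  rewrite (si_sumr (inner_semi R)) rmorph_sum/=; apply: eq_bigr => k _.
  by rewrite (siZr (inner_semi R)) mulrC mulc_conj.
have := cauchy_schwarz (inner_semi R) x y; rewrite xy sqnormcR -!nsqE ys => h.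
have s0 : 0 <= s by apply: sumr_ge0 => k _; exact: sqnormc_ge0.
have [->|sn] := eqVneq s 0; first exact: nsq_ge0.
by rewrite -(@ler_pM2r _ s) -?expr2// lt_neqAle eq_sym sn.
Qed.

End expansion.

Section operator.
Variables (a b : nat -> l2) (A B : R).
Hypotheses (bs : forall k, starts (n k) (b k)) (be : forall k, ends (n k.+1) (b k)).
Hypotheses (ae : forall k, ends (n k).+1 (a k)) (A0 : 0 <= A) (B0 : 0 <= B).
Hypothesis aB : forall x K, \sum_(0 <= k < K) sqnormc (inner x (a k)) <= A ^+ 2 * nsq x.
Hypothesis bB : forall k, nsq (b k) <= B ^+ 2.

Let block_sig x : signal R := fun t => \sum_(0 <= k < t.+1) inner x (a k) * (b k).[t].

Let partial x K : l2 := \sum_(0 <= k < K) inner x (a k) *: b k.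

Let partialE x K t : (t < n K)%N -> (partial x K).[t] = block_sig x t.
Proof.
move=> tK; have z k : (n k > t)%N -> inner x (a k) * (b k).[t] = 0.
  by move=> h; rewrite bs ?mulr0.
have e m : (forall k, (m <= k)%N -> (n k > t)%N) -> forall m', (m <= m')%N ->
    \sum_(0 <= k < m') inner x (a k) * (b k).[t] =
    \sum_(0 <= k < m) inner x (a k) * (b k).[t].
  move=> hm m' mm'; rewrite (@big_cat_nat _ _ _ m)//= [X in _ + X]big_nat_cond.
  by rewrite [X in _ + X]big1 ?addr0// => k /andP[/andP[mk _] _]; rewrite z// hm.
rewrite /partial ell2_val_sum /block_sig.
under eq_bigr do rewrite ell2_valZ.
rewrite -(e K _ (K + t.+1)%N) ?leq_addr//; last first.
  by move=> k Kk; apply: leq_trans tK (window_le Kk).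
rewrite -(e t.+1 _ (K + t.+1)%N) ?leq_addl// => k tk.
by apply: leq_trans tk (window_ge k).
Qed.

Let partial_nsq x K : nsq (partial x K) <= (A * B) ^+ 2 * nsq x.
Proof.
rewrite /partial (nsq_block_sum bs be).
apply: (@le_trans _ _ (\sum_(0 <= k < K) sqnormc (inner x (a k)) * B ^+ 2)).
  by apply: ler_sum => k _; rewrite ler_wpM2l ?sqnormc_ge0.
by rewrite -mulr_suml exprMn mulrAC ler_wpM2r ?sqr_ge0.
Qed.

Let block_energy x m : energy (block_sig x) m <= (A * B) ^+ 2 * nsq x.
Proof.
apply: le_trans (partial_nsq x m); apply: le_trans (energy_le_nsq _ m).
rewrite /energy big_nat_cond [leRHS]big_nat_cond; apply: ler_sum => t /andP[/andP[_ tm] _].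
by rewrite partialE// (leq_trans tm (window_ge m)).
Qed.

(** The operator [x |-> sum_k <x, a k> b k]. The coordinate at time [t] only
    involves finitely many blocks, which gives the sum a meaning without any
    convergence argument. *)
Lemma block_operator : exists D, [/\ Bc D, bnd (A * B) D &
  forall x K, head (n K) (D x) = \sum_(0 <= k < K) inner x (a k) *: b k].
Proof.
pose D x := Ell2 (bounded_energy_summable (block_energy x)).
have DE x K : head (n K) (D x) = partial x K.
  apply: ell2P => t; rewrite headE; case: ltnP => tn; first by rewrite partialE.
  by rewrite (block_sum_ends be).
have bD : bnd (A * B) D.
  move=> x; apply: norm2_le_sqr; first exact: mulr_ge0.
  by apply: nsq_le => m; exact: block_energy.
exists D; split=> //; apply: (BcI _ bD).
- move=> c x y; apply: ell2P => t; rewrite ell2_valD ell2_valZ.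
  rewrite -[LHS]/(block_sig (c *: x + y) t) -[(D x).[t]]/(block_sig x t).
  rewrite -[(D y).[t]]/(block_sig y t) /block_sig mulr_sumr -big_split.
  by apply: eq_bigr => k _ /=; rewrite innerP mulrDl mulrA.
- move=> m x sx t tm; rewrite -[LHS]/(block_sig x t) /block_sig big1// => k _.
  have [tk|kt] := ltnP t (n k); first by rewrite bs ?mulr0.
  have nm : ((n k).+1 <= m)%N by exact: leq_ltn_trans kt tm.
  by rewrite (inner_starts_ends sx (ends_le nm (@ae k))) mul0r.
Qed.

End operator.

Lemma block_single (a b : nat -> l2) D k0 x :
  (forall k, starts (n k) (b k)) ->
  (forall k, ends (n k.+1) (b k)) ->
  (forall x K, head (n K) (D x) = \sum_(0 <= k < K) inner x (a k) *: b k) ->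
  (forall k, inner x (a k) = (k == k0)%:R) -> D x = b k0.
Proof.
move=> bs be hD hx; apply: ell2P => t.
have tn : (t < n (k0 + t.+1))%N by apply: leq_trans (window_ge _); exact: leq_addl.
have := congr1 (fun y => y.[t]) (hD x (k0 + t.+1)%N); rewrite headE tn => ->.
rewrite (bigD1_seq k0) ?mem_index_iota ?iota_uniq//= ?addnS ?ltnS ?leq_addr//.
rewrite hx eqxx scale1r big1 ?addr0// => k kk0.
by rewrite hx (negbTE kk0) scale0r.
Qed.

End block_operators.

Section norms_of_truncations.
Variable R : realType.
Local Notation l2 := (ell2 R).

Lemma norm2_tail_small (x : l2) (e : R) : 0 < e ->
  exists m0, forall m, (m0 <= m)%N -> norm2 (tail m x) <= e.
Proof.
move=> e0; have [m0 h] := tail_small x (exprn_gt0 2 e0); exists m0 => m /h {}h.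
by rewrite norm2E -[e]ger0_norm ?(ltW e0)// -sqrtr_sqr ler_wsqrtr.
Qed.

Lemma norm2_pair_tail_small (z : l2 * l2) (e : R) : 0 < e ->
  exists m0, forall m, (m0 <= m)%N -> norm2_pair (tail2 m z) <= e.
Proof.
move=> e0; have e2 : 0 < e / 2 by rewrite divr_gt0.
have [m1 h1] := norm2_tail_small z.1 e2; have [m2 h2] := norm2_tail_small z.2 e2.
exists (maxn m1 m2) => m; rewrite geq_max => /andP[/h1 {}h1 /h2 {}h2].
by apply: le_trans (norm2_pair_le _) _ => /=; move: h1 h2; lra.
Qed.

Lemma nsq2_le_heads (z : l2 * l2) c : (forall m, nsq2 (head2 m z) <= c) -> nsq2 z <= c.
Proof.
move=> h; rewrite /nsq2 addrC -lerBrDr; apply: nsq_le_heads => m.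
rewrite lerBrDl -lerBrDr; apply: nsq_le_heads => m'; rewrite lerBrDr.
apply: le_trans (h (maxn m m')); rewrite /nsq2 /= !nsq_head.
by rewrite lerD// energy_nd// ?leq_maxl ?leq_maxr.
Qed.

Lemma norm2_le_heads (x : l2) c : 0 <= c -> (forall m, norm2 (head m x) <= c) -> norm2 x <= c.
Proof.
move=> c0 h; rewrite norm2E -[c]ger0_norm// -sqrtr_sqr ler_wsqrtr//.
apply: nsq_le_heads => m; rewrite -norm2_sqr.
by rewrite lerXn2r ?nnegrE ?norm2_ge0.
Qed.

Lemma sum_geometric_le1 K : \sum_(0 <= k < K) (2^-1 : R) ^+ k.+1 <= 1.
Proof.
have e : \sum_(0 <= k < K) (2^-1 : R) ^+ k.+1 = 1 - 2^-1 ^+ K.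
  elim: K => [|K ih]; first by rewrite big_geq// expr0 subrr.
  rewrite big_nat_recr//= ih exprS; lra.
by rewrite e lerBlDr lerDl exprn_ge0// invr_ge0.
Qed.

Lemma row_bounded (A B : l2 -> l2) : Bc A -> Bc B ->
  exists2 l, 0 < l & forall z, norm2 (row A B z) <= l * norm2_pair z.
Proof.
move=> hA hB; have [a a0 ha] := Bc_bnd hA; have [b b0 hb] := Bc_bnd hB.
exists (a + b + 1) => [|z]; first by rewrite ltr_wpDl// addr_ge0.
apply: le_trans (norm2D _ _) _; apply: (@le_trans _ _ ((a + b) * norm2_pair z)).
  rewrite mulrDl; apply: lerD.
    by apply: le_trans (ha _) _; rewrite ler_wpM2l// norm2_fst.
  by apply: le_trans (hb _) _; rewrite ler_wpM2l// norm2_snd.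
by rewrite ler_wpM2r ?norm2_pair_ge0// lerDl.
Qed.

End norms_of_truncations.

(** * Test inputs in time windows *)

Section real_scaling.
Variable R : realType.
Lemma norm2Zr (s : R) (x : ell2 R) : 0 <= s -> norm2 (s%:C%C *: x) = s * norm2 x.
Proof. by move=> s0; rewrite norm2Z sqnormcR sqrtr_sqr ger0_norm. Qed.
Lemma norm2_pairZr (s : R) (z : ell2 R * ell2 R) :
  0 <= s -> norm2_pair (s%:C%C *: z) = s * norm2_pair z.
Proof. by move=> s0; rewrite norm2_pairZ sqnormcR sqrtr_sqr ger0_norm. Qed.
Lemma norm2_unit n : norm2 (unit_vec R n) = 1.
Proof. by rewrite norm2E nsq_unit sqrtr1. Qed.
Lemma head_head m m' (x : ell2 R) : (m <= m')%N -> head m (head m' x) = head m x.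
Proof.
move=> mm; apply: ell2P => t; rewrite !headE; case: ltnP => // tm.
by rewrite (leq_trans tm mm).
Qed.
Lemma norm2_tail_lower m (x : ell2 R) : norm2 x - norm2 (tail m x) <= norm2 (head m x).
Proof. by rewrite lerBlDr -{1}(head_tail m x) norm2D. Qed.
End real_scaling.

Section windows.
Variable R : realType.
Local Notation l2 := (ell2 R).
Local Notation "x .[ t ]" := (ell2_val x t) : ring_scope.
Variables (M N Mh Nh A B U V : l2 -> l2).
Hypothesis hnp : normalized_pair M N Mh Nh.
Hypothesis hc : complement M N Mh Nh A B U V.
Local Notation F := (graph_map M N).
Local Notation G := (cograph_map Mh Nh).
Local Notation L := (row A B).
Local Notation W := (op_col U V).

(** A test input in a finite time window on which [L] is large, with output
    almost confined to the window. The last condition makes the input visible to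
    [G] at the very first time of the window; a small multiple of [W e_n], on
    which [L] vanishes, is added to achieve it. *)
Definition window (beta theta : R) (n : nat) (e : R) (wm : (l2 * l2) * nat) : Prop :=
  let: (w, m) := wm in
  [/\ (n < m)%N, starts2 n w, ends m w.1 /\ ends m w.2, norm2_pair w <= beta &
      [/\ norm2 (head m (L w)) = 1, norm2 (tail m (L w)) <= e,
          norm2 (tail m (G w)) <= e & theta <= sqnormc (G w).[n]]].

Lemma windows_exist (r mu : R) : 0 < r -> 1 < mu * r ->
  (forall n c, 0 <= c -> c < mu ->
     exists2 w, starts2 n w & c ^+ 2 * nsq2 w < nsq (L w)) ->
  exists beta theta, [/\ 0 < beta, beta < r, 0 < theta &
    forall n e, 0 < e -> exists wm, window beta theta n e wm].
Proof.
move=> r0 mr big; have [cA cB cU cV LF GW LW _] := hc.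
have lL : linear L := row_linear (Bc_lin cA) (Bc_lin cB).
have lG : linear G := cograph_linear hnp.
have [cM cN cMh cNh _ _ _] := hnp.
have [l l0 hl] := row_bounded cA cB.
have [c' hc'] := col_bounded cU cV.
pose c := `|c'| + 1; have c0 : 0 < c by rewrite ltr_wpDl.
have {hc'} hW x : norm2_pair (W x) <= c * norm2 x.
  apply: le_trans (hc' x) _; rewrite ler_wpM2r ?norm2_ge0//.
  by apply: le_trans (ler_norm _) _; rewrite lerDl.
pose ir := r^-1; have ir0 : 0 < ir by rewrite invr_gt0.
have irr : ir * r = 1 by rewrite mulVf// gt_eqF.
have irmu : ir < mu by rewrite -(ltr_pM2r r0) irr.
(* [1/r < rho2 < rho < mu]: truncation costs at most [rho - rho2], and [e1] is so
   small that [beta = (1 + e1 c) / rho2] is still below [r]. *)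
pose rho := (ir + mu) / 2; pose rho2 := (ir + rho) / 2.
have [h1 h2 h3] : [/\ ir < rho2, rho2 < rho & rho < mu] by rewrite /rho2 /rho; split; lra.
have rho2_gt0 : 0 < rho2 := lt_trans ir0 h1.
have rho2r : 1 < rho2 * r by rewrite -irr ltr_pM2r.
pose e1 := (rho2 * r - 1) / (2 * c).
have e10 : 0 < e1 by rewrite divr_gt0 ?mulr_gt0 ?subr_gt0.
have e1c : e1 * c = (rho2 * r - 1) / 2 by rewrite /e1; field; rewrite gt_eqF.
pose B1 := 1 + e1 * c; have B10 : 0 < B1 by rewrite /B1 e1c; lra.
pose beta := B1 / rho2.
pose theta := e1 ^+ 2 / (l * B1) ^+ 2.
have lB0 : 0 < l * B1 by rewrite mulr_gt0.
exists beta, theta; split.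
- by rewrite divr_gt0.
- by rewrite /beta ltr_pdivrMr// mulrC /B1 e1c; lra.
- by rewrite divr_gt0// exprn_gt0.
move=> n e e0.
have [w0 sw0 bw0] := big n.+1 rho (ltW (lt_trans rho2_gt0 h2)) h3.
have {}bw0 : rho * norm2_pair w0 < norm2 (L w0).
  rewrite ltNge; apply/negP => h; move: bw0; rewrite ltNge => /negP; apply.
  rewrite -norm2_pair_sqr -norm2_sqr -exprMn.
  have rho_ge0 := ltW (lt_trans rho2_gt0 h2).
  by rewrite lerXn2r ?nnegrE ?norm2_ge0// mulr_ge0// norm2_pair_ge0.
have w0_gt0 : 0 < norm2_pair w0.
  rewrite lt_neqAle eq_sym norm2_pair_ge0 andbT; apply/eqP => z.
  by have := hl w0; move: bw0; rewrite z !mulr0 => /lt_le_trans h /h; rewrite ltxx.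
pose s0 := (norm2_pair w0)^-1; have s00 : 0 < s0 by rewrite invr_gt0.
pose w' := s0%:C%C *: w0.
have nw' : norm2_pair w' = 1 by rewrite norm2_pairZr ?(ltW s00)// mulVf// gt_eqF.
have Lw' : rho < norm2 (L w').
  by rewrite /w' (linZ lL) norm2Zr ?(ltW s00)// mulrC ltr_pdivlMr.
have sw' : starts2 n.+1 w' by case: sw0 => p1 p2; split; exact: startsZ.
pose w1 := w' + e1%:C%C *: W (unit_vec R n).
have nw1 : norm2_pair w1 <= B1.
  apply: le_trans (norm2_pairD _ _) _; rewrite nw' norm2_pairZr ?(ltW e10)// lerD2l.
  by rewrite ler_wpM2l ?(ltW e10)//; have := hW (unit_vec R n); rewrite norm2_unit mulr1.
have Lw1 : L w1 = L w' by rewrite /w1 (linD lL) (linZ lL e1%:C%C) LW scaler0 addr0.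
have sw1 : starts2 n w1.
  have [p1 p2] := sw'; have [p3 p4] := col_starts cU cV (@unit_vec_starts R n).
  by split; [exact: startsD (starts_le (leqnSn n) p1) (startsZ _ p3)
           |exact: startsD (starts_le (leqnSn n) p2) (startsZ _ p4)].
have Gs k z : starts2 k z -> starts k (G z) by apply: row_starts => //; exact: BcN.
have Gw1 : (G w1).[n] = e1%:C%C.
  rewrite /w1 (linD lG) (linZ lG e1%:C%C) GW ell2_valD ell2_valZ unit_vecE eqxx mulr1.
  by rewrite (Gs _ _ sw') ?add0r.
have rr0 : 0 < (rho - rho2) / 2 by lra.
have [m1 hm1] := norm2_pair_tail_small w1 (divr_gt0 rr0 l0).
pose m2 := maxn m1 n.+1; pose w2 := head2 m2 w1.
have tw : norm2_pair (tail2 m2 w1) <= (rho - rho2) / 2 / l by apply: hm1; exact: leq_maxl.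
have w12 : w1 = w2 + tail2 m2 w1.
  rewrite -[RHS]/(head m2 w1.1 + tail m2 w1.1, head m2 w1.2 + tail m2 w1.2).
  by rewrite !head_tail pairE.
have nw2 : norm2_pair w2 <= B1.
  apply: le_trans nw1; rewrite !norm2_pairE ler_wsqrtr// [leRHS](nsq2_head_tail m2).
  by rewrite lerDl nsq2_ge0.
have Lw2 : rho - (rho - rho2) / 2 < norm2 (L w2).
  have : norm2 (L w') <= norm2 (L w2) + norm2 (L (tail2 m2 w1)).
    by rewrite -Lw1 {1}w12 (linD lL) norm2D.
  have : norm2 (L (tail2 m2 w1)) <= (rho - rho2) / 2.
    by apply: le_trans (hl _) _; rewrite mulrC -ler_pdivlMr.
  by move: Lw'; lra.
have Gw2 : (G w2).[n] = e1%:C%C.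
  rewrite -Gw1 w12 (linD lG) ell2_valD [X in _ = _ + X](Gs m2) ?addr0//.
    exact: tail2_starts.
  exact: leq_maxr.
pose e' := Num.min ((rho - rho2) / 2) (e * rho2).
have e'0 : 0 < e' by rewrite lt_min rr0 mulr_gt0.
have [e'1 e'2] : e' <= (rho - rho2) / 2 /\ e' <= e * rho2.
  by rewrite /e'; split; rewrite ge_min lexx ?orbT.
have [m3 hm3] := norm2_tail_small (L w2) e'0.
have [m4 hm4] := norm2_tail_small (G w2) e'0.
pose m := maxn m2 (maxn m3 m4).
have m2m : (m2 <= m)%N by exact: leq_maxl.
have tL : norm2 (tail m (L w2)) <= e'.
  by apply: hm3; apply: leq_trans (leq_maxr _ _); exact: leq_maxl.
have tG : norm2 (tail m (G w2)) <= e'.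
  by apply: hm4; apply: leq_trans (leq_maxr _ _); exact: leq_maxr.
pose sg := norm2 (head m (L w2)).
have sg1 : rho2 < sg by have := norm2_tail_lower m (L w2); rewrite -/sg; lra.
have sg0 : 0 < sg := lt_trans rho2_gt0 sg1.
have sg2 : sg <= l * B1.
  apply: le_trans (norm2_head_le _ _) _; apply: le_trans (hl _) _.
  by rewrite ler_wpM2l ?(ltW l0).
have i0 : 0 <= sg^-1 by rewrite invr_ge0 ltW.
have small x : norm2 x <= e' -> norm2 ((sg^-1)%:C%C *: (x : l2)) <= e.
  move=> hx; rewrite norm2Zr// mulrC ler_pdivrMr//; apply: le_trans hx _.
  by apply: le_trans e'2 _; rewrite ler_wpM2l ?(ltW e0)// ltW.
exists ((sg^-1)%:C%C *: w2, m); split.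
- by apply: leq_trans m2m; exact: leq_maxr.
- split; apply: startsZ => t tn; rewrite headE; case: ifP => // _; [exact: sw1.1|exact: sw1.2].
- by split=> t mt; rewrite ell2_valZ headE ltnNge (leq_trans m2m mt) mulr0.
- rewrite norm2_pairZr// mulrC /beta ler_pdivrMr// mulrAC ler_pdivlMr//.
  by apply: ler_pM; rewrite ?norm2_pair_ge0 ?(ltW rho2_gt0)// ltW.
- rewrite (linZ lL) (linZ lG) !(linZ (@head_linear R m)).
  have tZ x : tail m ((sg^-1)%:C%C *: x) = (sg^-1)%:C%C *: tail m x.
    by rewrite /tail (linZ (@head_linear R m)) scalerBr.
  rewrite !tZ; split; [|exact: small|exact: small|].
    by rewrite norm2Zr// mulVf// gt_eqF.
  rewrite ell2_valZ Gw2 sqnormcM !sqnormcR /theta exprVn mulrC.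
  rewrite ler_wpM2r ?sqr_ge0// lef_pV2 ?posrE ?exprn_gt0//.
  by rewrite lerXn2r ?nnegrE ?(ltW sg0) ?(ltW lB0).
Qed.

End windows.

(** * Destabilizing perturbations *)

Section destabilization.
Variable R : realType.
Local Notation l2 := (ell2 R).
Local Notation "x .[ t ]" := (ell2_val x t) : ring_scope.
Variables (M N Mh Nh A B U V : l2 -> l2).
Hypothesis hnp : normalized_pair M N Mh Nh.
Hypothesis hc : complement M N Mh Nh A B U V.
Local Notation F := (graph_map M N).
Local Notation G := (cograph_map Mh Nh).
Local Notation L := (row A B).
Local Notation opn := (opnorm (@norm2 R) (@norm2_pair R)).

Section window_sequence.
Variables (beta theta : R) (w : nat -> l2 * l2) (n : nat -> nat).
Hypotheses (beta0 : 0 < beta) (theta0 : 0 < theta).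

(** Bound of the detecting operator [K] below, and the tolerances that make all
    errors summable after [K] has acted on them. *)
Definition detector_norm : R := Num.sqrt theta^-1.
Definition tolerance (k : nat) : R := (2 * (1 + detector_norm))^-1 * 2^-1 ^+ k.+1.

Hypothesis hw : forall k, window Mh Nh A B beta theta (n k) (tolerance k) (w k, n k.+1).

Let k0 : 0 <= detector_norm. Proof. exact: sqrtr_ge0. Qed.
Let n_lt k : (n k < n k.+1)%N. Proof. by case: (hw k). Qed.
Let ws k : starts2 (n k) (w k). Proof. by case: (hw k). Qed.
Let we k : ends (n k.+1) (w k).1 /\ ends (n k.+1) (w k).2. Proof. by case: (hw k). Qed.
Let wn k : norm2_pair (w k) <= beta. Proof. by case: (hw k). Qed.

Let u k : l2 := - head (n k.+1) (L (w k)).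

Let cA : Bc A. Proof. by case: hc. Qed.
Let cB : Bc B. Proof. by case: hc. Qed.
Let lL : linear L. Proof. exact: row_linear (Bc_lin cA) (Bc_lin cB). Qed.
Let lG : linear G. Proof. exact: cograph_linear hnp. Qed.

Let us k : starts (n k) (u k).
Proof.
move=> t tn; rewrite ell2_valN headE (row_starts cA cB (ws k))// if_same oppr0//.
Qed.
Let ue k : ends (n k.+1) (u k).
Proof. by move=> t nt; rewrite ell2_valN head_ends// oppr0. Qed.
Let u1 k : nsq (u k) = 1.
Proof.
by have [_ _ _ _ [e _ _ _]] := hw k; rewrite nsqN -norm2_sqr e expr1n.
Qed.
Let Lw k : L (w k) = - u k + tail (n k.+1) (L (w k)).
Proof. by rewrite /u opprK head_tail. Qed.
Let Lw_tail k : norm2 (tail (n k.+1) (L (w k))) <= tolerance k.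
Proof. by have [_ _ _ _ [_ e _ _]] := hw k. Qed.
Let Gw_tail k : norm2 (tail (n k.+1) (G (w k))) <= tolerance k.
Proof. by have [_ _ _ _ [_ _ e _]] := hw k. Qed.
Let Gw_seen k : theta <= sqnormc (G (w k)).[n k].
Proof. by have [_ _ _ _ [_ _ _ e]] := hw k. Qed.

Let u_orth i j : inner (u i) (u j) = (i == j)%:R.
Proof.
have [ij|ij|->] := ltngtP i j.
- exact: inner_ends_starts (ends_le (window_le n_lt ij) (@ue i)) (@us j).
- exact: inner_starts_ends (@us i) (ends_le (window_le n_lt ij) (@ue j)).
- apply: complexP; first by rewrite -nsqE u1.
  exact: Im_si (inner_semi R) _.
Qed.

Let tolerance_gt0 k : 0 < tolerance k.
Proof.
rewrite mulr_gt0 ?exprn_gt0 ?invr_gt0//.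
by rewrite mulr_gt0// ltr_wpDr.
Qed.

Let tolerance_sum K : (\sum_(0 <= k < K) tolerance k) * (1 + detector_norm) <= 2^-1.
Proof.
have d0 : 0 < 1 + detector_norm by rewrite ltr_wpDr.
rewrite /tolerance -mulr_sumr mulrAC invfM divfK ?gt_eqF//.
by rewrite -[leRHS]mulr1 ler_wpM2l ?invr_ge0// sum_geometric_le1.
Qed.

(** The detector maps the trace of [w k] in the output of [G] to [u k]. *)
Let detector : exists K, [/\ Bc K, bnd detector_norm K &
  forall k, K (head (n k.+1) (G (w k))) = u k].
Proof.
pose th k := (G (w k)).[n k].
pose a k : l2 := conjc (th k)^-1 *: unit_vec R (n k).
have inner_a x k : inner x (a k) = (th k)^-1 * x.[n k].
  by rewrite (siZr (inner_semi R)) conjcK inner_unitr.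
have th0 k : th k != 0.
  apply/eqP => z; have := Gw_seen k; rewrite -/(th k) z sqnormc0 leNgt.
  by rewrite theta0.
have ae k : ends (n k).+1 (a k) by move=> t h; rewrite ell2_valZ unit_vec_ends ?mulr0.
have aB x K : \sum_(0 <= k < K) sqnormc (inner x (a k)) <= detector_norm ^+ 2 * nsq x.
  rewrite sqr_sqrtr ?invr_ge0 ?(ltW theta0)//.
  apply: (@le_trans _ _ (\sum_(0 <= k < K) theta^-1 * sqnormc (inner x (unit_vec R (n k))))).
    apply: ler_sum => k _; rewrite inner_a inner_unitr sqnormcM ler_wpM2r ?sqnormc_ge0//.
    by rewrite sqnormcV lef_pV2 ?posrE ?(lt_le_trans theta0 (@Gw_seen k))//; exact: Gw_seen.
  rewrite -mulr_sumr ler_wpM2l ?invr_ge0 ?(ltW theta0)//.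
  apply: (bessel n_lt (b := fun k => unit_vec R (n k))) => k.
  - exact: unit_vec_starts.
  - exact: ends_le (n_lt k) (@unit_vec_ends R (n k)).
  - exact: nsq_unit.
have bB k : nsq (u k) <= 1 ^+ 2 by rewrite u1 expr1n.
have [K [cK bK KE]] := block_operator n_lt us ue ae k0 ler01 aB bB.
rewrite mulr1 in bK; exists K; split=> // k.
apply: (block_single n_lt us ue KE) => j; rewrite inner_a headE.
have [->|jk] := eqVneq j k; first by rewrite n_lt mulVf.
case: ltnP => h; last by rewrite mulr0.
have [kj|kj] := leqP k.+1 j; first by have := window_le n_lt kj; rewrite leqNgt h.
rewrite (_ : (G (w k)).[n j] = 0) ?mulr0//.
apply: (row_starts (BcN (np_Nh hnp)) (np_Mh hnp) (ws k)).
by apply: leq_trans (n_lt j) (window_le n_lt _); rewrite ltn_neqAle jk.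
Qed.

Let a k : l2 := if k is j.+1 then u j else 0.

Let inner_ua j k : inner (u j) (a k) = (k == j.+1)%:R.
Proof.
case: k => [|k]; first by rewrite (si0r (inner_semi R)).
by rewrite u_orth eqSS eq_sym.
Qed.

Let a_le1 k : nsq (a k) <= 1.
Proof. by case: k => [|k]; rewrite ?nsq0 ?ler01 ?u1. Qed.

Let ae k : ends (n k) (a k).
Proof. by case: k => [|k] //; exact: ue. Qed.

Let a_bessel x K : \sum_(0 <= k < K) sqnormc (inner x (a k)) <= nsq x.
Proof.
case: K => [|K]; first by rewrite big_geq// nsq_ge0.
rewrite big_nat_recl//= (si0r (inner_semi R)) sqnormc0 add0r.
exact: (bessel n_lt us ue u1 x K).
Qed.

Let inner_a_le x k : Num.sqrt (sqnormc (inner x (a k))) <= norm2 x.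
Proof.
rewrite norm2E ler_wsqrtr//; apply: le_trans (cauchy_schwarz (inner_semi R) _ _) _.
by rewrite -!nsqE -[leRHS]mulr1 ler_wpM2l ?nsq_ge0.
Qed.

(** The perturbation feeds what [L] has produced in one window into the input of
    the next window. *)
Let perturbation : exists D1 D2, [/\ Bc D1, Bc D2,
  forall x, norm2_pair (op_col D1 D2 x) <= beta * norm2 x,
  (forall x K, head2 (n K) (op_col D1 D2 x) =
     \sum_(0 <= k < K) inner x (a k) *: w k) &
  forall j, op_col D1 D2 (u j) = w j.+1].
Proof.
have a1 x K : \sum_(0 <= k < K) sqnormc (inner x (a k)) <= 1 ^+ 2 * nsq x.
  by rewrite expr1n mul1r a_bessel.
have ae' k : ends (n k).+1 (a k) by exact: ends_le (leqnSn _) (@ae k).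
have w1s k : starts (n k) (w k).1 by have [] := ws k.
have w2s k : starts (n k) (w k).2 by have [] := ws k.
have w1e k : ends (n k.+1) (w k).1 by have [] := we k.
have w2e k : ends (n k.+1) (w k).2 by have [] := we k.
have wB k : nsq2 (w k) <= beta ^+ 2.
  rewrite -norm2_pair_sqr lerXn2r ?nnegrE ?norm2_pair_ge0 ?(ltW beta0)//.
have w1B k : nsq (w k).1 <= beta ^+ 2 by apply: le_trans (wB k); rewrite lerDl nsq_ge0.
have w2B k : nsq (w k).2 <= beta ^+ 2 by apply: le_trans (wB k); rewrite lerDr nsq_ge0.
have [D1 [cD1 _ D1E]] := block_operator n_lt w1s w1e ae' ler01 (ltW beta0) a1 w1B.
have [D2 [cD2 _ D2E]] := block_operator n_lt w2s w2e ae' ler01 (ltW beta0) a1 w2B.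
exists D1, D2; split=> //.
- move=> x; apply: norm2_pair_le_sqr; first exact: ltW.
  apply: nsq2_le_heads => m.
  apply: (@le_trans _ _ (nsq2 (head2 (n m) (op_col D1 D2 x)))).
    rewrite /nsq2 /= !nsq_head lerD// energy_nd//; exact: window_ge.
  rewrite /nsq2 /= D1E D2E (nsq_block_sum n_lt w1s w1e) (nsq_block_sum n_lt w2s w2e) -big_split /=.
  apply: (@le_trans _ _ (\sum_(0 <= k < m) beta ^+ 2 * sqnormc (inner x (a k)))).
    apply: ler_sum => k _; rewrite -mulrDr mulrC ler_wpM2r ?sqnormc_ge0//.
    exact: wB.
  by rewrite -mulr_sumr ler_wpM2l ?sqr_ge0.
- move=> x K; rewrite /head2 /op_col /= D1E D2E.
  elim: K => [|K ih]; first by rewrite !big_geq.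
  by rewrite !big_nat_recr//= -ih.
- move=> j; rewrite /op_col -[RHS]pairE; congr (_, _).
    by apply: (block_single n_lt w1s w1e D1E) => k; exact: inner_ua.
  by apply: (block_single n_lt w2s w2e D2E) => k; exact: inner_ua.
Qed.

Lemma chain_perturbation (hM : forall t, diag_entry M t != 0) :
  exists M1 N1 P1, [/\ right_coprime_factorization P1 M1 N1,
    opn (op_col M N - op_col M1 N1) <= beta &
    forall c, exists v, c * norm2 (L (op_col M1 N1 v)) < norm2 v].
Proof.
have [K [cK bK KE]] := detector.
have [D1 [D2 [cD1 cD2 Dn DE Du]]] := perturbation.
have [cM cN cMh cNh _ _ _] := hnp.
have lK := Bc_lin cK.
pose M1 := M + D1; pose N1 := N + D2.
have cM1 : Bc M1 by exact: BcD.
have cN1 : Bc N1 by exact: BcD.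
have F1E x : op_col M1 N1 x = F x + op_col D1 D2 x by [].
have cQ : Bc (- K) by exact: BcN.
have [cA' cB' _ _ LF' _ _ _] := complement_shift hnp hc cQ.
set A' := A + (- K \o Nh) in cA' LF'; set B' := B - (- K \o Mh) in cB' LF'.
have LE z : row A' B' z = L z + K (G z).
  by rewrite (left_shiftE _ _ _ _ _ (Bc_lin cQ)) -[(- K) _]/(- K _) opprK.
have lL' : linear (row A' B') by exact: row_linear (Bc_lin cA') (Bc_lin cB').
have Lw' k : norm2 (row A' B' (w k)) <= tolerance k * (1 + detector_norm).
  rewrite LE -(head_tail (n k.+1) (G (w k))) (linD lK) KE Lw addrACA addNr add0r.
  apply: le_trans (norm2D _ _) _; rewrite mulrDr mulr1; apply: lerD; first exact: Lw_tail.
  by apply: le_trans (bK _) _; rewrite mulrC ler_wpM2r// Gw_tail.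
(* The detector cancels the main part [- u k] of [L (w k)], so that only the tails
   contribute, and these are summable. *)
have LD x : norm2 (row A' B' (op_col D1 D2 x)) <= 2^-1 * norm2 x.
  apply: norm2_le_heads; first by rewrite mulr_ge0 ?norm2_ge0// invr_ge0.
  move=> m; rewrite -(head_head _ (window_ge n_lt m)); apply: le_trans (norm2_head_le _ _) _.
  have -> : head (n m) (row A' B' (op_col D1 D2 x)) =
            head (n m) (row A' B' (head2 (n m) (op_col D1 D2 x))).
    by rewrite (row_head _ _ cA' cB').
  apply: le_trans (norm2_head_le _ _) _; rewrite DE (lin_sum lL').
  apply: le_trans (norm2_sum _ _) _.
  apply: (@le_trans _ _ (\sum_(0 <= k < m) norm2 x * (tolerance k * (1 + detector_norm)))).
    apply: ler_sum => k _; rewrite (linZ lL') norm2Z.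
    by apply: ler_pM; rewrite ?sqrtr_ge0 ?norm2_ge0.
  by rewrite -mulr_sumr -mulr_suml mulrC ler_wpM2r ?norm2_ge0.
pose J := (A' \o M1) + (B' \o N1).
have cJ : Bc J by apply: BcD; apply: Bc_comp.
have JE x : J x = row A' B' (op_col M1 N1 x) by [].
have half : 2^-1 < 1 :> R by rewrite invf_lt1// ltr1n.
have [|J' [cJ' JJ' J'J]] := small_perturbation_inverse cJ half.
  by move=> x; rewrite JE F1E (linD lL') LF' addrAC subrr add0r.
have dD t : diag_entry D1 t = 0.
  have := congr1 (fun z => z.1.[t]) (DE (unit_vec R t) t.+1).
  rewrite /= headE (window_ge n_lt t.+1) /diag_entry => ->.
  have -> : (\sum_(0 <= k < t.+1) inner (unit_vec R t) (a k) *: w k).1 =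
            \sum_(0 <= k < t.+1) inner (unit_vec R t) (a k) *: (w k).1.
    by elim: t.+1 => [|m ih]; [rewrite !big_geq|rewrite !big_nat_recr//= ih].
  rewrite ell2_val_sum big1// => k _; rewrite ell2_valZ.
  have [tk|kt] := ltnP t (n k); first by rewrite (ws k).1 ?mulr0.
  by rewrite (inner_starts_ends (@unit_vec_starts R t) (ends_le kt (@ae k))) mul0r.
have dM1 t : diag_entry M1 t != 0.
  by rewrite -[diag_entry M1 t]/(diag_entry M t + diag_entry D1 t) dD addr0; exact: hM.
have [M1inv hM1] := entry_system_inverse cM1 dM1.
exists M1, N1, (ext N1 \o M1inv); split.
- split=> //; last by exists M1inv.
  exists (J' \o B'), (J' \o A'); split; try exact: Bc_comp.
  apply/funext => x; rewrite !fctE /= -(linD (Bc_lin cJ')) addrC.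
  exact: J'J.
- apply: opnorm_le (ltW beta0) _ => x.
  have -> : (op_col M N - op_col M1 N1) x = - op_col D1 D2 x.
    rewrite -[LHS]/(F x - op_col M1 N1 x) F1E opprD addrA subrr add0r//.
  by rewrite norm2_pairN.
(* For the sum [v] of [kk] orthonormal vectors [u j], the images under [L F1]
   telescope to [u 0 - u kk] up to the tails, while [|v|^2 = kk]. *)
- move=> c; pose kk := Num.bound ((3 * `|c|) ^+ 2).
  pose v : l2 := \sum_(0 <= j < kk) (fun=> 1) j *: u j.
  have nv : nsq v = kk%:R.
    rewrite /v (nsq_block_sum n_lt us ue).
    under eq_bigr do rewrite sqnormc1 mul1r u1.
    by rewrite sumr_const_nat subn0.
  have Lv : L (op_col M1 N1 v) =
      u 0 - u kk + \sum_(0 <= j < kk) tail (n j.+2) (L (w j.+1)).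
    have lF1 : linear (op_col M1 N1) := col_linear (Bc_lin cM1) (Bc_lin cN1).
    rewrite /v (lin_sum lF1) (lin_sum lL).
    have -> : u 0 - u kk = \sum_(0 <= j < kk) (u j - u j.+1).
      by under eq_bigr do rewrite -opprB; rewrite sumrN telescope_sumr// opprB.
    rewrite -big_split; apply: eq_bigr => j _ /=.
    by rewrite scale1r F1E (linD lL) (left_graph hc) Du [in LHS]Lw addrA.
  have nLv : norm2 (L (op_col M1 N1 v)) <= 3.
    rewrite Lv; apply: le_trans (norm2D _ _) _.
    have nu k : norm2 (u k) = 1 by rewrite norm2E u1 sqrtr1.
    have h1 : norm2 (u 0 - u kk) <= 2.
      by apply: le_trans (norm2D _ _) _; rewrite norm2N !nu; lra.
    have h2 : norm2 (\sum_(0 <= j < kk) tail (n j.+2) (L (w j.+1))) <= 1.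
      apply: le_trans (norm2_sum _ _) _; apply: le_trans (sum_geometric_le1 R kk).
      apply: ler_sum => j _; apply: le_trans (Lw_tail _) _; rewrite /tolerance exprS mulrA.
      rewrite -[leRHS]mul1r ler_wpM2r ?exprn_ge0 ?invr_ge0//.
      have d1 : 1 <= 1 + detector_norm by rewrite lerDl.
      set d := 1 + detector_norm in d1 *.
      have i1 : (2 * d)^-1 <= 1 by rewrite invf_le1 ?mulr_gt0 ?(lt_le_trans ltr01)//; lra.
      by apply: mulr_ile1 => //; rewrite ?invr_ge0 ?mulr_ge0 ?(le_trans ler01 d1)// invf_le1// ler1n.
    lra.
  exists v; apply: (@le_lt_trans _ _ (3 * `|c|)).
    apply: le_trans (ler_norm _) _; rewrite normrM mulrC ler_wpM2r//.
    by rewrite ger0_norm ?norm2_ge0.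
  rewrite norm2E nv -[ltLHS]ger0_norm ?mulr_ge0// -sqrtr_sqr ltr_sqrt.
    exact: archi_boundP (sqr_ge0 _).
  by apply: le_lt_trans (archi_boundP (sqr_ge0 (3 * `|c|))); exact: sqr_ge0.
Qed.

End window_sequence.

(** If the norm of [L] on late inputs stays above [1 / r], then some perturbation of
    norm less than [r] leaves [F1] left invertible but [L F1] not bounded below.
    The windows follow each other without gaps, each starting where the previous
    one ends. *)
Theorem destabilizing_perturbation (r mu : R) :
  0 < r -> 1 < mu * r -> (forall t, diag_entry M t != 0) ->
  (forall n c, 0 <= c -> c < mu ->
     exists2 w, starts2 n w & c ^+ 2 * nsq2 w < nsq (L w)) ->
  exists M1 N1 P1, [/\ right_coprime_factorization P1 M1 N1,
    opn (op_col M N - op_col M1 N1) < r &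
    forall c, exists v, c * norm2 (L (op_col M1 N1 v)) < norm2 v].
Proof.
move=> r0 mr hM big.
have [beta [theta [beta0 br theta0 H]]] := windows_exist hnp hc r0 mr big.
have tol0 k : 0 < tolerance theta k.
  rewrite mulr_gt0 ?exprn_gt0 ?invr_gt0// mulr_gt0// ltr_wpDr//.
  exact: sqrtr_ge0.
have H' (kn : nat * nat) : exists wm,
    window Mh Nh A B beta theta kn.2 (tolerance theta kn.1) wm.
  exact: H.
have [pick hpick] := choice H'.
pose n := fix n k := if k is j.+1 then (pick (j, n j)).2 else 0%N.
have [|M1 [N1 [P1 [h1 h2 h3]]]] := @chain_perturbation beta theta
  (fun k => (pick (k, n k)).1) n beta0 theta0 _ hM.
  by move=> k; have := hpick (k, n k); rewrite /=; case: (pick _).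
by exists M1, N1, P1; split=> //; exact: le_lt_trans h2 br.
Qed.

End destabilization.

(** * Controllers and left inverses *)

Section controllers.
Variable R : realType.
Local Notation l2 := (ell2 R).
Variables (P : signal R -> signal R) (M N Mh Nh : l2 -> l2).
Hypothesis hnp : normalized_pair M N Mh Nh.
Variables (La Lb U V : l2 -> l2).
Hypothesis hc : complement M N Mh Nh La Lb U V.
Variable Minv : signal R -> signal R.
Hypotheses (hMinv : system_inverse (ext M) Minv) (hP : P = ext N \o Minv).
Local Notation F := (graph_map M N).
Local Notation opn := (opnorm (@norm2 R) (@norm2_pair R)).
Local Notation mu := (optimal_norm M N U V).

Lemma causal_pair_starts (S : l2 * l2 -> l2 * l2) n z : linear S ->
  (forall k z, trunc_pair k (S (trunc_pair k z)) = trunc_pair k (S z)) ->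
  starts2 n z -> starts2 n (S z).
Proof.
move=> lS cS; case: n => // n [s1 s2].
have e : trunc_pair n z = 0.
  by congr (_, _); [exact: (starts_head s1)|exact: (starts_head s2)].
have := cS n z; rewrite e (lin0 lS) => h.
have h0 : head n.+1 (0 : l2) = 0 by apply: starts_head.
split; apply: head_starts.
  by have := congr1 fst h; rewrite -[LHS]/(head n.+1 0) h0.
by have := congr1 snd h; rewrite -[LHS]/(head n.+1 0) h0.
Qed.

(** A stabilizing controller is determined by a causal left inverse [L] of [F],
    namely the parameter in [F] of the graph element that the loop assigns to an
    exogenous signal; if it also stabilizes [N1 M1^-1], then [L F1] is bounded
    below. *)
Theorem stabilizing_left_inverse C : causal_system C -> stabilizes C P ->
  exists A B, [/\ Bc A, Bc B, forall x, row A B (F x) = x &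
    forall P1 M1 N1, right_coprime_factorization P1 M1 N1 -> stabilizes C P1 ->
      exists c, forall v, norm2 v <= c * norm2 (row A B (op_col M1 N1 v))].
Proof.
move=> [lC cC] [S [[lS [s hs]] tS TS ST]].
have [cM cN _ _ _ _ _] := hnp; have [cLa cLb _ _ LF _ _ _] := hc.
have S2 w : P (ell2_val (S w).1) = ell2_val (w.2 - (S w).2).
  have := congr1 snd (TS w); rewrite /op_block /= => h.
  by rewrite -[RHS]/(ell2_val w.2 - ell2_val (S w).2) -h addrK.
have S1 w : ell2_val (S w).1 + C (ell2_val (S w).2) = ell2_val w.1.
  exact: (congr1 fst (TS w)).
pose D w := row La Lb ((S w).1, w.2 - (S w).2).
have FD w : F (D w) = ((S w).1, w.2 - (S w).2).
  exact: (graph_range hnp hMinv hP cLa cLb LF (S2 w)).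
have lrow := row_linear (Bc_lin cLa) (Bc_lin cLb).
have lD : linear D.
  move=> a x y; rewrite /D lS -lrow; congr (row _ _ (_, _)).
  by rewrite /= scalerBr opprD addrACA.
have [l l0 hl] := row_bounded cLa cLb.
have bD w : norm2 (D w) <= l * (1 + 2 * `|s|) * norm2_pair w.
  apply: le_trans (hl _) _; rewrite -mulrA ler_wpM2l ?(ltW l0)//.
  apply: le_trans (norm2_pair_le _) _ => /=.
  have hS : norm2_pair (S w) <= `|s| * norm2_pair w.
    by apply: le_trans (hs w) _; rewrite ler_wpM2r ?norm2_pair_ge0// ler_norm.
  have e1 := norm2_fst (S w); have e2 := norm2_snd (S w); have e3 := norm2_snd w.
  have e4 : norm2 (w.2 - (S w).2) <= norm2 w.2 + norm2 (S w).2.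
    by apply: le_trans (norm2D _ _) _; rewrite norm2N.
  rewrite mulrDl mul1r -mulrA; lra.
have sD n w : starts2 n w -> starts n (D w).
  move=> sw; have [h1 h2] := causal_pair_starts lS tS sw.
  by apply: (row_starts cLa cLb); split=> //=; apply: startsB => //; case: sw.
have pair10 x : norm2_pair ((x, 0) : l2 * l2) = norm2 x.
  by rewrite norm2_pairE norm2E /nsq2 /= nsq0 addr0.
have pair01 x : norm2_pair ((0, x) : l2 * l2) = norm2 x.
  by rewrite norm2_pairE norm2E /nsq2 /= nsq0 add0r.
pose A x := D (x, 0); pose B x := D (0, x).
have cA : Bc A.
  apply: (@BcI _ _ (l * (1 + 2 * `|s|))).
  - move=> a x y; rewrite /A -lD; congr (D (_, _)).
    by rewrite /= scaler0 addr0.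
  - by move=> x; have := bD (x, 0); rewrite pair10.
  - by move=> n x sx; apply: sD; split.
have cB : Bc B.
  apply: (@BcI _ _ (l * (1 + 2 * `|s|))).
  - move=> a x y; rewrite /B -lD; congr (D (_, _)).
    by rewrite /= scaler0 addr0.
  - by move=> x; have := bD (0, x); rewrite pair01.
  - by move=> n x sx; apply: sD; split.
have AB w : row A B w = D w.
  rewrite /row /A /B -(linD lD); congr D; case: w => w1 w2.
  by congr (_, _); rewrite /= ?addr0 ?add0r.
exists A, B; split=> //.
- move=> x; rewrite AB /D.
  have -> : S (F x) = (M x, 0).
    apply: ST; rewrite -[LHS]/(ell2_val (M x) + C 0, P (ell2_val (M x)) + 0).
    by rewrite (lin0 lC) !addr0 (plant_graph hnp hMinv hP).
  by rewrite /= subr0; exact: LF.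
- move=> P1 M1 N1 [cM1 cN1 [X [Y [cX cY XY]]] [M1inv [_ _ MiM] hP1]].
  move=> [S' [[lS' [s' hs']] _ _ ST']].
  have [X' X'0 hX] := Bc_bnd cX; have [Y' Y'0 hY] := Bc_bnd cY.
  exists (X' * (1 + `|s'|) + Y' * `|s'|) => v; set x := row A B _.
  have xE : F x = ((S (op_col M1 N1 v)).1, N1 v - (S (op_col M1 N1 v)).2).
    by rewrite /x AB FD.
  set w := op_col M1 N1 v in xE.
  have Mx : (S w).1 = M x by have := congr1 fst xE.
  have Nx : (S w).2 = N1 v - N x.
    by have := congr1 snd xE; rewrite /= => ->; rewrite opprB addrC subrK.
  have S'x : S' (F x) = (M1 v, N x - N1 v).
    have CM : ell2_val (M x) + C (ell2_val (N1 v) - ell2_val (N x)) = ell2_val (M1 v).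
      by rewrite -[RHS](S1 w) Mx Nx.
    have PM : P1 (ell2_val (M1 v)) = ell2_val (N1 v).
      by rewrite hP1 /= -(ext_ell2 _ cM1) -[M1inv (ext M1 _)]/((M1inv \o ext M1) _) MiM ext_ell2.
    apply: ST'; rewrite -[LHS]/(ell2_val (M1 v) + C (ell2_val (N x) - ell2_val (N1 v)),
                                P1 (ell2_val (M1 v)) + (ell2_val (N x) - ell2_val (N1 v))).
    rewrite PM -[in X in (X, _)]CM -addrA -(linD lC) addrA subrK subrr (lin0 lC) addr0.
    by rewrite [X in (_, X)]addrC subrK.
  have nF : norm2_pair (F x) = norm2 x.
    by rewrite norm2_pairE norm2E (nsq2_graph hnp).
  have hS' : norm2_pair (S' (F x)) <= `|s'| * norm2 x.
    by rewrite -nF; apply: le_trans (hs' _) _; rewrite ler_wpM2r ?norm2_pair_ge0// ler_norm.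
  have nM : norm2 (M1 v) <= `|s'| * norm2 x.
    by apply: le_trans hS'; rewrite S'x; exact: (norm2_fst (M1 v, _)).
  have nN : norm2 (N1 v) <= (1 + `|s'|) * norm2 x.
    have h1 : norm2 (N x - N1 v) <= `|s'| * norm2 x.
      by apply: le_trans hS'; rewrite S'x; exact: (norm2_snd (_, N x - N1 v)).
    have h2 : norm2 (N x) <= norm2 x by rewrite -nF; exact: (norm2_snd (F x)).
    have : norm2 (N1 v) <= norm2 (N x) + norm2 (N x - N1 v).
      rewrite -[norm2 (N x - N1 v)]norm2N; apply: le_trans (norm2D _ _).
      by rewrite opprB addrCA subrr addr0.
    by rewrite mulrDl mul1r; lra.
  have {1}-> : v = X (N1 v) + Y (M1 v) by have := congr1 (@^~ v) XY.
  apply: le_trans (norm2D _ _) _; rewrite mulrDl; apply: lerD.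
    by apply: le_trans (hX _) _; rewrite -mulrA ler_wpM2l.
  by apply: le_trans (hY _) _; rewrite -mulrA ler_wpM2l.
Qed.

(** [mu r < 1] leaves room for the parameter attaining [mu] and for the correction
    by [d] that makes the denominator invertible. *)
Lemma robust_controller (r : R) : 0 <= r -> mu * r < 1 ->
  exists2 C, causal_system C & forall P1, factor_ball M N r P1 -> stabilizes C P1.
Proof.
move=> r0 mr; have [Q hQ hW] := optimal_attained hnp hc.
have m1 := optimal_norm_ge1 hnp hc.
have hcQ := youla_column_cp hnp hc hQ.
have r1 : 0 < r + 1 by rewrite ltr_wpDl.
pose d := (1 - mu * r) / (r + 1); have d0 : 0 < d by rewrite divr_gt0// subr_gt0.
have dr : d * r <= 1 - mu * r.
  by rewrite /d mulrAC ler_pdivrMr// ler_wpM2l ?subr_ge0 ?(ltW mr)// lerDl.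
have M0 t : diag_entry M t != 0 by exact: system_inverse_entry (np_M hnp) hMinv.
have [D [cD bD dV]] := invertible_denominator hnp hcQ d0 M0.
have hcD := complement_shift hnp hcQ cD.
have [_ _ cU' cV' _ _ _ _] := hcD.
have [Vinv hV] := entry_system_inverse cV' dV.
exists (ext (U + (M \o Q) + (M \o D)) \o Vinv).
  by apply: causal_comp (ext_causal cU') _; case: hV.
move=> P1; apply: (small_gain hnp hcD (c := mu + d)) hV => //.
- by rewrite addr_ge0// ?(ltW d0)// (le_trans _ m1).
- move=> x; apply: nsq2_le_sqr; first by rewrite addr_ge0// ?(ltW d0)// (le_trans _ m1).
  have -> : op_col (U + (M \o Q) + (M \o D)) (V + (N \o Q) + (N \o D)) x
      = youla_column M N U V Q x + F (D x) by [].
  apply: le_trans (norm2_pairD _ _) _; rewrite mulrDl; apply: lerD.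
    by apply: norm2_pair_le_sqr => //; rewrite (le_trans _ m1).
  by rewrite norm2_pairE (nsq2_graph hnp) -norm2E; exact: bD.
- by rewrite mulrDl; lra.
Qed.

(** The left inverse of [F] given by the loop is large on late inputs, so a
    perturbed plant in the ball destroys the lower bound that stability of its
    loop would imply. *)
Lemma no_robust_controller (r : R) C : time_invariant P -> right_coprime_factorization P M N ->
  causal_system C -> (forall P1, factor_ball M N r P1 -> stabilizes C P1) ->
  0 < r -> mu * r <= 1.
Proof.
move=> hT hrcf hC hS r0; rewrite leNgt; apply/negP => mr.
have [|A [B [cA cB ABF hAB]]] := stabilizing_left_inverse hC _.
  apply: hS; exists M, N; split=> //; apply: le_lt_trans r0.
  by apply: opnorm_le => // x; rewrite subrr norm2_pair0 mul0r.
have [Q hQ hcQ] := complement_of_left hnp hc cA cB ABF.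
have M0 t : diag_entry M t != 0 by exact: system_inverse_entry (np_M hnp) hMinv.
have big n c : 0 <= c -> c < mu ->
    exists2 w, starts2 n w & c ^+ 2 * nsq2 w < nsq (row A B w).
  move=> c0 cmu; apply: contrapT => hn; move: cmu; rewrite ltNge => /negP; apply.
  apply: (tail_norm_optimal hnp hc hMinv hP (n := n) hT cA cB ABF c0) => w sw.
  by rewrite leNgt; apply/negP => hw; apply: hn; exists w.
have [M1 [N1 [P1 [h1 h2 h3]]]] := destabilizing_perturbation hnp hcQ r0 mr M0 big.
have [|c hcv] := hAB _ _ _ h1 (hS P1 _); first by exists M1, N1.
by have [v] := h3 c; rewrite ltNge hcv.
Qed.

End controllers.

(** * The theorem *)

Theorem theorem3 (R : realType) (P : signal R -> signal R)
    (M N Mh Nh U V Uh Vh : ell2 R -> ell2 R) :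
  causal_system P -> stabilizable P ->
  normalized_rcf P M N -> normalized_lcf P Mh Nh ->
  Bc U -> Bc V -> Bc Uh -> Bc Vh ->
  op_block Vh (- Uh) (- Nh) Mh \o op_block M U N V = id ->
  op_block M U N V \o op_block Vh (- Uh) (- Nh) Mh = id ->
  let r_o : R := 
    (inf [set opnorm (@norm2 R) (@norm2_pair R) (op_col U V + (op_col M N \o Q)) |
            Q in @Bc R])^-1 in
  let r_opt : \bar R := stability_margin M N in
  [/\ 0 < r_o,
      r_o ^+ 2 = 1 - hankel_norm (adj Mh) (adj Nh) ^+ 2,
      (r_opt^-1 <= (r_o^-1)%:E)%E &
      time_invariant P -> r_o%:E = r_opt].
Proof.
move=> _ _ [hrcf iso] [[cMh cNh _ _] coiso] cU cV cUh cVh hl hr.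
have [cM cN _ [Minv hMinv hP]] := hrcf.
have hnp : normalized_pair M N Mh Nh.
  split=> //.
  - by move=> x; have := congr1 (@^~ x) iso.
  - move=> y; have e : Mh (adj Mh y) + Nh (adj Nh y) = y := congr1 (@^~ y) coiso.
    rewrite -[RHS]e -[LHS]/(- Nh (- adj Nh y) + Mh (adj Mh y)) (linN (Bc_lin cNh)).
    by rewrite opprK addrC.
  - move=> x; have := congr1 (fun T => (T (x, 0)).2) hl.
    by rewrite /op_block /= (lin0 (Bc_lin cU)) (lin0 (Bc_lin cV)) !addr0.
have hc : complement M N Mh Nh Vh (- Uh) U V.
  split=> //; first exact: BcN.
  - move=> x; have := congr1 (fun T => (T (x, 0)).1) hl.
    by rewrite /op_block /= (lin0 (Bc_lin cU)) (lin0 (Bc_lin cV)) !addr0.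
  - move=> y; have := congr1 (fun T => (T (0, y)).2) hl.
    by rewrite /op_block /= (lin0 (Bc_lin cM)) (lin0 (Bc_lin cN)) !add0r.
  - move=> y; have := congr1 (fun T => (T (0, y)).1) hl.
    by rewrite /op_block /= (lin0 (Bc_lin cM)) (lin0 (Bc_lin cN)) !add0r.
  - by move=> z; have := congr1 (fun T => T z) hr.
move=> r_o r_opt; pose mu := optimal_norm M N U V.
have m1 : 1 <= mu := optimal_norm_ge1 hnp hc.
have m0 : 0 < mu := lt_le_trans ltr01 m1.
have r_oE : r_o = mu^-1 by [].
have ro0 : 0 < r_o by rewrite r_oE invr_gt0.
have lower : (r_o%:E <= r_opt)%E.
  apply/lee_addgt0Pr => e e0; pose r := Num.max 0 (r_o - e).
  have rm : mu * r < 1.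
    rewrite -ltr_pdivlMl// mulr1 -r_oE /r gt_max ro0 /=; lra.
  have r0 : 0 <= r by rewrite le_max lexx.
  apply: (@le_trans _ _ (r%:E + e%:E)%E).
    by rewrite -EFinD lee_fin /r -lerBlDr le_max lexx orbT.
  rewrite leeD2r//; apply: ereal_sup_ubound; exists r => //; split=> //.
  exact: (robust_controller hnp hc hMinv).
split=> //.
- exact: (optimal_norm_hankel hnp hc).
- case: r_opt lower => [s| |].
  + rewrite lee_fin => rs; have s0 := lt_le_trans ro0 rs.
    by rewrite inver gt_eqF// lee_fin lef_pV2 ?posrE.
  + by move=> _; rewrite invey lee_fin invr_ge0 ltW.
  + by rewrite leeNy_eq /=.
- move=> hT; apply/eqP; rewrite eq_le lower /=; apply: ge_ereal_sup => _ [r [r0 [C hC hS]] <-].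
  rewrite lee_fin r_oE; have [->|rn] := eqVneq r 0; first by rewrite invr_ge0 ltW.
  rewrite -[leRHS]mulr1 ler_pdivlMl//.
  apply: (no_robust_controller hnp hc hMinv hP hT hrcf hC hS).
  by rewrite lt_neqAle eq_sym rn.
Qed.
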